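(* Let $2\le p<\infty$, let $q\in(2,\infty]$ satisfy $1/p+1/q=1/2$, and let $\Phi\in L^p(\mathbb{M}_n)$. Then $$\|\boldsymbol H_\Phi\|_{H^q(\boldsymbol S_2^n)\to H^2_-(\boldsymbol S_2^n)}=\operatorname{dist}_{L^p}\big(\Phi,H^p(\mathbb{M}_n)\big).$$
   Context: $\mathbb{M}_n$ is the space of $n\times n$ complex matrices with the operator norm; $\boldsymbol S_2^n$ is the same space with the Hilbert–Schmidt norm. $L^p(\mathbb{M}_n)$ is the space of matrix functions on the unit circle $\mathbb{T}$ (normalized Lebesgue measure $\boldsymbol m$) with norm $\|\Phi\|_{L^p}=\big(\int_{\mathbb T}\|\Phi(\zeta)\|_{\mathbb{M}_n}^p\,d\boldsymbol m(\zeta)\big)^{1/p}$; distances to $H^p(\mathbb M_n)$ are taken in this norm. $L^q(\boldsymbol S_2^n)$ has norm $\big\|\,\|F(\cdot)\|_{\boldsymbol S_2^n}\big\|_{L^q}$. $H^s(\cdot)$ denotes the subspace of functions with entries in the Hardy class $H^s$. $H^2_-(\boldsymbol S_2^n)=L^2(\boldsymbol S_2^n)\ominus H^2(\boldsymbol S_2^n)$, $\mathbb{P}_-$ is the orthogonal projection onto it, and $\boldsymbol H_\Phi:H^q(\boldsymbol S_2^n)\to H^2_-(\boldsymbol S_2^n)$ is defined by $\boldsymbol H_\Phi F=\mathbb{P}_-\Phi F$. *)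

(* Defs.v *)
From HB Require Import structures.
From mathcomp Require Import all_boot all_order all_algebra.
From mathcomp Require Import all_classical all_reals all_analysis.
From mathcomp Require Import measurable_realfun.
From mathcomp Require Import complex.

Set Implicit Arguments.
Unset Strict Implicit.
Unset Printing Implicit Defensive.

Import Order.TTheory GRing.Theory Num.Theory.
Import numFieldNormedType.Exports.
Import ComplexField.Normc.

Local Open Scope classical_set_scope.
Local Open Scope ring_scope.

Section UnitCircle.
Variable R : realType.

Definition unit_complex := {z : R[i] | `|z| == 1}.

Lemma unit_complex_1 : `|1 : R[i]| == 1. Proof. by rewrite normr1. Qed.

HB.instance Definition _ := Choice.on unit_complex.
HB.instance Definition _ :=
  isPointed.Build unit_complex (exist _ (1 : R[i]) unit_complex_1).

Definition unit_coords (z : unit_complex) : R * R :=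
  (complex.Re (val z), complex.Im (val z)).

(* The unit circle with the sigma-algebra of the traces of the Borel sets of
   the plane. *)
Definition circle := g_sigma_algebra_preimageType unit_coords.

HB.instance Definition _ := Measurable.on circle.

Definition circle_val (z : circle) : R[i] := val (z : unit_complex).

Lemma expi_unit (t : R) : `|(cos t +i* sin t)%C| == 1.
Proof. by rewrite normc_def /= cos2Dsin2 sqrtr1. Qed.

Definition expi (t : measurableTypeR R) : circle :=
  exist (fun z : R[i] => `|z| == 1) (cos t +i* sin t)%C (expi_unit t).

Lemma measurable_expi : measurable_fun [set: measurableTypeR R] expi.
Proof.
move=> _ _ [B mB <-]; rewrite !setTI -comp_preimage.
have mcs : measurable_fun [set: measurableTypeR R] (unit_coords \o expi).
  apply/measurable_fun_pair => /=.
  - apply: continuous_measurable_fun; exact: continuous_cos.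
  - apply: continuous_measurable_fun; exact: continuous_sin.
by rewrite -[X in measurable X]setTI; exact: mcs.
Qed.

HB.instance Definition _ := isMeasurableFun.Build _ _ _ _ expi measurable_expi.

Lemma two_pi_gt0 : 0 < (2 * pi : R). Proof. by rewrite mulr_gt0 ?pi_gt0. Qed.

Definition circle_measure : probability circle R :=
  distribution (uniform_prob two_pi_gt0) expi.

End UnitCircle.

Section Hardy.
Variable R : realType.
Local Notation C := R[i].
Local Notation T := (circle R).
Local Notation m := (circle_measure R).

Definition circle_int (f : T -> C) : C :=
  ((\int[m]_z complex.Re (f z)) +i* (\int[m]_z complex.Im (f z)))%C.

Definition measurable_cfun (f : T -> C) :=
  measurable_fun [set: T] (@complex.Re R \o f) /\
  measurable_fun [set: T] (@complex.Im R \o f).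

(* As usual, elements of Lebesgue spaces are represented by functions, and
   almost everywhere equal representatives are not identified. *)
Definition scalar_L (s : \bar R) : set (T -> C) :=
  [set f | measurable_cfun f /\
           (Lnorm m s (fun z => (normc (f z))%:E) < +oo)%E].

Definition fourier_coef (f : T -> C) (k : int) : C :=
  circle_int (fun z => f z * circle_val z ^ (- k)).

Definition hardy (s : \bar R) : set (T -> C) :=
  [set f | scalar_L s f /\ forall k : int, k < 0 -> fourier_coef f k = 0].

Section Matrices.
Variable n : nat.
Local Notation M := 'M[C]_n.

Definition hs_norm p q (A : 'M[C]_(p, q)) : R :=
  Num.sqrt (\sum_i \sum_j normc (A i j) ^+ 2).

(* On column vectors, hs_norm is the Euclidean norm. *)
Definition op_norm (A : M) : R :=
  sup [set hs_norm (A *m x) | x in [set x : 'cV[C]_n | hs_norm x <= 1]].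

Lemma normc_norm (x : C) : (normc x)%:C%C = `|x|.
Proof. by case: x. Qed.

Lemma normc_nneg (x : C) : 0 <= normc x.
Proof. by case: x => a b; exact: sqrtr_ge0. Qed.

Lemma op_norm_has_sup (A : M) :
  has_sup [set hs_norm (A *m x) | x in [set x : 'cV[C]_n | hs_norm x <= 1]].
Proof.
split.
  exists (hs_norm (A *m (0 : 'cV_n))), 0 => //=.
  rewrite /hs_norm big1 ?sqrtr0// => i _.
  by rewrite big1// => j _; rewrite mxE normc0 expr0n.
exists (Num.sqrt (\sum_i (\sum_j normc (A i j)) ^+ 2)) => _ [x /= x1 <-].
rewrite ler_wsqrtr// ler_sum// => i _; rewrite big_ord1.
rewrite ler_pXn2r ?nnegrE ?normc_nneg ?sumr_ge0 => // [|j _]; last exact: normc_nneg.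
rewrite -lecR rmorph_sum /= normc_norm mxE (le_trans (ler_norm_sum _ _ _))//.
rewrite ler_sum// => j _; rewrite normrM -normc_norm -[X in _ * X]normc_norm.
rewrite -rmorphM lecR ler_piMr ?normc_nneg// (le_trans _ x1)//.
rewrite /hs_norm -[leLHS](ger0_norm (normc_nneg _)) -sqrtr_sqr ler_wsqrtr//.
rewrite (bigD1 j)//= big_ord1 lerDl sumr_ge0// => k _.
by rewrite sumr_ge0// => l _; rewrite sqr_ge0.
Qed.

Definition measurable_mxfun (F : T -> M) :=
  forall i j, measurable_cfun (fun z => F z i j).

Definition LM_norm (s : \bar R) (F : T -> M) : \bar R :=
  Lnorm m s (fun z => (op_norm (F z))%:E).

Definition LS2_norm (s : \bar R) (F : T -> M) : \bar R :=
  Lnorm m s (fun z => (hs_norm (F z))%:E).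

Definition LM (s : \bar R) : set (T -> M) :=
  [set F | measurable_mxfun F /\ (LM_norm s F < +oo)%E].

Definition LS2 (s : \bar R) : set (T -> M) :=
  [set F | measurable_mxfun F /\ (LS2_norm s F < +oo)%E].

(* The same set underlies the Hardy spaces of functions with values in the
   n x n matrices with the operator norm and with the Hilbert-Schmidt norm. *)
Definition hardy_mx (s : \bar R) : set (T -> M) :=
  [set F | forall i j, hardy s (fun z => F z i j)].

Definition dist_hardy (p : \bar R) (Phi : T -> M) : \bar R :=
  ereal_inf [set LM_norm p (fun z => Phi z - Psi z) | Psi in hardy_mx p].

Definition inner_L2 (F G : T -> M) : C :=
  circle_int (fun z => \tr (F z *m (map_mx conjc (G z))^T)).

Definition hardy2_minus : set (T -> M) :=
  [set F | LS2 2%:E F /\ forall G, hardy_mx 2%:E G -> inner_L2 F G = 0].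

(* The orthogonal projection is only determined almost everywhere; xget selects
   a representative, and would return 0 if there were none. *)
Definition ortho_proj (V : set (T -> M)) (F : T -> M) : T -> M :=
  xget (fun=> 0)
    [set U | V U /\ forall W, V W -> inner_L2 (fun z => F z - U z) W = 0].

Definition proj_minus : (T -> M) -> T -> M := ortho_proj hardy2_minus.

Definition hankel (Phi F : T -> M) : T -> M :=
  proj_minus (fun z => Phi z *m F z).

Definition hankel_norm (q : \bar R) (Phi : T -> M) : \bar R :=
  ereal_sup [set LS2_norm 2%:E (hankel Phi F) |
             F in [set F | hardy_mx q F /\ (LS2_norm q F <= 1)%E]].

End Matrices.
End Hardy.

(* Main.v *)
Require Import Defs.
From mathcomp Require Import all_boot all_order all_algebra.
From mathcomp Require Import all_classical all_reals all_analysis.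
From mathcomp Require Import measurable_realfun ess_sup_inf.
From mathcomp Require Import complex.
From mathcomp Require Import ring lra.

Set Implicit Arguments.
Unset Strict Implicit.
Unset Printing Implicit Defensive.

Import Order.TTheory GRing.Theory Num.Theory.
Import numFieldNormedType.Exports.
Import ComplexField.Normc.

Local Open Scope classical_set_scope.
Local Open Scope ring_scope.

(** The upper bound is Hoelder's inequality, since [Psi F] is analytic for [Psi]
    in [H^p] and [F] in [H^q].

    For the lower bound, let [N] be the norm of the Hankel operator and let [W]
    range over the bounded, uniformly positive matrix weights such that
    [(tr W)^(1/2)] has norm at most 1 in [L^q]. A factorization [W = F F^*], with
    [F] and [F^-1] bounded and analytic, identifies the distance from [Phi] to
    [H^2] in [L^2(W)] with the norm of [H_Phi F], which is at most [N]. These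
    weights form a convex set, on which the squared distance from [Phi] to [Psi]
    is affine in [W] and uniformly convex in [Psi]; hence a minimax argument
    yields one [Psi] whose distance to [Phi] in [L^2(W)] is at most [N] for all
    these [W] at once. Testing this on weights close to [s x x^*], where [x(z)]
    is a unit vector almost norming [(Phi - Psi)(z)] and [s] is scalar, and using
    the duality of [L^(p/2)] and [L^(q/2)], bounds the norm of [Phi - Psi] in [L^p]
    by a number as close to [N] as desired. *)

(** * Integration on the circle *)

Section ComplexScalars.
Context {R : realType}.
Local Notation C := R[i].
Local Notation cRe := (@complex.Re R).
Local Notation cIm := (@complex.Im R).

(** The Hilbert-Schmidt norm enters through [W = F F^*]: the squared norm of [F(z)] is the trace of
    [W(z)], which is linear in [W], and since [q/2 >= 1] a norm bound on this trace in [L^(q/2)]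
    cuts out a convex set. The obstacle is that a [Psi] good for one weight need not be good for
    another. One [Psi] serves them all thanks to a uniform bound [W >= k]: it gives all the squared
    distances the same convexity modulus, so almost optimal weights have nearby minimisers, and
    completeness of [L^2] supplies the limit without weak compactness. Rank one weights have no such
    bound; they are mixed with a multiple of the identity, which costs a factor tending to 1. The
    spectral factor comes from prediction theory, by projecting the constant 1 onto [z H^2] in
    [L^2(W)]. Analyticity of products and constancy of the prediction error rest on the uniqueness
    of Fourier coefficients, so no Fourier series is ever summed. The minimax places [Psi] in [H^2]
    only; it lies in [H^p] because [Phi] and [Phi - Psi] are in [L^p]. *)

Lemma complex_eqP (x y : C) : cRe x = cRe y -> cIm x = cIm y -> x = y.
Proof. by case: x y => [a b] [c d] /= -> ->. Qed.

Lemma cReD (x y : C) : cRe (x + y) = cRe x + cRe y.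
Proof. by case: x y => [a b] [c d]. Qed.
Lemma cImD (x y : C) : cIm (x + y) = cIm x + cIm y.
Proof. by case: x y => [a b] [c d]. Qed.
Lemma cReN (x : C) : cRe (- x) = - cRe x.
Proof. by case: x. Qed.
Lemma cImN (x : C) : cIm (- x) = - cIm x.
Proof. by case: x. Qed.
Lemma cReM (x y : C) : cRe (x * y) = cRe x * cRe y - cIm x * cIm y.
Proof. by case: x y => [a b] [c d]. Qed.
Lemma cImM (x y : C) : cIm (x * y) = cRe x * cIm y + cIm x * cRe y.
Proof. by case: x y => [a b] [c d]. Qed.
Lemma cRe_conj (x : C) : cRe (conjc x) = cRe x.
Proof. by case: x. Qed.
Lemma cIm_conj (x : C) : cIm (conjc x) = - cIm x.
Proof. by case: x. Qed.
Lemma cRe_sum (I : Type) (r : seq I) (P : pred I) (f : I -> C) :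
  cRe (\sum_(i <- r | P i) f i) = \sum_(i <- r | P i) cRe (f i).
Proof. by apply: (big_morph cRe cReD). Qed.
Lemma cRe_nat (k : nat) : cRe k%:R = k%:R.
Proof. by elim: k => [|k IH] //; rewrite -!natr1 cReD IH. Qed.

Lemma normc_sqr (x : C) : normc x ^+ 2 = cRe x ^+ 2 + cIm x ^+ 2.
Proof. by case: x => a b /=; rewrite sqr_sqrtr// addr_ge0// sqr_ge0. Qed.

Lemma normc_conj (x : C) : normc (conjc x) = normc x.
Proof. by case: x => a b /=; rewrite sqrrN. Qed.

Lemma conjcN_real (a : R) : conjc (- a%:C%C) = - a%:C%C :> C.
Proof. by apply: complex_eqP; rewrite /= ?oppr0. Qed.

Lemma cRe_real_mul (a : R) (x : C) : cRe (a%:C%C * x) = a * cRe x.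
Proof. by case: x => b c /=; rewrite mul0r subr0. Qed.

Lemma mulcJ (x : C) : x * conjc x = (normc x ^+ 2)%:C%C.
Proof.
by rewrite normc_sqr; case: x => a b; apply: complex_eqP; rewrite /= ?mulrN ?opprK ?expr2//; ring.
Qed.

Lemma normc_Re (x : C) : `|cRe x| <= normc x.
Proof.
rewrite -ler_sqr ?nnegrE ?normc_nneg// normc_sqr -normrX ger0_norm ?sqr_ge0//.
by rewrite lerDl sqr_ge0.
Qed.

Lemma normc_Im (x : C) : `|cIm x| <= normc x.
Proof.
rewrite -ler_sqr ?nnegrE ?normc_nneg// normc_sqr -normrX ger0_norm ?sqr_ge0//.
by rewrite lerDr sqr_ge0.
Qed.

Lemma le_Re_normc (x : C) : cRe x <= normc x.
Proof. exact: le_trans (ler_norm _) (normc_Re _). Qed.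

Lemma normc_le_ReIm (x : C) : normc x <= `|cRe x| + `|cIm x|.
Proof.
rewrite -ler_sqr ?nnegrE ?normc_nneg ?addr_ge0// normc_sqr.
rewrite -(real_normK (num_real (cRe x))) -(real_normK (num_real (cIm x))).
have := mulr_ge0 (normr_ge0 (cRe x)) (normr_ge0 (cIm x)); nra.
Qed.

Lemma normc_real (a : R) : normc (a%:C)%C = `|a|.
Proof. by rewrite /= expr0n addr0 sqrtr_sqr. Qed.

Lemma sqr_normcD (x y : C) :
  normc (x + y) ^+ 2 <= 2 * normc x ^+ 2 + 2 * normc y ^+ 2.
Proof.
rewrite !normc_sqr cReD cImD; move: (cRe x) (cIm x) (cRe y) (cIm y) => a b c d.
have := sqr_ge0 (a - c); have := sqr_ge0 (b - d); nra.
Qed.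

Lemma normc_sum (I : Type) (r : seq I) (P : pred I) (f : I -> C) :
  normc (\sum_(i <- r | P i) f i) <= \sum_(i <- r | P i) normc (f i).
Proof.
elim/big_rec2: _ => [|i y x _ le]; first by rewrite normc0.
by rewrite (le_trans (le_normcD _ _))// lerD2l.
Qed.

Lemma normcX (x : C) k : normc (x ^+ k) = normc x ^+ k.
Proof.
elim: k => [|k IH]; first by rewrite !expr0 normc1.
by rewrite !exprS normcM IH.
Qed.

End ComplexScalars.

Section CircleIntegral.
Context {R : realType}.
Local Notation C := R[i].
Local Notation T := (circle R).
Local Notation m := (circle_measure R).
Local Notation cRe := (@complex.Re R).
Local Notation cIm := (@complex.Im R).
Implicit Types f g : T -> C.

Lemma measurable_cfun_cst (c : C) : measurable_cfun (fun=> c : C).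
Proof. by split; exact: measurable_cst. Qed.

Lemma measurable_cfunD f g : measurable_cfun f -> measurable_cfun g ->
  measurable_cfun (fun z => f z + g z).
Proof.
move=> [f1 f2] [g1 g2]; split.
  rewrite (_ : _ \o _ = (cRe \o f) \+ (cRe \o g)); first exact: measurable_funD.
  by apply/funext => z /=; rewrite cReD.
rewrite (_ : _ \o _ = (cIm \o f) \+ (cIm \o g)); first exact: measurable_funD.
by apply/funext => z /=; rewrite cImD.
Qed.

Lemma measurable_cfunM f g : measurable_cfun f -> measurable_cfun g ->
  measurable_cfun (fun z => f z * g z).
Proof.
move=> [f1 f2] [g1 g2]; split.
  rewrite (_ : _ \o _ = ((cRe \o f) \* (cRe \o g)) \- ((cIm \o f) \* (cIm \o g))).
    by apply: measurable_funB; exact: measurable_funM.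
  by apply/funext => z /=; rewrite cReM.
rewrite (_ : _ \o _ = ((cRe \o f) \* (cIm \o g)) \+ ((cIm \o f) \* (cRe \o g))).
  by apply: measurable_funD; exact: measurable_funM.
by apply/funext => z /=; rewrite cImM.
Qed.

Lemma measurable_cfun_conj f : measurable_cfun f ->
  measurable_cfun (fun z => conjc (f z)).
Proof.
move=> [f1 f2]; split.
  by rewrite (_ : _ \o _ = cRe \o f)//; apply/funext => z /=; rewrite cRe_conj.
rewrite (_ : _ \o _ = \- (cIm \o f)); first exact: measurable_funN.
by apply/funext => z /=; rewrite cIm_conj.
Qed.

Lemma measurable_cfun_sum (I : Type) (r : seq I) (P : pred I) (F : I -> T -> C) :
  (forall i, P i -> measurable_cfun (F i)) ->
  measurable_cfun (fun z => \sum_(i <- r | P i) F i z).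
Proof.
move=> mF; elim: r => [|i r IH].
  by under [X in measurable_cfun X]eq_fun do rewrite big_nil;
     exact: measurable_cfun_cst.
under [X in measurable_cfun X]eq_fun do rewrite big_cons.
have [Pi|Pi] := boolP (P i); last exact: IH.
by apply: measurable_cfunD => //; exact: mF.
Qed.

Lemma measurable_normc_sqr f : measurable_cfun f ->
  measurable_fun setT (fun z => normc (f z) ^+ 2).
Proof.
move=> [f1 f2]; under [X in measurable_fun _ X]eq_fun do rewrite normc_sqr.
by apply: measurable_funD; apply: measurable_funX.
Qed.

Lemma measurable_normc f : measurable_cfun f ->
  measurable_fun setT (fun z => normc (f z)).
Proof.
move=> mf; rewrite (_ : (fun _ => _) = (fun z => Num.sqrt (normc (f z) ^+ 2))).
  have msqrt : measurable_fun setT (@Num.sqrt R).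
    by apply: continuous_measurable_fun; exact: sqrt_continuous.
  exact: (measurableT_comp msqrt (measurable_normc_sqr mf)).
by apply/funext => z; rewrite sqrtr_sqr ger0_norm// normc_nneg.
Qed.

Lemma ae_le_integrable (f g : T -> R) : measurable_fun setT f ->
  {ae m, forall z, `|f z| <= g z} -> m.-integrable setT (EFin \o g) ->
  m.-integrable setT (EFin \o f).
Proof.
move=> mf fg /integrableP[mg gi]; apply/integrableP; split.
  exact/measurable_EFinP.
apply: le_lt_trans gi; apply: ae_ge0_le_integral => //.
- by apply: measurableT_comp => //; exact/measurable_EFinP.
- by apply: measurableT_comp.
- apply: filterS fg => z fgz _ /=; rewrite lee_fin (le_trans fgz)//.
  exact: ler_norm.
Qed.

Lemma ge_integrable (f g : T -> R) : measurable_fun setT f ->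
  (forall z, `|f z| <= g z) -> m.-integrable setT (EFin \o g) ->
  m.-integrable setT (EFin \o f).
Proof. by move=> mf fg; apply: ae_le_integrable => //; exact: nearW. Qed.

Definition L1 f := measurable_cfun f /\
  m.-integrable setT (EFin \o (fun z => normc (f z))).

Definition L2 f := measurable_cfun f /\
  m.-integrable setT (EFin \o (fun z => normc (f z) ^+ 2)).

Lemma ae_L1 f (g : T -> R) : measurable_cfun f ->
  {ae m, forall z, normc (f z) <= g z} -> m.-integrable setT (EFin \o g) -> L1 f.
Proof.
move=> mf fg gi; split=> //; apply: ae_le_integrable gi.
  exact: measurable_normc.
by apply: filterS fg => z; rewrite ger0_norm ?normc_nneg.
Qed.

Lemma ge_L1 f (g : T -> R) : measurable_cfun f ->
  (forall z, normc (f z) <= g z) -> m.-integrable setT (EFin \o g) -> L1 f.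
Proof. by move=> mf fg; apply: ae_L1 => //; exact: nearW. Qed.

Lemma ae_L2 f (g : T -> R) : measurable_cfun f ->
  {ae m, forall z, normc (f z) ^+ 2 <= g z} ->
  m.-integrable setT (EFin \o g) -> L2 f.
Proof.
move=> mf fg gi; split=> //; apply: ae_le_integrable gi.
  exact: measurable_normc_sqr.
by apply: filterS fg => z; rewrite ger0_norm ?sqr_ge0.
Qed.

Lemma ge_L2 f (g : T -> R) : measurable_cfun f ->
  (forall z, normc (f z) ^+ 2 <= g z) -> m.-integrable setT (EFin \o g) -> L2 f.
Proof. by move=> mf fg; apply: ae_L2 => //; exact: nearW. Qed.

Lemma integrable_cst (r : R) : m.-integrable setT (EFin \o (fun=> r)).
Proof. exact: finite_measure_integrable_cst. Qed.

Lemma integrable_addR (f g : T -> R) : m.-integrable setT (EFin \o f) ->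
  m.-integrable setT (EFin \o g) -> m.-integrable setT (EFin \o (fun z => f z + g z)).
Proof. by move=> fi gi; exact: (integrableD _ fi gi). Qed.

Lemma integrable_scaleR (r : R) (f : T -> R) : m.-integrable setT (EFin \o f) ->
  m.-integrable setT (EFin \o (fun z => r * f z)).
Proof. by move=> fi; exact: (integrableZl _ r fi). Qed.

Lemma L1_Re f : L1 f -> m.-integrable setT (EFin \o (fun z => cRe (f z))).
Proof.
by move=> [[mr mi] fi]; apply: ge_integrable fi => // z; exact: normc_Re.
Qed.

Lemma L1_Im f : L1 f -> m.-integrable setT (EFin \o (fun z => cIm (f z))).
Proof.
by move=> [[mr mi] fi]; apply: ge_integrable fi => // z; exact: normc_Im.
Qed.

Lemma L1_cst (c : C) : L1 (fun=> c).
Proof.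
by split; [exact: measurable_cfun_cst|exact: integrable_cst].
Qed.

Lemma L1D f g : L1 f -> L1 g -> L1 (fun z => f z + g z).
Proof.
move=> [mf fi] [mg gi]; apply: ge_L1 (integrable_addR fi gi).
  exact: measurable_cfunD.
by move=> z; exact: le_normcD.
Qed.

Lemma L1Z (c : C) f : L1 f -> L1 (fun z => c * f z).
Proof.
move=> [mf fi]; apply: ge_L1 (integrable_scaleR (normc c) fi).
  exact: measurable_cfunM (measurable_cfun_cst _) mf.
by move=> z; rewrite normcM.
Qed.

Lemma L1N f : L1 f -> L1 (fun z => - f z).
Proof. by move=> /(L1Z (-1)); under eq_fun do rewrite mulN1r. Qed.

Lemma L1B f g : L1 f -> L1 g -> L1 (fun z => f z - g z).
Proof. by move=> f1 g1; apply: L1D => //; exact: L1N. Qed.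

Lemma L1_sum (I : Type) (r : seq I) (P : pred I) (F : I -> T -> C) :
  (forall i, P i -> L1 (F i)) -> L1 (fun z => \sum_(i <- r | P i) F i z).
Proof.
move=> mF; elim: r => [|i r IH].
  by under [X in L1 X]eq_fun do rewrite big_nil; exact: L1_cst.
under [X in L1 X]eq_fun do rewrite big_cons.
have [Pi|Pi] := boolP (P i); last exact: IH.
by apply: L1D => //; exact: mF.
Qed.

Lemma L2_bounded f K : measurable_cfun f -> (forall z, normc (f z) <= K) -> L2 f.
Proof.
move=> mf fK; apply: (ge_L2 mf (g := fun=> K ^+ 2)); last exact: integrable_cst.
by move=> z; rewrite ler_sqr// ?nnegrE ?normc_nneg// (le_trans (normc_nneg _) (fK z)).
Qed.

Lemma L2_cst (c : C) : L2 (fun=> c).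
Proof. by apply: (@L2_bounded _ (normc c)) => //; exact: measurable_cfun_cst. Qed.

Lemma L2D f g : L2 f -> L2 g -> L2 (fun z => f z + g z).
Proof.
move=> [mf fi] [mg gi]; apply: ge_L2
  (integrable_addR (integrable_scaleR 2 fi) (integrable_scaleR 2 gi)).
  exact: measurable_cfunD.
by move=> z; exact: sqr_normcD.
Qed.

Lemma ae_L2M f g K : measurable_cfun f -> {ae m, forall z, normc (f z) <= K} ->
  L2 g -> L2 (fun z => f z * g z).
Proof.
move=> mf fK [mg gi].
apply: ae_L2 (integrable_scaleR (K ^+ 2) gi); first exact: measurable_cfunM.
apply: filterS fK => z fK; rewrite normcM exprMn ler_wpM2r ?sqr_ge0//.
by rewrite ler_sqr// ?nnegrE ?normc_nneg// (le_trans (normc_nneg _) fK).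
Qed.

Lemma L2M f g K : measurable_cfun f -> (forall z, normc (f z) <= K) ->
  L2 g -> L2 (fun z => f z * g z).
Proof. by move=> mf fK; apply: (@ae_L2M _ _ K) => //; exact: nearW. Qed.

Lemma L2Z (c : C) f : L2 f -> L2 (fun z => c * f z).
Proof. by apply: (@L2M _ _ (normc c)) => //; exact: measurable_cfun_cst. Qed.

Lemma L2N f : L2 f -> L2 (fun z => - f z).
Proof. by move=> /(L2Z (-1)); under eq_fun do rewrite mulN1r. Qed.

Lemma L2_conj f : L2 f -> L2 (fun z => conjc (f z)).
Proof.
move=> [mf fi]; split; first exact: measurable_cfun_conj.
by under eq_fun do rewrite normc_conj.
Qed.

Lemma L2_sum (I : Type) (r : seq I) (P : pred I) (F : I -> T -> C) :
  (forall i, P i -> L2 (F i)) -> L2 (fun z => \sum_(i <- r | P i) F i z).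
Proof.
move=> mF; elim: r => [|i r IH].
  by under [X in L2 X]eq_fun do rewrite big_nil; exact: L2_cst.
under [X in L2 X]eq_fun do rewrite big_cons.
have [Pi|Pi] := boolP (P i); last exact: IH.
by apply: L2D => //; exact: mF.
Qed.

Lemma L2_L1M f g : L2 f -> L2 g -> L1 (fun z => f z * g z).
Proof.
move=> [mf fi] [mg gi]; apply: ge_L1 (integrable_addR fi gi).
  exact: measurable_cfunM.
move=> z; rewrite normcM; move: (normc_nneg (f z)) (normc_nneg (g z)).
by move: (normc (f z)) (normc (g z)) => a b a0 b0; have := sqr_ge0 (a - b); nra.
Qed.

Lemma L2_L1 f : L2 f -> L1 f.
Proof.
move=> f2; rewrite (_ : f = (fun z => f z * 1)); first exact: L2_L1M f2 (L2_cst 1).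
by apply/funext => z; rewrite mulr1.
Qed.

Lemma Re_cint f : cRe (circle_int f) = \int[m]_z cRe (f z).
Proof. by []. Qed.

Lemma Im_cint f : cIm (circle_int f) = \int[m]_z cIm (f z).
Proof. by []. Qed.

Lemma eq_cint f g : f =1 g -> circle_int f = circle_int g.
Proof. by move=> /funext ->. Qed.

Lemma ae_eq_cint f g : L1 f -> L1 g -> {ae m, forall z, f z = g z} ->
  circle_int f = circle_int g.
Proof.
move=> f1 g1 fg; apply: complex_eqP; rewrite ?Re_cint ?Im_cint; congr fine.
  apply: ae_eq_integral => //.
  - exact: measurable_int (L1_Re f1).
  - exact: measurable_int (L1_Re g1).
  - by apply: filterS fg => z -> _.
apply: ae_eq_integral => //.
- exact: measurable_int (L1_Im f1).
- exact: measurable_int (L1_Im g1).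
- by apply: filterS fg => z -> _.
Qed.

Lemma cint_cst (c : C) : circle_int (fun=> c) = c.
Proof.
have mT : fine (m setT) = 1 by rewrite probability_setT.
by apply: complex_eqP; rewrite ?Re_cint ?Im_cint Rintegral_cst// mT mulr1.
Qed.

Lemma cintD f g : L1 f -> L1 g ->
  circle_int (fun z => f z + g z) = circle_int f + circle_int g.
Proof.
move=> f1 g1; apply: complex_eqP; rewrite ?cReD ?cImD !(Re_cint, Im_cint).
  under eq_Rintegral do rewrite cReD.
  by rewrite RintegralD//; exact: L1_Re.
under eq_Rintegral do rewrite cImD.
by rewrite RintegralD//; exact: L1_Im.
Qed.

Lemma cintZ (c : C) f : L1 f ->
  circle_int (fun z => c * f z) = c * circle_int f.
Proof.
move=> f1; have rf := L1_Re f1; have jf := L1_Im f1.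
apply: complex_eqP; rewrite ?cReM ?cImM !(Re_cint, Im_cint).
  under eq_Rintegral do rewrite cReM.
  by rewrite RintegralB ?RintegralZl//; exact: integrable_scaleR.
under eq_Rintegral do rewrite cImM.
by rewrite RintegralD ?RintegralZl//; exact: integrable_scaleR.
Qed.

Lemma cintN f : L1 f -> circle_int (fun z => - f z) = - circle_int f.
Proof.
move=> f1; rewrite -mulN1r -cintZ//; apply: eq_cint => z.
by rewrite mulN1r.
Qed.

Lemma cintB f g : L1 f -> L1 g ->
  circle_int (fun z => f z - g z) = circle_int f - circle_int g.
Proof. by move=> f1 g1; rewrite cintD ?cintN//; exact: L1N. Qed.

Lemma cint_conj f : L1 f ->
  circle_int (fun z => conjc (f z)) = conjc (circle_int f).
Proof.
move=> f1; apply: complex_eqP; rewrite ?cRe_conj ?cIm_conj !(Re_cint, Im_cint).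
  by under eq_Rintegral do rewrite cRe_conj.
under eq_Rintegral do rewrite cIm_conj -mulN1r.
by rewrite RintegralZl ?mulN1r//; exact: L1_Im.
Qed.

Lemma cint_sum (I : Type) (r : seq I) (P : pred I) (F : I -> T -> C) :
  (forall i, P i -> L1 (F i)) ->
  circle_int (fun z => \sum_(i <- r | P i) F i z) =
  \sum_(i <- r | P i) circle_int (F i).
Proof.
move=> F1; elim: r => [|i r IH].
  by rewrite big_nil -[RHS]cint_cst; apply: eq_cint => z; rewrite big_nil.
rewrite big_cons; have [Pi|Pi] := boolP (P i).
  rewrite -IH -cintD; first by apply: eq_cint => z; rewrite big_cons Pi.
    exact: F1.
  exact: L1_sum.
by rewrite -IH; apply: eq_cint => z; rewrite big_cons (negbTE Pi).
Qed.

(* AM-GM, in the form in which it proves that square integrable convergence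
   implies convergence of the pairings with square integrable functions. *)
Lemma normc_cint_le f g (s : R) : L2 f -> L2 g -> 0 < s ->
  normc (circle_int (fun z => f z * g z)) <=
  s * (\int[m]_z (normc (f z) ^+ 2)) + s^-1 * \int[m]_z (normc (g z) ^+ 2).
Proof.
move=> f2 g2 s0; have fg1 := L2_L1M f2 g2.
pose h z := s * normc (f z) ^+ 2 + s^-1 * normc (g z) ^+ 2.
have hi : m.-integrable setT (EFin \o h).
  by apply: integrable_addR; apply: integrable_scaleR; [case: f2|case: g2].
have -> : s * (\int[m]_z (normc (f z) ^+ 2)) + s^-1 * \int[m]_z (normc (g z) ^+ 2)
    = \int[m]_z h z.
  rewrite RintegralD ?RintegralZl//; try by [case: f2|case: g2].
  - by apply: integrable_scaleR; case: f2.
  - by apply: integrable_scaleR; case: g2.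
(* The factor 2 lets the bounds for the real and the imaginary part add up to one integral of
   [h]. *)
have le1 (u : T -> R) : m.-integrable setT (EFin \o u) ->
    (forall z, `|u z| <= normc (f z * g z)) -> 2 * `|\int[m]_z u z| <= \int[m]_z h z.
  move=> ui uh; have := le_normr_Rintegral measurableT ui.
  rewrite -(ler_pM2l (ltr0n _ 2)); move/le_trans; apply.
  rewrite -RintegralZl//; last exact: integrable_norm.
  apply: le_Rintegral => //; first by apply: integrable_scaleR; exact: integrable_norm.
  move=> z _; apply: (@le_trans _ _ (2 * (normc (f z) * normc (g z)))).
    by rewrite ler_wpM2l// -normcM.
  rewrite /h; move: (normc (f z)) (normc (g z)) => a b.
  have -> : s * a ^+ 2 + s^-1 * b ^+ 2 =
      2 * (a * b) + s * (a - s^-1 * b) ^+ 2 by field; rewrite gt_eqF.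
  by rewrite lerDl mulr_ge0 ?sqr_ge0 ?ltW.
have := le1 _ (L1_Re fg1) (fun z => normc_Re _).
have := le1 _ (L1_Im fg1) (fun z => normc_Im _).
have := normc_le_ReIm (circle_int (fun z => f z * g z)).
rewrite Re_cint Im_cint; lra.
Qed.

End CircleIntegral.

(** * Uniqueness of Fourier coefficients *)

Section SignApproximation.
Context {R : realType}.

(* Its iterates converge to the sign on [-1, 1]; in this way half-planes become
   pointwise limits of trigonometric polynomials. *)
Definition smoothstep (t : R) : R := (3 * t - t ^+ 3) / 2.

Lemma smoothstep_norm t : `|t| <= 1 -> `|smoothstep t| <= 1.
Proof.
rewrite !ler_norml /smoothstep => /andP[t1 t2].
have := mulr_ge0 (sqr_ge0 (1 - t)) (_ : 0 <= 2 + t).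
have := mulr_ge0 (sqr_ge0 (1 + t)) (_ : 0 <= 2 - t).
have -> : (1 + t) ^+ 2 * (2 - t) = 2 + (3 * t - t ^+ 3) by ring.
have -> : (1 - t) ^+ 2 * (2 + t) = 2 - (3 * t - t ^+ 3) by ring.
by move=> h1 h2; apply/andP; have := h1; have := h2; lra.
Qed.

Lemma smoothstepN t : smoothstep (- t) = - smoothstep t.
Proof. by rewrite /smoothstep; field. Qed.

(** One step multiplies the distance to the fixed point 1 by [1 - (t + t ^+ 2) / 2], and it does not
    decrease [t] on [0, 1]. Hence an orbit starting at or above [s] stays there and approaches 1
    geometrically, with ratio [1 - s / 2]. *)
Lemma smoothstep_gap s t : 0 <= s <= t -> t <= 1 ->
  s <= smoothstep t <= 1 /\ 1 - smoothstep t <= (1 - t) * (1 - s / 2).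
Proof.
move=> /andP[s0 st] t1; have t0 := le_trans s0 st.
have e : 1 - smoothstep t = (1 - t) * (1 - (t + t ^+ 2) / 2).
  by rewrite /smoothstep; field.
have e2 : smoothstep t = t + t * (1 - t) * (1 + t) / 2.
  by rewrite /smoothstep; field.
have p : 0 <= t * (1 - t) * (1 + t).
  by rewrite !mulr_ge0//; lra.
split.
  apply/andP; split; first by lra.
  by have := smoothstep_norm (_ : `|t| <= 1); rewrite !ler_norml => /(_ _)/andP[|//]; lra.
rewrite e ler_wpM2l//; first lra.
by have := sqr_ge0 t; lra.
Qed.

Lemma cvg_smoothstep_gt0 t : 0 < t <= 1 ->
  (fun k => iter k smoothstep t) @ \oo --> (1 : R).
Proof.
move=> /andP[t0 t1].
have iterP k : t <= iter k smoothstep t <= 1 /\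
    1 - iter k smoothstep t <= (1 - t / 2) ^+ k.
  elim: k => [|k [/andP[a b] IH]] /=; first by rewrite lexx t1 expr0; split=> //; lra.
  have [|ab le] := @smoothstep_gap t _ _ b; first by rewrite (ltW t0) a.
  split=> //; rewrite (le_trans le)// exprSr ler_wpM2r//; lra.
have h : (fun k => (1 - t / 2) ^+ k) @ \oo --> (0 : R).
  by apply: cvg_expr; rewrite ger0_norm; lra.
have h1 : (fun k => 1 - (1 - t / 2) ^+ k) @ \oo --> (1 - 0 : R).
  by apply: cvgB => //; exact: cvg_cst.
rewrite subr0 in h1.
apply: (squeeze_cvgr _ h1 (cvg_cst (1 : R))).
by apply: nearW => k; have [/andP[_ ->]] := iterP k; rewrite andbT; lra.
Qed.

Lemma cvg_smoothstep t : `|t| <= 1 ->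
  (fun k => iter k smoothstep t) @ \oo --> Num.sg t.
Proof.
rewrite ler_norml => /andP[t1 t2]; have [t0|t0|->] := ltgtP t 0.
- rewrite ltr0_sg//.
  have iN k : iter k smoothstep t = - iter k smoothstep (- t).
    by elim: k => [|k IH] /=; rewrite ?opprK// IH smoothstepN.
  under eq_fun do rewrite iN; apply: cvgN.
  by apply: cvg_smoothstep_gt0; rewrite oppr_gt0 t0; lra.
- by rewrite gtr0_sg//; apply: cvg_smoothstep_gt0; rewrite t0.
- rewrite sgr0 (_ : (fun _ => _) = (fun=> 0)); first exact: cvg_cst.
  apply/funext; elim=> //= k ->; rewrite /smoothstep.
  by rewrite mulr0 expr0n subr0 mul0r.
Qed.

End SignApproximation.

Section Uniqueness.
Context {R : realType}.
Local Notation C := R[i].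
Local Notation T := (circle R).
Local Notation m := (circle_measure R).
Local Notation cRe := (@complex.Re R).
Local Notation cIm := (@complex.Im R).
Local Notation zpow k := (fun z : T => circle_val z ^ k).
Implicit Types F G : T -> C.

Lemma normc_circle_val (z : T) : normc (circle_val z) = 1.
Proof.
case: z => z /= z1; rewrite /circle_val /=.
by apply: complexI; rewrite normc_norm (eqP z1).
Qed.

Lemma circle_val_neq0 (z : T) : circle_val z != 0.
Proof.
apply/eqP => z0; have := normc_circle_val z; rewrite z0 normc0 => /esym/eqP.
by rewrite oner_eq0.
Qed.

Lemma circle_valV (z : T) : (circle_val z)^-1 = conjc (circle_val z).
Proof.
apply: (mulfI (circle_val_neq0 z)); rewrite mulfV ?circle_val_neq0//.
by rewrite mulcJ normc_circle_val expr1n.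
Qed.

Lemma normc_zpow k (z : T) : normc (circle_val z ^ k) = 1.
Proof.
case: k => k; first by rewrite -exprnP normcX normc_circle_val expr1n.
by rewrite NegzE -exprnN -exprVn circle_valV normcX normc_conj
  normc_circle_val expr1n.
Qed.

Lemma conj_zpow k (z : T) : conjc (circle_val z ^ k) = circle_val z ^ (- k).
Proof.
apply: (mulfI (expfz_neq0 k (circle_val_neq0 z))).
by rewrite mulcJ normc_zpow expr1n -expfzDr ?circle_val_neq0// subrr.
Qed.

Lemma zpowD j k (z : T) :
  circle_val z ^ (j + k) = circle_val z ^ j * circle_val z ^ k.
Proof. exact: expfzDr (circle_val_neq0 z). Qed.

Lemma measurable_circle_val : measurable_cfun (@circle_val R).
Proof.
have mc : measurable_fun setT (@unit_coords R : T -> _).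
  by move=> _ B mB; exists B.
split.
  exact: (measurableT_comp measurable_fst mc).
exact: (measurableT_comp measurable_snd mc).
Qed.

Lemma measurable_zpow k : measurable_cfun (zpow k).
Proof.
have mn (n : nat) : measurable_cfun (zpow n).
  elim: n => [|n IH]; first exact: measurable_cfun_cst.
  rewrite (_ : zpow _ = (fun z => circle_val z * circle_val z ^ n%:Z)).
    exact: measurable_cfunM measurable_circle_val IH.
  by apply/funext => z; rewrite -!exprnP exprS.
case: k => n; first exact: mn.
rewrite NegzE; under eq_fun do rewrite -conj_zpow.
exact: measurable_cfun_conj.
Qed.

Lemma L2_zpow k : L2 (zpow k).
Proof. by apply: (@L2_bounded _ _ 1); [exact: measurable_zpow|move=> z; rewrite normc_zpow]. Qed.

Lemma L1_bounded (f g : T -> C) K : measurable_cfun f ->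
  (forall z, normc (f z) <= K) -> L1 g -> L1 (fun z => f z * g z).
Proof.
move=> mf fK [mg gi]; apply: ge_L1 (integrable_scaleR K gi).
  exact: measurable_cfunM.
by move=> z; rewrite normcM ler_wpM2r// normc_nneg.
Qed.

Lemma L1_zpow k F : L1 F -> L1 (fun z => circle_val z ^ k * F z).
Proof.
apply: (@L1_bounded _ _ 1); first exact: measurable_zpow.
by move=> z; rewrite normc_zpow.
Qed.

Definition null_coefs F := L1 F /\ forall k, fourier_coef F k = 0.

Lemma null_coefsD F G : null_coefs F -> null_coefs G ->
  null_coefs (fun z => F z + G z).
Proof.
move=> [F1 F0] [G1 G0]; split=> [|k]; first exact: L1D.
rewrite /fourier_coef (eq_cint (g := fun z =>
  circle_val z ^ (- k) * F z + circle_val z ^ (- k) * G z)).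
  rewrite cintD; try exact: L1_zpow.
  transitivity (fourier_coef F k + fourier_coef G k); last by rewrite F0 G0 addr0.
  by congr (_ + _); apply: eq_cint => z; rewrite mulrC.
by move=> z; rewrite -mulrDr mulrC.
Qed.

Lemma null_coefsZ (c : C) F : null_coefs F -> null_coefs (fun z => c * F z).
Proof.
move=> [F1 F0]; split=> [|k]; first exact: L1Z.
rewrite /fourier_coef (eq_cint (g := fun z => c * (circle_val z ^ (- k) * F z))).
  rewrite cintZ; last exact: L1_zpow.
  rewrite (eq_cint (g := fun z => F z * circle_val z ^ (- k))).
    by have := F0 k; rewrite /fourier_coef => ->; rewrite mulr0.
  by move=> z; rewrite mulrC.
by move=> z; ring.
Qed.

Lemma null_coefs_zpow j F : null_coefs F ->
  null_coefs (fun z => circle_val z ^ j * F z).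
Proof.
move=> [F1 F0]; split=> [|k]; first exact: L1_zpow.
rewrite -(F0 (k - j)); apply: eq_cint => z.
by rewrite opprB zpowD; ring.
Qed.

(** The device behind uniqueness. Trigonometric polynomials preserve the vanishing of all
    coefficients; the bound by 1 lets [smoothstep] be iterated and makes dominated convergence
    available, so the class reaches the indicators of all Borel sets. The coefficient of index 0
    then says that the integral of [F] over every measurable set is zero. *)
Definition multiplier (u : T -> R) := [/\ measurable_fun setT u,
  forall z, `|u z| <= 1 & forall F, null_coefs F -> null_coefs (fun z => (u z)%:C%C * F z)].

Lemma measurable_cfun_real (u : T -> R) : measurable_fun setT u ->
  measurable_cfun (fun z => (u z)%:C%C).
Proof. by move=> mu; split=> //; exact: measurable_cst. Qed.

(** Dividing by [1 + |a|] restores the bound by 1 and leaves unchanged the set where [u - a] is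
    positive. *)
Lemma multiplier_coord (u : T -> R) (a : R) : measurable_fun setT u ->
  (forall z, `|u z| <= 1) ->
  (forall F, null_coefs F -> null_coefs (fun z => (u z)%:C%C * F z)) ->
  multiplier (fun z => (u z - a) / (1 + `|a|)).
Proof.
move=> mu u1 nu; have a0 : 0 < 1 + `|a| by rewrite ltr_pwDl.
split.
- rewrite (_ : (fun _ => _) = (fun z => (1 + `|a|)^-1 * (u z + (- a)))).
    apply: measurable_funM; first exact: measurable_cst.
    by apply: measurable_funD => //; exact: measurable_cst.
  by apply/funext => z; rewrite mulrC.
- move=> z; rewrite normrM normfV (gtr0_norm a0) ler_pdivrMr// mul1r.
  by rewrite (le_trans (ler_normB _ _))// lerD2r.
- move=> F F0; rewrite (_ : (fun _ => _) = fun z =>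
    ((1 + `|a|)^-1)%:C%C * ((u z)%:C%C * F z) + (- a / (1 + `|a|))%:C%C * F z).
    by apply: null_coefsD; apply: null_coefsZ => //; exact: nu.
  apply/funext => z; rewrite mulrA -mulrDl -rmorphM -rmorphD; congr (_%:C%C * _).
  by field; rewrite gt_eqF.
Qed.

Lemma null_coefs_Re F : null_coefs F ->
  null_coefs (fun z => (cRe (circle_val z))%:C%C * F z).
Proof.
move=> F0; rewrite (_ : (fun _ => _) = fun z =>
  (2^-1)%:C%C * (circle_val z ^ 1 * F z + circle_val z ^ (-1) * F z)).
  by apply: null_coefsZ; apply: null_coefsD; exact: null_coefs_zpow.
apply/funext => z; rewrite -conj_zpow -mulrDl mulrA; congr (_ * _).
by rewrite expr1z; apply: complex_eqP;
  rewrite ?(cReM, cImM, cReD, cImD, cRe_conj, cIm_conj) /=; field.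
Qed.

Lemma null_coefs_Im F : null_coefs F ->
  null_coefs (fun z => (cIm (circle_val z))%:C%C * F z).
Proof.
move=> F0; rewrite (_ : (fun _ => _) = fun z =>
  (0 +i* (- 2^-1))%C * (circle_val z ^ 1 * F z + (-1) * (circle_val z ^ (-1) * F z))).
  apply: null_coefsZ; apply: null_coefsD; first exact: null_coefs_zpow.
  by apply: null_coefsZ; exact: null_coefs_zpow.
apply/funext => z; rewrite -conj_zpow mulrA -mulrDl mulrA; congr (_ * _).
by rewrite expr1z mulN1r; apply: complex_eqP;
  rewrite ?(cReM, cImM, cReD, cImD, cReN, cImN, cRe_conj, cIm_conj) /=; field.
Qed.

Lemma multiplierM u v : multiplier u -> multiplier v ->
  multiplier (fun z => u z * v z).
Proof.
move=> [mu u1 nu] [mv v1 nv]; split; first exact: measurable_funM.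
  by move=> z; rewrite normrM mulr_ile1.
move=> F F0; rewrite (_ : (fun _ => _) = fun z => (u z)%:C%C * ((v z)%:C%C * F z)).
  by apply: nu; exact: nv.
by apply/funext => z; rewrite rmorphM mulrA.
Qed.

Lemma multiplier_smoothstep u : multiplier u ->
  multiplier (fun z => smoothstep (u z)).
Proof.
move=> [mu u1 nu]; split.
- rewrite (_ : (fun _ => _) = (fun z => 2^-1 * (3 * u z + (-1) * u z ^+ 3))).
    apply: measurable_funM; first exact: measurable_cst.
    apply: measurable_funD; apply: measurable_funM => //; try exact: measurable_cst.
    exact: measurable_funX.
  by apply/funext => z; rewrite /smoothstep mulrC mulN1r.
- by move=> z; exact: smoothstep_norm.
- move=> F F0; rewrite (_ : (fun _ => _) = fun z => (3 / 2)%:C%C * ((u z)%:C%C * F z) +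
    (- 2^-1)%:C%C * ((u z)%:C%C * ((u z)%:C%C * ((u z)%:C%C * F z)))).
    by apply: null_coefsD; apply: null_coefsZ; [exact: nu|exact/nu/nu/nu].
  apply/funext => z; rewrite !mulrA -!rmorphM -mulrDl -rmorphD; congr (_%:C%C * _).
  by rewrite /smoothstep; field.
Qed.

(** Dominated convergence with [|g|] as dominating function; it transfers vanishing coefficients to
    pointwise limits of multipliers. *)
Lemma Rintegral_mult_lim (u_ : nat -> T -> R) (u g : T -> R) :
  (forall k, measurable_fun setT (u_ k)) -> (forall k z, `|u_ k z| <= 1) ->
  (forall z, u_ ^~ z @ \oo --> u z) -> m.-integrable setT (EFin \o g) ->
  (forall k, \int[m]_z (u_ k z * g z) = 0) -> \int[m]_z (u z * g z) = 0.
Proof.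
move=> mu u1 uu gi u0.
have mg : measurable_fun setT g by apply/measurable_EFinP; exact: measurable_int gi.
have muu : measurable_fun setT u.
  by apply: (measurable_fun_cvg (h := u_)) => // z _; exact: uu.
have cug : {ae m, forall z, setT z -> (fun k => (u_ k z * g z)%:E) @ \oo --> (u z * g z)%:E}.
  apply: aeW => z _; apply: cvg_EFin; first exact: nearW.
  by apply: cvgM; [exact: uu|exact: cvg_cst].
have le_g : {ae m, forall z k, setT z -> (`|(u_ k z * g z)%:E| <= `|g z|%:E)%E}.
  by apply: aeW => z k _; rewrite lee_fin normrM ler_piMl.
have [ui _ ugc] := dominated_convergence measurableT
  (fun k => (measurable_EFinP _ _).2 (measurable_funM (mu k) mg))
  ((measurable_EFinP _ _).2 (measurable_funM muu mg)) cug (integrable_norm gi) le_g.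
have e k : (\int[m]_z (u_ k z * g z)%:E = 0)%E.
  have ugi : m.-integrable setT (EFin \o (fun z => u_ k z * g z)).
    apply: ge_integrable (integrable_norm gi); first exact: measurable_funM.
    by move=> z; rewrite normrM ler_piMl.
  rewrite -[LHS]fineK; last exact: (integrable_fin_num measurableT ugi).
  by congr EFin; exact: u0.
move: ugc; rewrite (_ : [sequence _]_n = cst 0%E); last by apply/funext => k; rewrite /= -(e k).
move=> /(cvg_lim (@ereal_hausdorff R)) h.
by rewrite /Rintegral -h (cvg_lim (@ereal_hausdorff R) (cvg_cst _)).
Qed.

Lemma multiplier_lim (u_ : nat -> T -> R) (u : T -> R) :
  (forall k, multiplier (u_ k)) -> (forall z, u_ ^~ z @ \oo --> u z) ->
  multiplier u.
Proof.
move=> mult uu.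
have mu k : measurable_fun setT (u_ k) by case: (mult k).
have u1 k z : `|u_ k z| <= 1 by case: (mult k).
have muu : measurable_fun setT u.
  by apply: (measurable_fun_cvg (h := u_)) => // z _; exact: uu.
have uu1 z : `|u z| <= 1.
  have h : (fun k => `|u_ k z|) @ \oo --> `|u z| by apply: cvg_norm; exact: uu.
  rewrite -(cvg_lim (@Rhausdorff R) h); apply: limr_le; first by apply/cvg_ex; exists `|u z|.
  exact: nearW.
split=> // F [F1 F0]; split=> [|k].
  apply: (@L1_bounded _ _ 1) => //; first exact: measurable_cfun_real.
  by move=> z; rewrite normc_real.
have zF := L1_zpow (- k) F1.
have e (v : T -> R) : (fun z => (v z)%:C%C * F z * circle_val z ^ (- k)) =
    (fun z => (v z)%:C%C * (circle_val z ^ (- k) * F z)).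
  by apply/funext => z; ring.
rewrite /fourier_coef e; apply: complex_eqP; rewrite ?(Re_cint, Im_cint).
  under eq_Rintegral do rewrite cReM /= mul0r subr0.
  apply: (Rintegral_mult_lim (u_ := u_)) => //; first exact: L1_Re.
  move=> j; have [_ _ /(_ F) []//] := mult j.
  move=> _ /(_ k); rewrite /fourier_coef e => /(congr1 cRe); rewrite Re_cint /= => <-.
  by apply: eq_Rintegral => z _; rewrite cReM /= mul0r subr0.
under eq_Rintegral do rewrite cImM /= mul0r addr0.
apply: (Rintegral_mult_lim (u_ := u_)) => //; first exact: L1_Im.
move=> j; have [_ _ /(_ F) []//] := mult j.
move=> _ /(_ k); rewrite /fourier_coef e => /(congr1 cIm); rewrite Im_cint /= => <-.
by apply: eq_Rintegral => z _; rewrite cImM /= mul0r addr0.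
Qed.

(** The sign of [u] is the limit of the iterates of [smoothstep], and the indicator is half the sum
    of the sign and its square. *)
Lemma multiplier_halfspace u : multiplier u ->
  multiplier (\1_[set z | 0 < u z]).
Proof.
move=> mu.
have ms : multiplier (fun z => Num.sg (u z)).
  apply: (multiplier_lim (u_ := fun k z => iter k smoothstep (u z))).
    elim=> [|k IH] //=; exact: multiplier_smoothstep.
  by case: mu => _ u1 _ z; exact: cvg_smoothstep.
have [mss _ nss] := multiplierM ms ms; have [mes _ ns] := ms.
have e z : \1_[set z | 0 < u z] z = (Num.sg (u z) + Num.sg (u z) * Num.sg (u z)) / 2 :> R.
  rewrite indicE; have [u0|u0|u0] := ltgtP (u z) 0.
  - rewrite ltr0_sg// memNset ?mulrNN ?mulr1 ?addNr ?mul0r//=.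
    by apply/negP; rewrite -leNgt ltW.
  - by rewrite gtr0_sg// mem_set// mulr1 -[1 + 1]/2%:R divff// pnatr_eq0.
  - by rewrite u0 sgr0 memNset /= ?mulr0 ?addr0 ?mul0r// u0 ltxx.
split.
- rewrite (_ : \1__ = fun z => (Num.sg (u z) + Num.sg (u z) * Num.sg (u z)) * 2^-1).
    by apply: measurable_funM; [exact: measurable_funD|exact: measurable_cst].
  by apply/funext => z; rewrite e.
- by move=> z; rewrite indicE; case: (_ \in _); rewrite ?normr1 ?normr0.
- move=> F F0; rewrite (_ : (fun _ => _) = fun z =>
    (2^-1)%:C%C * ((Num.sg (u z))%:C%C * F z + (Num.sg (u z) * Num.sg (u z))%:C%C * F z)).
    by apply: null_coefsZ; apply: null_coefsD; [exact: ns|exact: nss].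
  by apply/funext => z; rewrite -mulrDl -rmorphD mulrA -rmorphM e (mulrC 2^-1).
Qed.

Definition multiplier_set : set (set T) := [set A | multiplier \1_A].

Lemma multiplier_setC A : multiplier_set A -> multiplier_set (~` A).
Proof.
move=> [mA _ nA].
have e z : \1_(~` A) z = 1 - \1_A z :> R.
  rewrite !indicE in_setC; by case: (_ \in _); rewrite ?subr0 ?subrr.
split.
- rewrite (_ : \1__ = fun z => 1 - \1_A z); last by apply/funext.
  by apply: measurable_funB => //; exact: measurable_cst.
- by move=> z; rewrite indicE; case: (_ \in _); rewrite ?normr1 ?normr0.
- move=> F F0; rewrite (_ : (fun _ => _) = fun z => F z + (-1) * ((\1_A z)%:C%C * F z)).
    by apply: null_coefsD => //; apply: null_coefsZ; exact: nA.
  by apply/funext => z; rewrite e rmorphB mulrBl rmorph1 mul1r mulN1r.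
Qed.

Lemma multiplier_set0 : multiplier_set set0.
Proof.
split; first by rewrite indic0; exact: measurable_cst.
  by move=> z; rewrite indic0 normr0.
move=> F F0; rewrite indic0 (_ : (fun _ => _) = fun z => 0 * F z)//.
exact: null_coefsZ.
Qed.

Lemma multiplier_setU A B : multiplier_set A -> multiplier_set B ->
  multiplier_set (A `|` B).
Proof.
move=> /multiplier_setC mA /multiplier_setC mB.
rewrite -(setCK (A `|` B)) setCU; apply: multiplier_setC.
rewrite /multiplier_set /= (_ : \1__ = fun z => \1_(~` A) z * \1_(~` B) z).
  exact: multiplierM.
by apply/funext => z; rewrite !indicE in_setI; do 2 case: (_ \in _); rewrite ?mulr1 ?mulr0.
Qed.

Lemma multiplier_bigcup (A : (set T)^nat) : (forall k, multiplier_set (A k)) ->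
  multiplier_set (\bigcup_k A k).
Proof.
move=> mA; pose B k := \big[setU/set0]_(i < k) A i.
apply: (multiplier_lim (u_ := fun k => \1_(B k))).
  move=> k; rewrite /B; apply: (big_ind multiplier_set) => //.
    exact: multiplier_set0.
  exact: multiplier_setU.
move=> z; have [Az|Az] := pselect ((\bigcup_k A k) z).
  have [k _ Akz] := Az; rewrite indicE mem_set//.
  apply: cvg_near_cst; exists k.+1 => //= j /= kj.
  by rewrite indicE mem_set// /B -bigcup_mkord; exists k.
rewrite indicE memNset//; apply: cvg_near_cst; apply: nearW => k.
rewrite indicE memNset// /B -bigcup_mkord => -[i /= _ Aiz].
by apply: Az; exists i.
Qed.

(** The Borel sets of the plane whose trace on the circle is a multiplier form a sigma-algebra. It
    contains the open half-planes in each coordinate, and these generate. *)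
Lemma measurable_multiplier_set (A : set T) : measurable A -> multiplier_set A.
Proof.
pose D (B : set (R * R)) := multiplier_set ((@unit_coords R : T -> _) @^-1` B).
have sD : sigma_algebra setT D.
  split.
  - by rewrite /D preimage_set0; exact: multiplier_set0.
  - by move=> B; rewrite /D setTD preimage_setC; exact: multiplier_setC.
  - by move=> B mB; rewrite /D preimage_bigcup; exact: multiplier_bigcup.
have coordD (u : R * R -> R) : measurable_fun setT (fun z : T => u (unit_coords z)) ->
    (forall z : T, `|u (unit_coords z)| <= 1) ->
    (forall F, null_coefs F ->
       null_coefs (fun z : T => (u (unit_coords z))%:C%C * F z)) ->
    preimage_set_system setT u measurable `<=` D.
  move=> mu u1 nu _ [B mB <-]; rewrite setTI.
  have sE : sigma_algebra setT [set B | D (u @^-1` B)].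
    have [D0 DC DU] := sD; split=> /=.
    - by rewrite preimage_set0.
    - by move=> E; rewrite !setTD preimage_setC -setTD; exact: DC.
    - by move=> E; rewrite preimage_bigcup; exact: DU.
  suff: (@RGenOInfty.G R).-sigma.-measurable `<=` [set B | D (u @^-1` B)].
    by apply; rewrite -RGenOInfty.measurableE.
  apply: smallest_sub => // _ [a ->] /=; rewrite /D /multiplier_set /=.
  have := multiplier_halfspace (multiplier_coord a mu u1 nu).
  rewrite (_ : [set z | _] = (@unit_coords R : T -> _) @^-1` (u @^-1` `]a, +oo[%classic))//.
  have a0 : 0 < (1 + `|a|)^-1 by rewrite invr_gt0 ltr_pwDl.
  by apply/funext => z; rewrite /= in_itv /= andbT pmulr_lgt0// subr_gt0.
have [mre mim] := measurable_circle_val.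
move=> mA; have [B mB BA] : g_sigma_algebra_preimage (@unit_coords R) A := mA.
have {BA}-> : A = (@unit_coords R : T -> _) @^-1` B by rewrite -BA setTI.
suff : measurable `<=` D by apply.
apply: smallest_sub; first exact: sD.
move=> E []; apply: coordD => //.
- by move=> z; rewrite -(normc_circle_val z); exact: normc_Re.
- exact: null_coefs_Re.
- by move=> z; rewrite -(normc_circle_val z); exact: normc_Im.
- exact: null_coefs_Im.
Qed.

Lemma ae_eq0_of_null_coefs F : null_coefs F -> {ae m, forall z, F z = 0}.
Proof.
move=> F0; have [F1 _] := F0.
have intA (A : set T) : measurable A -> circle_int (fun z => (\1_A z)%:C%C * F z) = 0.
  move=> /measurable_multiplier_set[_ _ /(_ _ F0)[_ /(_ 0)]] <-.
  by apply: eq_cint => z; rewrite oppr0 expr0z mulr1.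
have ae0 (g : T -> R) : m.-integrable setT (EFin \o g) ->
    (forall A, measurable A -> \int[m]_z (\1_A z * g z) = 0) ->
    ae_eq m setT (EFin \o g) (cst 0%E).
  move=> gi g0; apply: integral_ae_eq => // A _ mA.
  rewrite integral0 integral_mkcond.
  have e : (EFin \o g) \_ A = EFin \o (fun z => \1_A z * g z).
    apply/funext => z; rewrite patchE /= indicE.
    by case: ifPn => _; rewrite ?mul1r ?mul0r.
  rewrite e -[LHS]fineK ?(g0 A mA)//; first by have := g0 A mA; rewrite /Rintegral /= => ->.
  apply: integrable_fin_num => //; apply: ge_integrable (integrable_norm gi).
    apply: measurable_funM; first exact: measurable_indic.
    by apply/measurable_EFinP; exact: measurable_int gi.
  move=> z; rewrite normrM ler_piMl// indicE; by case: (_ \in _); rewrite ?normr1 ?normr0.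
have re0 : ae_eq m setT (EFin \o (fun z => cRe (F z))) (cst 0%E).
  apply: (ae0 _ (L1_Re F1)) => A /intA/(congr1 cRe); rewrite Re_cint /= => <-.
  by apply: eq_Rintegral => z _; rewrite cReM /= mul0r subr0.
have im0 : ae_eq m setT (EFin \o (fun z => cIm (F z))) (cst 0%E).
  apply: (ae0 _ (L1_Im F1)) => A /intA/(congr1 cIm); rewrite Im_cint /= => <-.
  by apply: eq_Rintegral => z _; rewrite cImM /= mul0r addr0.
by apply: filterS2 re0 im0 => z /(_ I) [hr] /(_ I) [hi]; exact: complex_eqP.
Qed.

End Uniqueness.

(** * Mean values of the powers of [z] *)

Section ZPowerIntegral.
Context {R : realType}.
Local Notation C := R[i].
Local Notation T := (circle R).
Local Notation m := (circle_measure R).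
Local Notation cRe := (@complex.Re R).
Local Notation cIm := (@complex.Im R).

Lemma expi_pow (k : nat) (t : R) :
  circle_val (expi t) ^+ k = (cos (k%:R * t) +i* sin (k%:R * t))%C.
Proof.
elim: k => [|k IH]; first by rewrite expr0 mul0r cos0 sin0.
rewrite exprS IH -[in RHS]natr1 mulrDl mul1r cosD sinD.
by apply: complex_eqP; rewrite ?(cReM, cImM) /=; ring.
Qed.

(** The circle measure is the image of the uniform measure on the interval from 0 to [2 * pi], so
    this is the fundamental theorem of calculus. The change of variables is made for nonnegative
    functions. *)
Lemma Rintegral_circle (h : T -> R) (g G : R -> R) :
  measurable_fun setT h -> (forall z, 0 <= h z) ->
  (forall t, h (expi t) = g t) -> (forall t : R, is_derive t (1 : R) G (g t)) ->
  continuous g -> \int[m]_z h z = (2 * pi)^-1 * (G (2 * pi) - G 0).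
Proof.
move=> mh h0 hg dG cg; have pi0 := two_pi_gt0 R.
have cG : continuous G.
  by move=> t; apply: differentiable_continuous; apply/derivable1_diffP; have [] := dG t.
have mh' : measurable_fun setT (EFin \o h) by exact/measurable_EFinP.
rewrite /Rintegral /circle_measure (ge0_integral_distribution (@expi R) mh')//.
under eq_integral do rewrite /= hg.
rewrite integral_uniform; last 2 first.
- by apply/measurable_EFinP; exact: continuous_measurable_fun.
- by move=> t; rewrite lee_fin -hg.
rewrite (@continuous_FTC2 R g G)//.
- by rewrite subr0.
- exact: continuous_subspaceT.
- split; [by move=> t _; have [] := dG t| |].
    exact: cvg_at_right_filter (cG _).
  exact: cvg_at_left_filter (cG _).
- by move=> t _; rewrite derive1E; have [_ ->] := dG t.
Qed.

Lemma is_derive_mull (k x : R) : is_derive x (1 : R) (fun t : R => k * t) k.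
Proof. by apply: is_derive_eq; rewrite /GRing.scale /= ?mulr0 ?mulr1 ?add0r ?addr0. Qed.

Lemma cos_sin_2pik (k : nat) : cos (k%:R * (2 * pi)) = 1 :> R /\ sin (k%:R * (2 * pi)) = 0 :> R.
Proof.
elim: k => [|k [IHc IHs]]; first by rewrite mul0r cos0 sin0.
have e : (2 * pi : R) = pi *+ 2 by rewrite mulr_natl.
by rewrite -natr1 mulrDl mul1r cosD sinD IHc IHs e cos2pi sin2pi; split; ring.
Qed.

Lemma cint_zpow k : k != 0 -> circle_int (fun z : T => circle_val z ^ k) = 0.
Proof.
wlog: k / 0 < k => [wlog k0|k0 _].
  have [|kn|/eqP] := ltgtP k 0; [|exact: wlog|by rewrite (negbTE k0)].
  move=> kn; have := wlog (- k); rewrite oppr_gt0 kn oppr_eq0 => /(_ isT k0) h.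
  have := cint_conj (L2_L1 (L2_zpow (R := R) (- k))).
  by rewrite h conjc0 => <-; apply: eq_cint => z; rewrite conj_zpow opprK.
case: k k0 => // k k0; have kr0 : (k%:R : R) != 0 by rewrite pnatr_eq0 -lt0n.
have pi0 := two_pi_gt0 R.
have [mr mi] := measurable_zpow (R := R) k.
have zi := L2_L1 (L2_zpow (R := R) k).
(* Adding 1 makes the real and imaginary parts nonnegative, as [Rintegral_circle] requires; its
   integral is cancelled afterwards. *)
have re1 z : 0 <= 1 + cRe (circle_val z ^+ k :> C).
  by have := normc_Re (circle_val z ^ k); rewrite normc_zpow ler_norml -exprnP; lra.
have im1 z : 0 <= 1 + cIm (circle_val z ^+ k :> C).
  by have := normc_Im (circle_val z ^ k); rewrite normc_zpow ler_norml -exprnP; lra.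
have one : \int[m]_z 1 = 1 :> R.
  have mT : fine (m setT) = 1 by rewrite probability_setT.
  by rewrite Rintegral_cst// mT mulr1.
have [c1 s1] := cos_sin_2pik k.
have lin x := is_derive_mull k%:R x.
have ck : continuous (fun t : R => k%:R * t).
  by move=> t; apply: differentiable_continuous; apply/derivable1_diffP; have [] := lin t.
have dC (x : R) : is_derive x (1 : R) (fun t => t + k%:R^-1 * sin (k%:R * t)) (1 + cos (k%:R * x)).
  have ds := is_derive1_comp (is_derive_sin (k%:R * x)) (lin x).
  apply: (is_derive_eq (is_deriveD (is_derive_id x 1) (is_deriveZ k%:R^-1 ds))).
  by congr (1 + _); rewrite /GRing.scale /= mulrC mulfK.
have dS (x : R) : is_derive x (1 : R) (fun t => t + k%:R^-1 * (- cos (k%:R * t))) (1 + sin (k%:R * x)).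
  have ds := is_derive1_comp (is_derive_cos (k%:R * x)) (lin x).
  apply: (is_derive_eq (is_deriveD (is_derive_id x 1) (is_deriveZ k%:R^-1 (is_deriveN ds)))).
  by congr (1 + _); rewrite /GRing.scale /= mulNr opprK mulrC mulfK.
apply: complex_eqP; rewrite ?(Re_cint, Im_cint).
  apply: (addrI 1); rewrite -[in LHS]one -RintegralD//; last exact: L1_Re zi.
    rewrite (Rintegral_circle _ _ _ dC)//.
    - by rewrite s1 [k%:R * 0]mulr0 sin0 !mulr0 !addr0 subr0 mulVf ?gt_eqF.
    - by apply: measurable_funD => //; exact: measurable_cst.
    - by move=> t; rewrite -exprnP expi_pow.
    - move=> t; apply: cvgD; first exact: cvg_cst.
      by apply: continuous_comp; [exact: ck|exact: continuous_cos].
  exact: integrable_cst.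
apply: (addrI 1); rewrite -[in LHS]one -RintegralD//; last exact: L1_Im zi.
  rewrite (Rintegral_circle _ _ _ dS)//.
  - rewrite c1 [k%:R * 0]mulr0 cos0 add0r addrK mulVf ?gt_eqF//.
    by rewrite addr0.
  - by apply: measurable_funD => //; exact: measurable_cst.
  - by move=> t; rewrite -exprnP expi_pow.
  - move=> t; apply: cvgD; first exact: cvg_cst.
    by apply: continuous_comp; [exact: ck|exact: continuous_sin].
exact: integrable_cst.
Qed.

End ZPowerIntegral.

(** * Completeness and weighted norms *)

Section FastCauchy.
Context {R : realType}.
Local Notation w k := ((2^-1 : R) ^+ k).

Lemma half_pow_gt0 k : 0 < w k. Proof. by rewrite exprn_gt0. Qed.

Lemma half_powS k : w k = 2 * w k.+1.
Proof. by rewrite exprS mulrA divff ?mul1r ?pnatr_eq0. Qed.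

Lemma half_pow_le1 k : w k <= 1.
Proof. by rewrite exprn_ile1// invf_le1// ler1n. Qed.

Lemma cvg_half_pow : (fun k => w k) @ \oo --> (0 : R).
Proof. by apply: cvg_expr; rewrite ger0_norm// invf_lt1// ltr1n. Qed.

(** The correction [2 * M * w k] is the tail of the geometric series. Subtracting it makes the
    sequence nondecreasing and adding it makes it nonincreasing, so the limit is trapped between the
    two together with its rate. *)
Lemma fast_cauchy_cvg (a : nat -> R) (M : R) :
  (forall k, `|a k.+1 - a k| <= M * w k) ->
  exists l, a @ \oo --> l /\ forall k, `|a k - l| <= 2 * M * w k.
Proof.
move=> aM; pose b k := a k - 2 * M * w k; pose c k := a k + 2 * M * w k.
have M0 : 0 <= M.
  by have := aM 0; rewrite expr0 mulr1; exact: le_trans (normr_ge0 _).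
have ndb : nondecreasing_seq b.
  apply/nondecreasing_seqP => k; rewrite /b.
  by have := aM k; rewrite ler_norml => /andP[]; rewrite (half_powS k); lra.
have nic : nonincreasing_seq c.
  apply/nonincreasing_seqP => k; rewrite /c.
  by have := aM k; rewrite ler_norml => /andP[]; rewrite (half_powS k); lra.
have bc k : b k <= c k.
  have : 0 <= M * w k by rewrite mulr_ge0// ltW// half_pow_gt0.
  by rewrite /b /c; lra.
have bcjk j k : b j <= c k.
  have [jk|/ltnW kj] := leqP j k; first exact: le_trans (ndb _ _ jk) (bc k).
  exact: le_trans (bc j) (nic _ _ kj).
have cb : cvgn b.
  apply: nondecreasing_is_cvgn => //; exists (c 0) => _ [j _ <-]; exact: bcjk.
have lP k : `|a k - limn b| <= 2 * M * w k.
  have lb := nondecreasing_cvgn_le ndb cb k.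
  have lc : limn b <= c k by apply: limr_le => //; exact: nearW.
  by rewrite ler_norml; move: lb lc; rewrite /b /c; lra.
exists (limn b); split => //.
rewrite (_ : a = b + (fun k => 2 * M * w k)); last first.
  by apply/funext => k; rewrite /b -[RHS]/(_ + _) subrK.
rewrite -[X in _ --> X]addr0; apply: cvgD => //.
by rewrite -[X in _ --> X](mulr0 (2 * M)); apply: cvgM; [exact: cvg_cst|exact: cvg_half_pow].
Qed.

Lemma half_pow_nneseries : (\sum_(k <oo) (w k)%:E = 2%:E)%E.
Proof.
have := @cvg_geometric_eseries_half R 2 0; rewrite expr0 divr1.
rewrite (_ : eseries _ = fun j => (\sum_(0 <= k < j) (w k)%:E)%E).
  by move=> /(cvg_lim (@ereal_hausdorff R)).
apply/funext => j; apply: eq_bigr => k _; congr EFin.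
by rewrite addn1 natrX exprVn exprS invfM mulrA divff ?mul1r ?pnatr_eq0.
Qed.

End FastCauchy.

Section RealL2Complete.
Context {R : realType}.
Local Notation T := (circle R).
Local Notation m := (circle_measure R).
Local Notation w k := ((2^-1 : R) ^+ k).

(** Riesz-Fischer with a rate. Pointwise the squared distance to the limit is at most
    [4 * w k ^+ 2 * G], and [G] has integral at most 2, whence the 8. Half of the exponent 4 is
    spent on making [G] integrable. *)
Lemma real_L2_complete (u : nat -> T -> R) :
  (forall k, measurable_fun setT (u k)) ->
  (forall k, m.-integrable setT (EFin \o (fun z => (u k.+1 z - u k z) ^+ 2))) ->
  (forall k, \int[m]_z ((u k.+1 z - u k z) ^+ 2) <= w k ^+ 4) ->
  exists l : T -> R, measurable_fun setT l /\ forall k,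
    m.-integrable setT (EFin \o (fun z => (u k z - l z) ^+ 2)) /\
    \int[m]_z ((u k z - l z) ^+ 2) <= 8 * w k ^+ 2.
Proof.
move=> mu ui uw.
pose d k z := u k.+1 z - u k z.
have md k : measurable_fun setT (d k) by exact: measurable_funB.
(* The factor makes [G], the sum of the [h k], integrable; where [G] is finite
   the k-th increment is at most [2^-k sqrt G]. *)
pose h k z := (w k ^- 2 * d k z ^+ 2)%:E.
have w0 k : 0 < w k := half_pow_gt0 k.
have h0 k z : (0 <= h k z)%E.
  by rewrite lee_fin mulr_ge0 ?sqr_ge0// invr_ge0 exprn_ge0// ltW.
have mh k : measurable_fun setT (h k).
  apply/measurable_EFinP; apply: measurable_funM; first exact: measurable_cst.
  exact: measurable_funX.
pose G z := (\sum_(k <oo) h k z)%E.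
have mG : measurable_fun setT G.
  by apply: ge0_emeasurable_sum => // k z _ _; exact: h0.
have G0 z : (0 <= G z)%E by apply: nneseries_ge0 => k _ _; exact: h0.
have hi k : (\int[m]_z h k z <= (w k)%:E)%E.
  rewrite (_ : (\int[m]_z h k z)%E = (w k ^- 2 * \int[m]_z (d k z ^+ 2))%:E).
    have wi : 0 <= w k ^- 2 by rewrite invr_ge0 exprn_ge0// ltW.
    rewrite lee_fin (le_trans (ler_wpM2l wi (uw k)))//.
    rewrite (exprD _ 2 2) mulrA mulVf ?mul1r ?expf_neq0 ?gt_eqF//.
    by rewrite expr2 ler_piMl ?half_pow_le1// ltW.
  rewrite -RintegralZl//; last exact: ui.
  rewrite /Rintegral fineK//; apply: integrable_fin_num => //.
  exact: integrable_scaleR (ui k).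
have Gi : (\int[m]_z G z <= 2%:E)%E.
  rewrite (integral_nneseries _ measurableT mh (fun k z _ => h0 k z)).
  rewrite -half_pow_nneseries; apply: lee_nneseries => // k _ _.
  exact: integral_ge0.
have Gint : m.-integrable setT G.
  apply/integrableP; split=> //; rewrite (le_lt_trans _ (ltry 2))//.
  by under eq_integral do rewrite gee0_abs//.
have aeG : {ae m, forall z, G z \is a fin_num}.
  by apply: filterS (integrable_ae measurableT Gint) => z; apply.
pose g z := fine (G z).
have dg k z : G z \is a fin_num -> `|d k z| <= Num.sqrt (g z) * w k.
  move=> Gz; have hG : (h k z <= G z)%E.
    apply: le_trans (nneseries_lim_ge k.+1 _); last by move=> *; exact: h0.
    by rewrite big_nat_recr//= leeDr// sume_ge0// => *; exact: h0.
  have : w k ^- 2 * d k z ^+ 2 <= g z by rewrite -lee_fin fineK.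
  rewrite mulrC ler_pdivrMr ?exprn_gt0// => le_d.
  have gw : 0 <= Num.sqrt (g z) * w k by rewrite mulr_ge0 ?sqrtr_ge0// ltW.
  rewrite -ler_sqr ?nnegrE// real_normK ?num_real// exprMn sqr_sqrtr//.
  by rewrite fine_ge0.
pose A := [set z | G z \is a fin_num].
have mA : measurable A.
  by rewrite -[A]setTI; exact: emeasurable_fin_num.
have lex z : exists l, A z -> (fun k => u k z) @ \oo --> l /\
    forall k, `|u k z - l| <= 2 * Num.sqrt (g z) * w k.
  have [Az|nAz] := pselect (A z); last by exists 0.
  have [l lP] := fast_cauchy_cvg (a := fun k => u k z) (fun k => dg k z Az).
  by exists l.
have [l0 l0P] := choice lex.
(* Off [A] the chosen [l0] is arbitrary. The indicator makes [l] an everywhere limit of measurable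
   functions. *)
pose l z := \1_A z * l0 z.
have ml : measurable_fun setT l.
  apply: (measurable_fun_cvg (h := fun k z => \1_A z * u k z)).
    by move=> k; apply: measurable_funM => //; exact: measurable_indic.
  move=> z _; have [Az|nAz] := pselect (A z); rewrite /l indicE.
    rewrite mem_set// mul1r; under eq_fun do rewrite mul1r.
    by have [] := l0P z Az.
  rewrite memNset// mul0r; under eq_fun do rewrite mul0r.
  exact: cvg_cst.
have ul k : {ae m, forall z, (u k z - l z) ^+ 2 <= 4 * w k ^+ 2 * g z}.
  apply: filterS aeG => z Az; rewrite /l indicE mem_set// mul1r.
  have [_ /(_ k)] := l0P z Az.
  have gw : 0 <= 2 * Num.sqrt (g z) * w k by rewrite !mulr_ge0 ?sqrtr_ge0// ltW.
  rewrite -ler_sqr ?nnegrE// real_normK ?num_real//; move/le_trans; apply.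
  by rewrite !exprMn sqr_sqrtr ?fine_ge0//; rewrite mulrAC -natrX.
have gi : m.-integrable setT (EFin \o g).
  apply/integrableP; split.
    by apply/measurable_EFinP; exact: measurableT_comp.
  rewrite (le_lt_trans _ (ltry 2))// (le_trans _ Gi)//.
  apply: ae_ge0_le_integral => //.
  - by apply/measurable_EFinP; apply: measurableT_comp => //; exact: measurableT_comp.
  - by apply: filterS aeG => z Az _; rewrite /= ger0_norm ?fine_ge0// fineK.
have g2 : \int[m]_z g z <= 2.
  rewrite -lee_fin /Rintegral fineK; last exact: integrable_fin_num gi.
  rewrite (le_trans _ Gi)//; apply: ae_ge0_le_integral => //.
  - by move=> z _; rewrite lee_fin fine_ge0.
  - exact: measurable_int gi.
  - by apply: filterS aeG => z Az _; rewrite fineK.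
exists l; split=> // k.
have mul : measurable_fun setT (fun z => (u k z - l z) ^+ 2).
  by apply: measurable_funX; exact: measurable_funB.
have uli : m.-integrable setT (EFin \o (fun z => (u k z - l z) ^+ 2)).
  apply: ae_le_integrable (integrable_scaleR (4 * w k ^+ 2) gi) => //.
  by apply: filterS (ul k) => z; rewrite ger0_norm// sqr_ge0.
split=> //; apply: (@le_trans _ _ (4 * w k ^+ 2 * \int[m]_z g z)); last first.
  have : 0 <= w k ^+ 2 by rewrite exprn_ge0// ltW.
  by move: g2; nra.
rewrite -RintegralZl//; rewrite /Rintegral fine_le//.
- exact: integrable_fin_num uli.
- exact: (integrable_fin_num measurableT (integrable_scaleR (4 * w k ^+ 2) gi)).
- apply: ae_ge0_le_integral => //.
  + by move=> z _; rewrite lee_fin sqr_ge0.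
  + exact: measurable_int uli.
  + by move=> z _; rewrite lee_fin mulr_ge0 ?fine_ge0// mulr_ge0// exprn_ge0// ltW.
  + exact: measurable_int (integrable_scaleR (4 * w k ^+ 2) gi).
  + by apply: filterS (ul k) => z zl _; rewrite lee_fin.
Qed.

End RealL2Complete.

(** * Adjoints and weighted quadratic forms *)

Section Adjoint.
Context {R : realType}.
Local Notation C := R[i].
Local Notation cRe := (@complex.Re R).

Definition adj p q (A : 'M[C]_(p, q)) : 'M[C]_(q, p) := (map_mx conjc A)^T.

Lemma adjE p q (A : 'M[C]_(p, q)) i j : adj A i j = conjc (A j i).
Proof. by rewrite !mxE. Qed.

Lemma adjK p q (A : 'M[C]_(p, q)) : adj (adj A) = A.
Proof. by apply/matrixP => i j; rewrite !adjE conjcK. Qed.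

Lemma adjM p q r (A : 'M[C]_(p, q)) (B : 'M[C]_(q, r)) :
  adj (A *m B) = adj B *m adj A.
Proof. by rewrite /adj map_mxM trmx_mul. Qed.

Lemma adjD p q (A B : 'M[C]_(p, q)) : adj (A + B) = adj A + adj B.
Proof. by rewrite /adj map_mxD raddfD. Qed.

Lemma adjN p q (A : 'M[C]_(p, q)) : adj (- A) = - adj A.
Proof. by rewrite /adj map_mxN raddfN. Qed.

Lemma adjZ p q (c : C) (A : 'M[C]_(p, q)) : adj (c *: A) = conjc c *: adj A.
Proof. by apply/matrixP => i j; rewrite !(adjE, mxE) rmorphM. Qed.

Lemma adj1 n : adj (1%:M : 'M[C]_n) = 1%:M.
Proof. by rewrite /adj map_mx1 trmx1. Qed.

Lemma mxtrace_adj n (A : 'M[C]_n) : \tr (adj A) = conjc (\tr A).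
Proof. by rewrite /mxtrace rmorph_sum; apply: eq_bigr => i _; rewrite adjE. Qed.

Lemma sqr_hs_norm p q (A : 'M[C]_(p, q)) :
  hs_norm A ^+ 2 = \sum_i \sum_j normc (A i j) ^+ 2.
Proof.
by rewrite sqr_sqrtr//; apply: sumr_ge0 => i _; apply: sumr_ge0 => j _; exact: sqr_ge0.
Qed.

Lemma hs_norm_ge0 p q (A : 'M[C]_(p, q)) : 0 <= hs_norm A.
Proof. exact: sqrtr_ge0. Qed.

Lemma mxtrace_mul_adj p q (A : 'M[C]_(p, q)) :
  \tr (A *m adj A) = (hs_norm A ^+ 2)%:C%C.
Proof.
rewrite sqr_hs_norm rmorph_sum; apply: eq_bigr => i _; rewrite mxE rmorph_sum.
by apply: eq_bigr => j _; rewrite adjE mulcJ.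
Qed.

Lemma entry_le_hs_norm p q (A : 'M[C]_(p, q)) i j : normc (A i j) <= hs_norm A.
Proof.
rewrite -ler_sqr ?nnegrE ?normc_nneg ?hs_norm_ge0// sqr_hs_norm (bigD1 i)//= (bigD1 j)//=.
rewrite -addrA lerDl addr_ge0//; first by apply: sumr_ge0 => k _; exact: sqr_ge0.
by apply: sumr_ge0 => k _; apply: sumr_ge0 => l _; exact: sqr_ge0.
Qed.

(** The weight stands on the right of [X], so that for [W = F F^*] this is the squared
    Hilbert-Schmidt norm of [X F]. *)
Definition qform n p (W : 'M[C]_n) (X : 'M[C]_(p, n)) : R :=
  cRe (\tr (X *m W *m adj X)).

Lemma qform1 n p (X : 'M[C]_(p, n)) : qform 1%:M X = hs_norm X ^+ 2.
Proof. by rewrite /qform mulmx1 mxtrace_mul_adj. Qed.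

Lemma herm_trC n p (W : 'M[C]_n) (X Y : 'M[C]_(p, n)) : adj W = W ->
  \tr (Y *m W *m adj X) = conjc (\tr (X *m W *m adj Y)).
Proof. by move=> hW; rewrite -mxtrace_adj !adjM adjK hW mulmxA. Qed.

Lemma qformD n p (W : 'M[C]_n) (X Y : 'M[C]_(p, n)) : adj W = W ->
  qform W (X + Y) = qform W X + qform W Y + 2 * cRe (\tr (X *m W *m adj Y)).
Proof.
move=> hW; rewrite /qform adjD !mulmxDl !mulmxDr !mxtraceD !cReD.
rewrite (herm_trC X Y hW) cRe_conj.
move: (cRe (\tr (X *m W *m adj X))) (cRe (\tr (Y *m W *m adj Y))).
by move: (cRe (\tr (X *m W *m adj Y))) => a b c; ring.
Qed.

Lemma qformZ n p (W : 'M[C]_n) (c : C) (X : 'M[C]_(p, n)) :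
  qform W (c *: X) = normc c ^+ 2 * qform W X.
Proof.
rewrite /qform adjZ -scalemxAl -scalemxAl -scalemxAr !mxtraceZ mulrA mulcJ.
by rewrite cReM /= mul0r subr0.
Qed.

Lemma qformN n p (W : 'M[C]_n) (X : 'M[C]_(p, n)) : qform W (- X) = qform W X.
Proof. by rewrite -scaleN1r qformZ normcN normc1 expr1n mul1r. Qed.

Lemma qform_parallelogram n p (W : 'M[C]_n) (X Y : 'M[C]_(p, n)) : adj W = W ->
  qform W (X + Y) + qform W (X - Y) = 2 * qform W X + 2 * qform W Y.
Proof.
move=> hW; rewrite !qformD// qformN adjN mulmxN (raddfN (@mxtrace _ _)) /= cReN.
by move: (qform W X) (qform W Y) (cRe _) => a b c; ring.
Qed.

Lemma hs_normZ p q (c : C) (A : 'M[C]_(p, q)) : hs_norm (c *: A) = normc c * hs_norm A.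
Proof.
apply/eqP; rewrite -(eqrXn2 (n := 2)) ?mulr_ge0 ?normc_nneg ?hs_norm_ge0//.
by rewrite -qform1 qformZ qform1 exprMn.
Qed.

Lemma hs_normN p q (A : 'M[C]_(p, q)) : hs_norm (- A) = hs_norm A.
Proof. by rewrite -scaleN1r hs_normZ normcN normc1 mul1r. Qed.

Lemma sqr_hs_normD p q (X Y : 'M[C]_(p, q)) :
  hs_norm (X + Y) ^+ 2 <= 2 * hs_norm X ^+ 2 + 2 * hs_norm Y ^+ 2.
Proof.
rewrite -!qform1 -qform_parallelogram ?adj1// lerDl qform1 sqr_ge0//.
Qed.

Lemma qform_le n p (W : 'M[C]_n) (K : R) (X : 'M[C]_(p, n)) :
  (forall i j, normc (W i j) <= K) -> qform W X <= n%:R * K * hs_norm X ^+ 2.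
Proof.
move=> WK; rewrite (le_trans (le_Re_normc _))// sqr_hs_norm mulr_sumr.
rewrite (le_trans (normc_sum _ _ _))//; apply: ler_sum => i _.
rewrite mxE (le_trans (normc_sum _ _ _))//.
pose x j := normc (X i j).
apply: (@le_trans _ _ (\sum_j \sum_k K * ((x k ^+ 2 + x j ^+ 2) / 2))).
  apply: ler_sum => j _; rewrite normcM adjE normc_conj mxE.
  rewrite (le_trans (ler_wpM2r (normc_nneg _) (normc_sum _ _ _)))// mulr_suml.
  apply: ler_sum => k _; rewrite normcM -/(x k) -/(x j) mulrAC mulrC.
  have xk : 0 <= x k by exact: normc_nneg.
  have xj : 0 <= x j by exact: normc_nneg.
  rewrite (le_trans (ler_wpM2r (mulr_ge0 xk xj) (WK k j)))//.
  rewrite ler_wpM2l ?(le_trans (normc_nneg _) (WK k j))//.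
  by have := sqr_ge0 (x k - x j); nra.
under eq_bigr do rewrite -mulr_sumr -mulr_suml big_split /= sumr_const card_ord.
rewrite -mulr_sumr -mulr_suml big_split /= sumr_const card_ord sumrMnl.
by rewrite -mulr_natl le_eqVlt -/(x _); apply/orP; left; apply/eqP; field.
Qed.

End Adjoint.

(** The hypothesis is the expansion of the squared norm of [X - e^-1 Y], where [x] and [y] are the
    squared norms of [X] and [Y] and [t] is the real part of their inner product; multiplying by [e]
    gives Young's inequality. *)
Lemma young_square (R : realFieldType) (x y t e : R) : 0 < e ->
  0 <= x + e^-1 ^+ 2 * y + 2 * - (e^-1 * t) ->
  x + y + 2 * t <= (1 + e) * x + (1 + e^-1) * y.
Proof.
move=> e0 h; have : 0 <= e * (x + e^-1 ^+ 2 * y + 2 * - (e^-1 * t)).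
  by apply: mulr_ge0 h; exact: ltW.
have -> : e * (x + e^-1 ^+ 2 * y + 2 * - (e^-1 * t)) = e * x + e^-1 * y - 2 * t.
  by field; rewrite gt_eqF.
by lra.
Qed.

(** * Square integrable matrix functions and matrix weights *)

Section MatrixL2.
Context {R : realType} {n : nat}.
Local Notation C := R[i].
Local Notation T := (circle R).
Local Notation m := (circle_measure R).
Local Notation cRe := (@complex.Re R).
Local Notation cIm := (@complex.Im R).
Local Notation M := 'M[C]_n.
Implicit Types F G X Y : T -> M.

Definition mxL2 F := forall i j, L2 (fun z => F z i j).

Definition sqnorm F : R := \int[m]_z hs_norm (F z) ^+ 2.

Lemma mxL2_cst (A : M) : mxL2 (fun=> A).
Proof. by move=> i j; exact: L2_cst. Qed.

Lemma mxL2D F G : mxL2 F -> mxL2 G -> mxL2 (fun z => F z + G z).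
Proof.
by move=> F2 G2 i j; under [X in L2 X]eq_fun do rewrite mxE; exact: L2D.
Qed.

Lemma mxL2Z (c : C) F : mxL2 F -> mxL2 (fun z => c *: F z).
Proof.
by move=> F2 i j; under [X in L2 X]eq_fun do rewrite mxE; exact: L2Z.
Qed.

Lemma mxL2N F : mxL2 F -> mxL2 (fun z => - F z).
Proof.
by move=> F2 i j; under [X in L2 X]eq_fun do rewrite mxE; exact: L2N.
Qed.

Lemma mxL2B F G : mxL2 F -> mxL2 G -> mxL2 (fun z => F z - G z).
Proof. by move=> F2 G2; apply: mxL2D => //; exact: mxL2N. Qed.

Lemma mxL2_adj F : mxL2 F -> mxL2 (fun z => adj (F z)).
Proof.
by move=> F2 i j; under [X in L2 X]eq_fun do rewrite adjE; exact: L2_conj.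
Qed.

Lemma ae_mxL2_mull F G K : measurable_mxfun F ->
  {ae m, forall z, forall i j, normc (F z i j) <= K} -> mxL2 G ->
  mxL2 (fun z => F z *m G z).
Proof.
move=> mF FK G2 i j; under [X in L2 X]eq_fun do rewrite mxE.
apply: L2_sum => k _.
apply: (@ae_L2M R (fun z => F z i k) (fun z => G z k j) K) => //.
by apply: filterS FK.
Qed.

Lemma ae_mxL2_mulr F G K : measurable_mxfun F ->
  {ae m, forall z, forall i j, normc (F z i j) <= K} -> mxL2 G ->
  mxL2 (fun z => G z *m F z).
Proof.
move=> mF FK G2 i j; under [X in L2 X]eq_fun do rewrite mxE.
apply: L2_sum => k _; under [X in L2 X]eq_fun do rewrite mulrC.
apply: (@ae_L2M R (fun z => F z k j) (fun z => G z i k) K) => //.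
by apply: filterS FK.
Qed.

Lemma mxL2_mull F G K : measurable_mxfun F ->
  (forall z i j, normc (F z i j) <= K) -> mxL2 G -> mxL2 (fun z => F z *m G z).
Proof. by move=> mF FK; apply: (@ae_mxL2_mull _ _ K) => //; exact: nearW. Qed.

Lemma mxL2_mulr F G K : measurable_mxfun F ->
  (forall z i j, normc (F z i j) <= K) -> mxL2 G -> mxL2 (fun z => G z *m F z).
Proof. by move=> mF FK; apply: (@ae_mxL2_mulr _ _ K) => //; exact: nearW. Qed.

Lemma mxL2_zpow k F : mxL2 F -> mxL2 (fun z => circle_val z ^ k *: F z).
Proof.
move=> F2 i j; under [X in L2 X]eq_fun do rewrite mxE.
apply: (@L2M R (fun z => circle_val z ^ k) (fun z => F z i j) 1) => //; first exact: measurable_zpow.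
by move=> z; rewrite normc_zpow.
Qed.

Lemma mxL2_measurable F : mxL2 F -> measurable_mxfun F.
Proof. by move=> F2 i j; case: (F2 i j). Qed.

Lemma mxL1_entry F G i j : mxL2 F -> mxL2 G -> L1 (fun z => (F z *m G z) i j).
Proof.
move=> F2 G2; under [X in L1 X]eq_fun do rewrite mxE.
by apply: L1_sum => k _; exact: L2_L1M.
Qed.

Lemma mxL1_trace F G : mxL2 F -> mxL2 G -> L1 (fun z => \tr (F z *m G z)).
Proof. by move=> F2 G2; apply: L1_sum => i _; exact: mxL1_entry. Qed.

Lemma sqr_hs_norm_integrable F : mxL2 F ->
  m.-integrable setT (EFin \o (fun z => hs_norm (F z) ^+ 2)).
Proof.
move=> F2; have := L1_Re (mxL1_trace F2 (mxL2_adj F2)).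
by under eq_fun do rewrite mxtrace_mul_adj.
Qed.

Lemma measurable_sqr_hs_norm F : measurable_mxfun F ->
  measurable_fun setT (fun z => hs_norm (F z) ^+ 2).
Proof.
move=> mF; under [X in measurable_fun _ X]eq_fun do rewrite sqr_hs_norm.
apply: (@measurable_sum _ _ _ _ _ _ (fun i z => \sum_j normc (F z i j) ^+ 2)) => i.
apply: (@measurable_sum _ _ _ _ _ _ (fun j z => normc (F z i j) ^+ 2)) => j.
exact: measurable_normc_sqr.
Qed.

Lemma measurable_hs_norm F : measurable_mxfun F ->
  measurable_fun setT (fun z => hs_norm (F z)).
Proof.
move=> mF; have msqrt : measurable_fun setT (@Num.sqrt R).
  by apply: continuous_measurable_fun; exact: sqrt_continuous.
under [X in measurable_fun _ X]eq_fun do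
  rewrite -(ger0_norm (hs_norm_ge0 _)) -sqrtr_sqr.
exact: measurableT_comp msqrt (measurable_sqr_hs_norm mF).
Qed.

Lemma mxL2P F : measurable_mxfun F ->
  m.-integrable setT (EFin \o (fun z => hs_norm (F z) ^+ 2)) -> mxL2 F.
Proof.
move=> mF Fi i j; apply: ge_L2 Fi => // z.
by rewrite ler_sqr ?nnegrE ?normc_nneg ?hs_norm_ge0// entry_le_hs_norm.
Qed.

Lemma sqnorm_ge0 F : 0 <= sqnorm F.
Proof. by apply: Rintegral_ge0 => z _; exact: sqr_ge0. Qed.

Lemma sqnormC F G : sqnorm (fun z => F z - G z) = sqnorm (fun z => G z - F z).
Proof. by apply: eq_Rintegral => z _; rewrite -opprB hs_normN. Qed.

Lemma sqnormD F G : mxL2 F -> mxL2 G ->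
  sqnorm (fun z => F z + G z) <= 2 * sqnorm F + 2 * sqnorm G.
Proof.
move=> F2 G2; have Fi := sqr_hs_norm_integrable F2.
have Gi := sqr_hs_norm_integrable G2.
rewrite -!RintegralZl// -RintegralD//; try exact: integrable_scaleR.
apply: le_Rintegral => //; first exact: sqr_hs_norm_integrable (mxL2D F2 G2).
  by apply: integrable_addR; exact: integrable_scaleR.
by move=> z _; exact: sqr_hs_normD.
Qed.

(** The constant [k] is a lower bound in the order of Hermitian forms, while [K] bounds the entries.
    For [k > 0] the norm of [L^2(W)] is equivalent to the unweighted one; [k = 0] admits degenerate
    weights, in particular those of rank one. *)
Definition weight (k K : R) (W : T -> M) := [/\ measurable_mxfun W,
  forall z, adj (W z) = W z, forall z i j, normc (W z i j) <= K &
  forall z (X : M), k * hs_norm X ^+ 2 <= qform (W z) X].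

Lemma weight1 : weight 1 1 (fun=> 1%:M).
Proof.
split=> [i j|z|z i j|z X]; first exact: measurable_cfun_cst.
- exact: adj1.
- by rewrite mxE; case: (_ == _); rewrite ?normc1 ?normc0.
- by rewrite qform1 mul1r.
Qed.

(** The norm of [L^2(W)] is kept squared, which makes it affine in [W]. *)
Definition wnorm W X : R := \int[m]_z qform (W z) (X z).

Lemma wnorm1 X : wnorm (fun=> 1%:M) X = sqnorm X.
Proof. by apply: eq_Rintegral => z _; rewrite qform1. Qed.

Section Weighted.
Variables (k K : R) (W : T -> M).
Hypothesis (k0 : 0 <= k) (wW : weight k K W).

Lemma weight_L1 X Y : mxL2 X -> mxL2 Y -> L1 (fun z => \tr (X z *m W z *m adj (Y z))).
Proof.
have [mW _ WK _] := wW; move=> X2 Y2.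
by apply: mxL1_trace; [exact: mxL2_mulr WK X2|exact: mxL2_adj].
Qed.

Lemma weight_integrable X : mxL2 X ->
  m.-integrable setT (EFin \o (fun z => qform (W z) (X z))).
Proof. by move=> X2; exact: L1_Re (weight_L1 X2 X2). Qed.

Lemma wnorm_ge0 X : 0 <= wnorm W X.
Proof.
have [_ _ _ Wk] := wW; apply: Rintegral_ge0 => z _.
by rewrite (le_trans _ (Wk _ _))// mulr_ge0// sqr_ge0.
Qed.

Lemma wnorm_ge_sqnorm X : mxL2 X -> k * sqnorm X <= wnorm W X.
Proof.
have [_ _ _ Wk] := wW; move=> X2; have Xi := sqr_hs_norm_integrable X2.
rewrite -RintegralZl//; apply: le_Rintegral => //.
- exact: integrable_scaleR.
- exact: weight_integrable.
Qed.

Lemma wnorm_le_sqnorm X : mxL2 X -> wnorm W X <= n%:R * K * sqnorm X.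
Proof.
have [_ _ WK _] := wW; move=> X2; have Xi := sqr_hs_norm_integrable X2.
rewrite -RintegralZl//; apply: le_Rintegral => //.
- exact: weight_integrable.
- exact: integrable_scaleR.
- by move=> z _; exact: qform_le.
Qed.

Lemma wnorm_expand X Y (c : C) : mxL2 X -> mxL2 Y ->
  wnorm W (fun z => X z + c *: Y z) = wnorm W X + normc c ^+ 2 * wnorm W Y +
    2 * cRe (conjc c * circle_int (fun z => \tr (X z *m W z *m adj (Y z)))).
Proof.
have [_ hW _ _] := wW; move=> X2 Y2; have Xi := weight_integrable X2.
have Yi := weight_integrable Y2; have XY1 := weight_L1 X2 Y2.
have cXY := L1Z (conjc c) XY1.
have i2 := integrable_scaleR (normc c ^+ 2) Yi.
have i3 := integrable_scaleR 2 (L1_Re cXY).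
rewrite -cintZ//; transitivity (\int[m]_z (qform (W z) (X z) +
    normc c ^+ 2 * qform (W z) (Y z) +
    2 * cRe (conjc c * \tr (X z *m W z *m adj (Y z))))).
  by apply: eq_Rintegral => z _; rewrite qformD// qformZ adjZ -scalemxAr mxtraceZ.
rewrite (RintegralD measurableT (integrable_addR Xi i2) i3).
rewrite (RintegralD measurableT Xi i2) (RintegralZl _ measurableT Yi).
by rewrite (RintegralZl _ measurableT (L1_Re cXY)).
Qed.

Lemma wnorm_parallelogram X Y : mxL2 X -> mxL2 Y ->
  wnorm W (fun z => X z + Y z) + wnorm W (fun z => X z - Y z) =
  2 * wnorm W X + 2 * wnorm W Y.
Proof.
have [_ hW _ _] := wW; move=> X2 Y2; have Xi := weight_integrable X2.
have Yi := weight_integrable Y2.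
have i1 := weight_integrable (mxL2D X2 Y2).
have i2 := weight_integrable (mxL2B X2 Y2).
transitivity (\int[m]_z (2 * qform (W z) (X z) + 2 * qform (W z) (Y z))).
  rewrite -(RintegralD measurableT i1 i2).
  by apply: eq_Rintegral => z _; exact: qform_parallelogram.
rewrite (RintegralD measurableT (integrable_scaleR 2 Xi) (integrable_scaleR 2 Yi)).
by rewrite (RintegralZl _ measurableT Xi) (RintegralZl _ measurableT Yi).
Qed.

(* Lower semicontinuity, with the explicit modulus (1 + e, 1 + 1/e). *)
Lemma wnorm_lsc X Y (e : R) : mxL2 X -> mxL2 Y -> 0 < e ->
  wnorm W (fun z => X z + Y z) <= (1 + e) * wnorm W X + (1 + e^-1) * wnorm W Y.
Proof.
move=> X2 Y2 e0; have h := wnorm_ge0 (fun z => X z + (- (e^-1)%:C%C) *: Y z).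
have e1 : wnorm W (fun z => X z + Y z) = wnorm W (fun z => X z + 1 *: Y z).
  by congr wnorm; apply/funext => z; rewrite scale1r.
rewrite e1 (wnorm_expand 1 X2 Y2); move: h; rewrite (wnorm_expand _ X2 Y2).
move: (wnorm W X) (wnorm W Y) (circle_int _) => x y u.
rewrite normcN normc1 normc_real conjc1 mul1r.
rewrite conjcN_real mulNr cReN cRe_real_mul ger0_norm; last by rewrite invr_ge0 ltW.
rewrite expr1n mul1r.
by apply: young_square.
Qed.

End Weighted.

End MatrixL2.

(** * Minimax for strongly convex functions *)

Section StrongConvexity.
Context {R : realType}.
Local Notation w k := ((2^-1 : R) ^+ k).

Lemma le_half_pow_lim (x y K : R) : (forall k, x <= y + K * w k) -> x <= y.
Proof.
move=> xy; have h : (fun k => y + K * w k) @ \oo --> y.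
  rewrite -[X in _ --> X]addr0; apply: cvgD; first exact: cvg_cst.
  by rewrite -[X in _ --> X](mulr0 K); apply: cvgM; [exact: cvg_cst|exact: cvg_half_pow].
rewrite -(cvg_lim (@Rhausdorff R) h); apply: limr_ge; first by apply/cvg_ex; exists y.
exact: nearW.
Qed.

Lemma le_eps_mul (x y : R) : (forall e, 0 < e -> x <= (1 + e) * y) -> x <= y.
Proof.
move=> xy; apply: (@le_half_pow_lim _ _ y) => k.
by have := xy _ (half_pow_gt0 k); lra.
Qed.

Lemma half_powX_le j i : w j ^+ i.+1 <= w j.
Proof.
have w0 := half_pow_gt0 (R := R) j; rewrite exprS (ler_piMr (ltW w0))//.
by rewrite exprn_ile1 ?half_pow_le1// ltW.
Qed.

Lemma half_pow4S j : w j.+1 ^+ 4 <= w j ^+ 4.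
Proof.
have w0 := half_pow_gt0 (R := R) j; have w1 := half_pow_gt0 (R := R) j.+1.
by rewrite lerXn2r ?nnegrE ?ltW// [ltRHS]half_powS; lra.
Qed.

Variables (X : Type) (S : set X) (mid : X -> X -> X) (D : X -> X -> R) (k : R).
Hypotheses (S0 : S !=set0) (k0 : 0 < k).
Hypothesis Smid : forall a b, S a -> S b -> S (mid a b).
Hypothesis Scomplete : forall u : nat -> X, (forall j, S (u j)) ->
  (forall j, D (u j.+1) (u j) <= w j ^+ 4) ->
  exists2 l, S l & exists K, forall j, D (u j) l <= K * w j ^+ 2.

(** Here [k] is the convexity modulus at midpoints, and the last clause is a quantitative lower
    semicontinuity. [D] plays the role of a squared distance, so completeness is asked only along
    sequences whose steps have length at most [4^-j]. *)
Definition strongly_convex (f : X -> R) := [/\ forall a, S a -> 0 <= f a,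
  forall a b, S a -> S b -> f (mid a b) + k * D a b <= (f a + f b) / 2 &
  forall a e, S a -> 0 < e -> exists c, 0 <= c /\
    forall b, S b -> f a <= (1 + e) * f b + c * D b a].

(** Comparing two almost minimal points with their midpoint shows that a minimising sequence with
    errors [k * w j ^+ 4] converges fast enough for [Scomplete]. Comparing the minimiser with any
    [b] in the same way yields the gain [2 * k * D a b]. *)
Lemma strongly_convex_min f : strongly_convex f ->
  exists2 a, S a & forall b, S b -> f a + 2 * k * D a b <= f b.
Proof.
move=> [f0 fmid flsc].
pose E := f @` S; have E0 : E !=set0 by have [a Sa] := S0; exists (f a); exists a.
have lE : has_lbound E by exists 0 => _ [a Sa <-]; exact: f0.
have hE : has_inf E by [].
have infE a : S a -> inf E <= f a by move=> Sa; apply: ge_inf => //; exists a.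
have exu j : exists a, S a /\ f a <= inf E + k * w j ^+ 4.
  have e0 : 0 < k * w j ^+ 4 by rewrite mulr_gt0// exprn_gt0// half_pow_gt0.
  have [_ [a Sa <-] h] := inf_adherent e0 hE.
  by exists a; split=> //; exact: ltW.
have [u uP] := choice exu.
have Du j : D (u j.+1) (u j) <= w j ^+ 4.
  have [S1 h1] := uP j.+1; have [S2 h2] := uP j.
  rewrite -(ler_pM2l k0).
  have := fmid _ _ S1 S2; have := infE _ (Smid S1 S2).
  by have := ler_wpM2l (ltW k0) (half_pow4S j); lra.
have [l Sl [K KP]] := Scomplete (fun j => (uP j).1) Du.
(* Lower semicontinuity: [j] tends to infinity for a fixed [e], and then [e] tends to 0. *)
have fl : f l <= inf E.
  apply: le_eps_mul => e e0; have [c [c0 cP]] := flsc l e Sl e0.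
  apply: (@le_half_pow_lim _ _ ((1 + e) * k + c * `|K|)) => j.
  have [Su h] := uP j; apply: le_trans (cP _ Su) _.
  have := ler_wpM2l (_ : 0 <= 1 + e) h; have := ler_wpM2l c0 (KP j).
  have w0 := half_pow_gt0 (R := R) j; have w1 := half_pow_le1 (R := R) j.
  have w2 := half_powX_le j 1; have w24 := half_powX_le j 3.
  have : K * w j ^+ 2 <= `|K| * w j.
    apply: le_trans (ler_wpM2l (normr_ge0 K) w2).
    by rewrite ler_wpM2r ?ler_norm// exprn_ge0// ltW.
  move=> /(ler_wpM2l c0) h1 h2 /(_ _) h3.
  have /h3 : 0 <= 1 + e by lra.
  have := ler_wpM2l (_ : 0 <= (1 + e) * k) w24.
  have ek : 0 <= (1 + e) * k by rewrite mulr_ge0 ?ltW// addr_gt0.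
  by move=> /(_ ek); lra.
exists l => // b Sb.
have := fmid _ _ Sl Sb; have := infE _ (Smid Sl Sb); lra.
Qed.

Hypothesis DC : forall a b, D a b = D b a.
Hypothesis Dtri : forall a b c, S a -> S b -> S c -> D a c <= 2 * D a b + 2 * D b c.
Hypothesis D0 : forall a b, 0 <= D a b.

Variables (I : Type) (P : set I) (conv : R -> I -> I -> I) (f : I -> X -> R).
Hypothesis P0 : P !=set0.
Hypothesis Pconv : forall t V W, 0 <= t <= 1 -> P V -> P W -> P (conv t V W).
Hypothesis fconv : forall t V W a, 0 <= t <= 1 -> P V -> P W -> S a ->
  f (conv t V W) a = t * f V a + (1 - t) * f W a.
Hypothesis fP : forall W, P W -> strongly_convex (f W).

(* The minimisers of almost optimal weights form a Cauchy sequence: compare two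
   of them with the minimiser for the average weight. Perturbing an almost
   optimal weight towards [V] bounds [f V] at the limit. *)
Lemma strongly_convex_minimax c :
  (forall W, P W -> exists2 a, S a & f W a <= c) ->
  exists2 a, S a & forall W, P W -> f W a <= c.
Proof.
move=> fc.
have exa W : exists a, P W -> S a /\ forall b, S b -> f W a + 2 * k * D a b <= f W b.
  have [PW|nPW] := pselect (P W); last by have [a _] := S0; exists a.
  by have [a Sa aP] := strongly_convex_min (fP PW); exists a.
have [am amP] := choice exa.
pose g W := f W (am W).
have gc W : P W -> g W <= c.
  move=> PW; have [a Sa /(le_trans _)] := fc W PW; apply.
  have [_ /(_ a Sa)] := amP W PW; rewrite /g.
  have := mulr_ge0 (ltW k0) (D0 (am W) a); lra.
have g0 W : P W -> 0 <= g W.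
  by move=> PW; have [h _ _] := fP PW; apply: h; have [] := amP W PW.
pose E := g @` P.
have hE : has_sup E.
  split; first by have [W PW] := P0; exists (g W); exists W.
  by exists c => _ [W PW <-]; exact: gc.
pose s := sup E.
have gs W : P W -> g W <= s by move=> PW; apply: ub_le_sup; [case: hE|exists W].
have sc : s <= c by apply: ge_sup; [case: hE|move=> _ [W PW <-]; exact: gc].
have s0 : 0 <= s by have [W PW] := P0; exact: le_trans (g0 W PW) (gs W PW).
(* Small enough for two consecutive minimisers to be within [w j ^+ 4] of each other, after the loss
   of a factor 2 in [Dtri]. *)
pose de j := k * w j ^+ 4 / 2.
have de0 j : 0 < de j by rewrite !mulr_gt0// exprn_gt0// half_pow_gt0.
have exW j : exists W, P W /\ s - de j <= g W.
  have [_ [W PW <-] h] := sup_adherent (de0 j) hE.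
  by exists W; split=> //; exact: ltW.
have [Ws WsP] := choice exW.
pose a j := am (Ws j).
have Sa j : S (a j) by have [PW _] := WsP j; have [] := amP _ PW.
have aP j b : S b -> s - de j + 2 * k * D (a j) b <= f (Ws j) b.
  move=> Sb; have [PW h] := WsP j; have [_ /(_ b Sb)] := amP _ PW.
  by move: h; rewrite /g /a; lra.
have Da j : D (a j.+1) (a j) <= w j ^+ 4.
  have [P1 _] := WsP j.+1; have [P2 _] := WsP j.
  have h01 : 0 <= (2^-1 : R) <= 1 by lra.
  have PW := Pconv h01 P1 P2; pose b := am (conv 2^-1 (Ws j.+1) (Ws j)).
  have Sb : S b by have [] := amP _ PW.
  have := gs _ PW; rewrite /g fconv// -/b => gb.
  have h1 := aP j.+1 b Sb; have h2 := aP j b Sb.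
  have h3 := Dtri (Sa j.+1) Sb (Sa j); rewrite (DC b) in h3.
  have h4 := ler_wpM2l (ltW k0) (half_pow4S j).
  rewrite -(ler_pM2l k0); have := ler_wpM2l (ltW k0) h3.
  by move: gb h1 h2 h4; rewrite /de; lra.
have [l Sl [K KP]] := Scomplete Sa Da.
exists l => // V PV; apply: le_trans sc.
apply: le_eps_mul => e e0; have [_ _ /(_ l e Sl e0) [c1 [c10 c1P]]] := fP PV.
have bnd j : f V l <= (1 + e) * (s + k * w j.+1 ^+ 2 / 2) +
    c1 * (2 / k * (w j.+1 ^+ 2 * s + de j.+1) + 2 * (K * w j.+1 ^+ 2)).
  (* The share [t] of [V] tends to 0, which keeps the minimiser [b] of the mixture close to
     [a j.+1], yet the optimality gap [de j.+1] is of order [t ^+ 2], so dividing by [t] still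
     leaves a vanishing error in the bound on [f V b]. The index [j.+1] ensures that [t] is at most
     one half. *)
  set t := w j.+1 ^+ 2; have w0 := half_pow_gt0 (R := R) j.+1.
  have t0 : 0 < t by rewrite exprn_gt0.
  have t12 : t <= 2^-1.
    have := half_powX_le j.+1 1; rewrite -/t.
    by have := half_pow_le1 (R := R) j; rewrite (half_powS j); lra.
  have [PW _] := WsP j.+1.
  have t01 : 0 <= t <= 1 by lra.
  have PW' := Pconv t01 PV PW; pose b := am (conv t V (Ws j.+1)).
  have Sb : S b by have [] := amP _ PW'.
  have := gs _ PW'; rewrite /g fconv// -/b => gb.
  have h1 := aP j.+1 b Sb.
  have fV0 : 0 <= f V b by have [h _ _] := fP PV; exact: h.
  have d0 := de0 j.+1; have Db := D0 (a j.+1) b.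
  have h2 : (1 - t) * (s - de j.+1 + 2 * k * D (a j.+1) b) <= (1 - t) * f (Ws j.+1) b.
    by rewrite ler_wpM2l//; lra.
  have kD0 : 0 <= k * D (a j.+1) b by rewrite mulr_ge0// ltW.
  have h3 : t * f V b + (1 - t) * (2 * (k * D (a j.+1) b)) <= t * s + de j.+1.
    have td : 0 <= t * de j.+1 by rewrite mulr_ge0 ?ltW.
    by move: h2 gb td; lra.
  have h4 : k * D (a j.+1) b <= t * s + de j.+1.
    have t1 : 0 <= 1 - 2 * t by lra.
    have := mulr_ge0 t1 kD0.
    by have := mulr_ge0 (ltW t0) fV0; move: h3; lra.
  have h5 : f V b <= s + k * t / 2.
    rewrite -(ler_pM2l t0).
    have t1 : 0 <= 1 - t by lra.
    have : 0 <= (1 - t) * (2 * (k * D (a j.+1) b)).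
      by apply: (mulr_ge0 t1); exact: mulr_ge0.
    have : de j.+1 = t * (k * t / 2) by rewrite /de /t; field.
    by move: h3; lra.
  apply: le_trans (c1P b Sb) _; apply: lerD; first by rewrite ler_wpM2l//; lra.
  rewrite ler_wpM2l//; apply: le_trans (Dtri Sb (Sa j.+1) Sl) _.
  rewrite (DC b); apply: lerD; last by rewrite ler_wpM2l.
  by rewrite -mulrA ler_wpM2l// mulrC ler_pdivlMr// mulrC.
apply: (@le_half_pow_lim _ _ ((1 + e) * k + c1 * (2 / k * (s + k) + 2 * `|K|))) => j.
apply: le_trans (bnd j) _.
have w0 := half_pow_gt0 (R := R) j; have w1 := half_pow_le1 (R := R) j.
have v0 := half_pow_gt0 (R := R) j.+1; have v1 := half_pow_le1 (R := R) j.+1.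
have vw : w j.+1 <= w j by rewrite [leRHS]half_powS; lra.
have v2 : w j.+1 ^+ 2 <= w j.
  exact: le_trans (half_powX_le j.+1 1) vw.
have v20 : 0 <= w j.+1 ^+ 2 by rewrite exprn_ge0// ltW.
have v4 : w j.+1 ^+ 4 <= w j.
  exact: le_trans (half_powX_le j.+1 3) vw.
have i1 : k * w j.+1 ^+ 2 / 2 <= k * w j.
  have := ler_wpM2l (ltW k0) v2; have := mulr_ge0 (ltW k0) v20; lra.
have i2 : w j.+1 ^+ 2 * s + de j.+1 <= (s + k) * w j.
  have := ler_wpM2r s0 v2; have := ler_wpM2l (ltW k0) v4.
  have := mulr_ge0 (ltW k0) (exprn_ge0 4 (ltW v0)); rewrite /de; lra.
have i3 : K * w j.+1 ^+ 2 <= `|K| * w j.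
  apply: le_trans (ler_wpM2l (normr_ge0 K) v2).
  by rewrite ler_wpM2r// ler_norm.
have e10 : 0 <= 1 + e by lra.
have k20 : 0 <= 2 / k by rewrite divr_ge0// ltW.
have := ler_wpM2l e10 i1.
have := ler_wpM2l c10 (lerD (ler_wpM2l k20 i2) (ler_wpM2l (ler0n _ 2) i3)).
move: (w j.+1 ^+ 2 * s + de j.+1) (K * w j.+1 ^+ 2) (k * w j.+1 ^+ 2 / 2) => B C A.
by move: (2 / k) => d; lra.
Qed.

End StrongConvexity.

(** * Orthogonal projections in weighted [L^2] *)

Section Projection.
Context {R : realType} {n : nat}.
Local Notation C := R[i].
Local Notation T := (circle R).
Local Notation m := (circle_measure R).
Local Notation cRe := (@complex.Re R).
Local Notation cIm := (@complex.Im R).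
Local Notation M := 'M[C]_n.
Local Notation w k := ((2^-1 : R) ^+ k).
Implicit Types F G X Y : T -> M.

Lemma sqr_Re_le (x : C) : cRe x ^+ 2 <= normc x ^+ 2.
Proof. by rewrite normc_sqr lerDl sqr_ge0. Qed.

Lemma sqr_Im_le (x : C) : cIm x ^+ 2 <= normc x ^+ 2.
Proof. by rewrite normc_sqr lerDr sqr_ge0. Qed.

Lemma sqr_entry_le p q (A : 'M[C]_(p, q)) i j : normc (A i j) ^+ 2 <= hs_norm A ^+ 2.
Proof. by rewrite ler_sqr ?nnegrE ?normc_nneg ?hs_norm_ge0// entry_le_hs_norm. Qed.

(** Here [r] stands for the real or the imaginary part of one entry, which reduces completeness to
    the real scalar case. *)
Lemma entry_part_complete (u : nat -> T -> M) (r : T -> M -> R) :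
  (forall k, mxL2 (u k)) ->
  (forall k, sqnorm (fun z => u k.+1 z - u k z) <= w k ^+ 4) ->
  (forall z A B, r z (A - B) = r z A - r z B) ->
  (forall z A, r z A ^+ 2 <= hs_norm A ^+ 2) ->
  (forall F, measurable_mxfun F -> measurable_fun setT (fun z => r z (F z))) ->
  exists l : T -> R, measurable_fun setT l /\ forall k,
    m.-integrable setT (EFin \o (fun z => (r z (u k z) - l z) ^+ 2)) /\
    \int[m]_z ((r z (u k z) - l z) ^+ 2) <= 8 * w k ^+ 2.
Proof.
move=> u2 uw rB r_le mr.
have di k : m.-integrable setT
    (EFin \o (fun z => (r z (u k.+1 z) - r z (u k z)) ^+ 2)).
  apply: ge_integrable (sqr_hs_norm_integrable (mxL2B (u2 k.+1) (u2 k))).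
    apply: measurable_funX; apply: measurable_funB; apply: mr; exact: mxL2_measurable.
  by move=> z; rewrite ger0_norm ?sqr_ge0// -rB.
apply: real_L2_complete => // k; first by apply: mr; exact: mxL2_measurable.
apply: le_trans (uw k); apply: le_Rintegral => //.
  exact: sqr_hs_norm_integrable (mxL2B (u2 k.+1) (u2 k)).
by move=> z _; rewrite -rB.
Qed.

Lemma mx_L2_complete (u : nat -> T -> M) : (forall k, mxL2 (u k)) ->
  (forall k, sqnorm (fun z => u k.+1 z - u k z) <= w k ^+ 4) ->
  exists2 l, mxL2 l & exists K, forall k, sqnorm (fun z => u k z - l z) <= K * w k ^+ 2.
Proof.
move=> u2 uw.
have exl (i j : 'I_n) : exists l : T -> C, measurable_cfun l /\ forall k,
    L2 (fun z => u k z i j - l z) /\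
    \int[m]_z (normc (u k z i j - l z) ^+ 2) <= 16 * w k ^+ 2.
  have [|||l1 [ml1 l1P]] := entry_part_complete (r := fun z A => cRe (A i j)) u2 uw.
  - by move=> z A B; rewrite !mxE cReD cReN.
  - by move=> z A; apply: le_trans (sqr_Re_le _) (sqr_entry_le _ _ _).
  - by move=> F mF; case: (mF i j).
  have [|||l2 [ml2 l2P]] := entry_part_complete (r := fun z A => cIm (A i j)) u2 uw.
  - by move=> z A B; rewrite !mxE cImD cImN.
  - by move=> z A; apply: le_trans (sqr_Im_le _) (sqr_entry_le _ _ _).
  - by move=> F mF; case: (mF i j).
  pose l z := (l1 z +i* l2 z)%C.
  have ml : measurable_cfun l by split.
  have nE k z : normc (u k z i j - l z) ^+ 2 =
      (cRe (u k z i j) - l1 z) ^+ 2 + (cIm (u k z i j) - l2 z) ^+ 2.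
    by rewrite normc_sqr cReD cImD cReN cImN.
  exists l; split=> // k; have [i1 b1] := l1P k; have [i2 b2] := l2P k.
  have i12 := integrable_addR i1 i2; split.
    split; last by under eq_fun do rewrite nE.
    apply: measurable_cfunD; first by case: (u2 k i j).
    rewrite (_ : (fun _ => _) = fun z => (-1) * l z); last first.
      by apply/funext => z; rewrite mulN1r.
    by apply: measurable_cfunM => //; exact: measurable_cfun_cst.
  under eq_Rintegral do rewrite nE.
  by rewrite (RintegralD measurableT i1 i2); lra.
have exl' (ij : 'I_n * 'I_n) := exl ij.1 ij.2.
have [l lP] := choice exl'.
pose L z : M := \matrix_(i, j) l (i, j) z.
have uL k : mxL2 (fun z => u k z - L z).
  move=> i j; have [_ /(_ k) [h _]] := lP (i, j).
  by under [X in L2 X]eq_fun do rewrite !mxE.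
have L2L : mxL2 L.
  have := mxL2B (u2 0) (uL 0).
  by under eq_fun do rewrite opprB addrC subrK.
exists L => //; exists (n%:R * (n%:R * 16)) => k.
rewrite /sqnorm; under eq_Rintegral do rewrite sqr_hs_norm.
have ei i j : m.-integrable setT (EFin \o (fun z => normc ((u k z - L z) i j) ^+ 2)).
  by case: (uL k i j).
have si (I : Type) (r : seq I) (F : I -> T -> R) (K : R) :
    (forall i, m.-integrable setT (EFin \o F i)) -> (forall i, \int[m]_z F i z <= K) ->
    m.-integrable setT (EFin \o (fun z => \sum_(i <- r) F i z)) /\
    \int[m]_z (\sum_(i <- r) F i z) <= (size r)%:R * K.
  move=> Fi FK; elim: r => [|i r [IHi IH]].
    under eq_fun do rewrite big_nil; split; first exact: integrable_cst.
    by rewrite Rintegral_cst// !mul0r.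
  have e : (fun z => \sum_(j <- i :: r) F j z) = fun z => F i z + \sum_(j <- r) F j z.
    by apply/funext => z; rewrite big_cons.
  rewrite e; split; first exact: integrable_addR (Fi i) IHi.
  rewrite (RintegralD measurableT (Fi i) IHi) /= -natr1 mulrDl mul1r addrC.
  exact: lerD.
have bnd i j : \int[m]_z (normc ((u k z - L z) i j) ^+ 2) <= 16 * w k ^+ 2.
  have [_ /(_ k) [_ h]] := lP (i, j).
  by under eq_Rintegral do rewrite !mxE.
have rowi i := si _ (index_enum 'I_n) _ _ (ei i) (bnd i).
have [_] := si _ (index_enum 'I_n) _ _ (fun i => (rowi i).1) (fun i => (rowi i).2).
have -> : size (index_enum 'I_n) = n by rewrite [index_enum _]unlock -enumT size_enum_ord.
by rewrite !mulrA.
Qed.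

(** [H^2], its shifts and its orthogonal complement all have this form, with a bilinear pairing.
    Such a subspace is closed by continuity of the pairing, so one projection theorem covers every
    use. *)
Definition annih (A : set (T -> M)) : set (T -> M) := [set F | mxL2 F /\
  forall h, A h -> circle_int (fun z => \tr (F z *m h z)) = 0].

Definition midpoint F G : T -> M := fun z => (2^-1)%:C%C *: (F z + G z).

Lemma half_add : (2^-1)%:C%C + (2^-1)%:C%C = 1 :> C.
Proof. by apply: complex_eqP; rewrite /= ?addr0//; field. Qed.

Variable A : set (T -> M).
Hypothesis A2 : forall h, A h -> mxL2 h.

Lemma annih0 : annih A (fun=> 0).
Proof.
split=> [|h Ah]; first exact: mxL2_cst.
by rewrite -[RHS]cint_cst; apply: eq_cint => z; rewrite mul0mx mxtrace0.
Qed.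

Lemma annihD F G : annih A F -> annih A G -> annih A (fun z => F z + G z).
Proof.
move=> [F2 F0] [G2 G0]; split=> [|h Ah]; first exact: mxL2D.
under eq_cint do rewrite mulmxDl mxtraceD.
by rewrite cintD ?F0 ?G0 ?addr0//; apply: mxL1_trace => //; exact: A2.
Qed.

Lemma annihZ (c : C) F : annih A F -> annih A (fun z => c *: F z).
Proof.
move=> [F2 F0]; split=> [|h Ah]; first exact: mxL2Z.
under eq_cint do rewrite -scalemxAl mxtraceZ.
by rewrite cintZ ?F0 ?mulr0//; apply: mxL1_trace => //; exact: A2.
Qed.

Lemma annih_midpoint F G : annih A F -> annih A G -> annih A (midpoint F G).
Proof. by move=> FA GA; apply: annihZ; exact: annihD. Qed.

Lemma normc_cint_trace_le F H (s : R) : mxL2 F -> mxL2 H -> 0 < s ->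
  normc (circle_int (fun z => \tr (F z *m H z))) <=
  n%:R * (n%:R * (s * sqnorm F + s^-1 * sqnorm H)).
Proof.
move=> F2 H2 s0; rewrite (@cint_sum R _ _ _ (fun i z => (F z *m H z) i i)); last first.
  by move=> i _; exact: mxL1_entry.
rewrite (le_trans (normc_sum _ _ _))//.
have cn (K : R) : \sum_(i < n) K = n%:R * K by rewrite sumr_const card_ord mulr_natl.
rewrite -[leRHS]cn; apply: ler_sum => i _.
under eq_cint do rewrite mxE.
rewrite (@cint_sum R _ _ _ (fun j z => F z i j * H z j i)); last first.
  by move=> j _; exact: L2_L1M.
rewrite (le_trans (normc_sum _ _ _))// -[leRHS]cn; apply: ler_sum => j _.
rewrite (le_trans (normc_cint_le (F2 i j) (H2 j i) s0))//.
have le_sq G a b : mxL2 G -> \int[m]_z (normc (G z a b) ^+ 2) <= sqnorm G.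
  move=> G2; apply: le_Rintegral => //; first by case: (G2 a b).
    exact: sqr_hs_norm_integrable.
  by move=> z _; exact: sqr_entry_le.
by apply: lerD; rewrite ler_wpM2l ?le_sq// ?invr_ge0 ltW.
Qed.

Lemma annih_complete (u : nat -> T -> M) : (forall k, annih A (u k)) ->
  (forall k, sqnorm (fun z => u k.+1 z - u k z) <= w k ^+ 4) ->
  exists2 l, annih A l & exists K, forall k, sqnorm (fun z => u k z - l z) <= K * w k ^+ 2.
Proof.
move=> uA uw; have [l l2 [K lK]] := mx_L2_complete (fun k => (uA k).1) uw.
exists l; last by exists K.
split=> // h Ah; apply: eq0_normc; have h2 := A2 Ah.
apply/eqP; rewrite eq_le normc_nneg andbT.
apply: (@le_half_pow_lim _ _ _ (n%:R * (n%:R * (K + sqnorm h)))) => k; rewrite add0r.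
have [uk2 uk0] := uA k; have ul2 := mxL2B uk2 l2.
have w0 := half_pow_gt0 (R := R) k.
have -> : circle_int (fun z => \tr (l z *m h z)) =
    - circle_int (fun z => \tr ((u k z - l z) *m h z)).
  rewrite -[LHS]opprK -[X in - X]add0r -(uk0 h Ah) -cintB; try exact: mxL1_trace.
  by congr (- _); apply: eq_cint => z; rewrite mulmxBl (raddfB (@mxtrace _ _)).
(* With the parameter [(w k)^-1] the rate [w k ^+ 2] is reduced to [w k], while the term in [h] also
   carries the factor [w k]: both vanish in the limit. *)
have wi : 0 < (w k)^-1 by rewrite invr_gt0.
rewrite normcN (le_trans (normc_cint_trace_le ul2 h2 wi))// invrK -!mulrA.
do 2 rewrite ler_wpM2l//.
rewrite mulrDl [w k * _]mulrC lerD2r (le_trans (ler_wpM2l (ltW wi) (lK k)))//.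
by rewrite mulrCA expr2 mulKf// gt_eqF.
Qed.

Section Weighted.
Variables (k K : R) (W : T -> M).
Hypothesis (k0 : 0 < k) (wW : weight k K W).

Let sqdist F G := sqnorm (fun z => F z - G z).

Lemma wnormZ (c : C) X : mxL2 X ->
  wnorm W (fun z => c *: X z) = normc c ^+ 2 * wnorm W X.
Proof.
move=> X2; have Xi := weight_integrable wW X2.
rewrite -(RintegralZl _ measurableT Xi); apply: eq_Rintegral => z _.
exact: qformZ.
Qed.

(** The parallelogram law for the halves of [X - F] and [X - G]. The halved difference contributes a
    quarter of the weighted squared norm of [F - G], hence the modulus [k / 4], which depends on the
    weight only through its lower bound. *)
Lemma wdist_strongly_convex X : mxL2 X ->
  strongly_convex (annih A) midpoint sqdist (k / 4) (fun F => wnorm W (fun z => X z - F z)).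
Proof.
move=> X2; split.
- by move=> F _; exact: wnorm_ge0 (ltW k0) wW _.
- move=> F G [F2 _] [G2 _]; have h0 : 0 <= (2^-1 : R) by rewrite invr_ge0.
  have XF2 := mxL2B X2 F2; have XG2 := mxL2B X2 G2; have FG2 := mxL2B F2 G2.
  have /= := wnorm_parallelogram wW (mxL2Z (2^-1)%:C%C XF2) (mxL2Z (2^-1)%:C%C XG2).
  have -> : (fun z => (2^-1)%:C%C *: (X z - F z) + (2^-1)%:C%C *: (X z - G z)) =
      (fun z => X z - midpoint F G z).
    apply/funext => z; rewrite /midpoint -scalerDr addrACA scalerDr -opprD scalerN.
    by rewrite scalerDr -scalerDl half_add scale1r.
  have -> : (fun z => (2^-1)%:C%C *: (X z - F z) - (2^-1)%:C%C *: (X z - G z)) =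
      (fun z => (- 2^-1%:C)%C *: (F z - G z)).
    apply/funext => z; rewrite -scalerBr opprB addrC addrA subrK.
    by rewrite scaleNr -scalerN opprB.
  rewrite !wnormZ// normcN normc_real ger0_norm//.
  have := wnorm_ge_sqnorm wW FG2; rewrite -/(sqdist F G).
  move: (wnorm W _) (wnorm W _) (wnorm W _) (wnorm W _) (sqdist F G) => a b c d e.
  by rewrite expr2; lra.
- move=> F e [F2 _] e0; have e1 : 0 <= 1 + e^-1 by rewrite addr_ge0// invr_ge0 ltW.
  exists ((1 + e^-1) * (n%:R * `|K|)); split; first by rewrite !mulr_ge0.
  move=> G [G2 _]; have -> : (fun z => X z - F z) = (fun z => (X z - G z) + (G z - F z)).
    by apply/funext => z; rewrite addrA subrK.
  have XG2 := mxL2B X2 G2; have GF2 := mxL2B G2 F2.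
  rewrite (le_trans (wnorm_lsc (ltW k0) wW XG2 GF2 e0))// lerD2l -mulrA ler_wpM2l//.
  rewrite (le_trans (wnorm_le_sqnorm wW GF2))// ler_wpM2r ?sqnorm_ge0//.
  by rewrite ler_wpM2l// ler_norm.
Qed.

Lemma annih_projection X : mxL2 X -> exists2 F, annih A F & forall G, annih A G ->
  circle_int (fun z => \tr ((X z - F z) *m W z *m adj (G z))) = 0.
Proof.
move=> X2; have k40 : 0 < k / 4 by rewrite divr_gt0.
have [F FA Fmin] := strongly_convex_min (ex_intro _ _ annih0) k40 annih_midpoint
  annih_complete (wdist_strongly_convex X2).
exists F => // G GA; have [F2 _] := FA; have [G2 _] := GA.
have XF2 := mxL2B X2 F2.
set I := circle_int _; apply: eq0_normc; apply/eqP.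
rewrite -sqrf_eq0 eq_le sqr_ge0 andbT.
apply: (@le_half_pow_lim _ _ _ (normc I ^+ 2 * wnorm W G / 2)) => j; rewrite add0r.
have w0 := half_pow_gt0 (R := R) j.
(* Moving [F] against the inner product [I] changes the squared distance by [- 2 * w j * |I|^2 + w j
   ^+ 2 * |I|^2 * wnorm W G]. Minimality makes this nonnegative for every [j], which forces
   [I = 0]. *)
pose c : C := - ((w j)%:C%C * I).
have cGA := annihZ (- c) GA.
have bA := annihD FA cGA.
have : wnorm W (fun z => X z - F z) <= wnorm W (fun z => X z - (F z + - c *: G z)).
  by apply: le_trans (Fmin _ bA); rewrite lerDl !mulr_ge0 ?sqnorm_ge0// ltW.
have -> : (fun z => X z - (F z + - c *: G z)) = (fun z => (X z - F z) + c *: G z).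
  by apply/funext => z; rewrite scaleNr opprD opprK addrA.
rewrite (wnorm_expand wW c XF2 G2) -/I.
have -> : cRe (conjc c * I) = - (w j * normc I ^+ 2).
  have cN (x y : C) : conjc (- (x * y)) = - (conjc x * conjc y).
    by rewrite -rmorphM -raddfN.
  rewrite /c cN conjc_real mulNr cReN -mulrA [conjc I * I]mulrC mulcJ.
  by rewrite cRe_real_mul.
rewrite /c normcN normcM normc_real exprMn real_normK ?num_real//.
rewrite -addrA lerDl => h; rewrite -(ler_pM2l w0); move: h.
by move: (wnorm W _) (w j) (normc I ^+ 2) => a v I2; lra.
Qed.
End Weighted.

End Projection.

(** * Hardy spaces and spectral factorization *)

Section HardyProducts.
Context {R : realType} {n : nat}.
Local Notation C := R[i].
Local Notation T := (circle R).
Local Notation m := (circle_measure R).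
Local Notation cRe := (@complex.Re R).
Local Notation cIm := (@complex.Im R).
Local Notation M := 'M[C]_n.
Implicit Types F G X Y : T -> M.

Lemma mul_delta_mxE (A : M) (a b i j : 'I_n) : (A *m delta_mx a b) i j = (j == b)%:R * A i a.
Proof.
rewrite mxE (bigD1 a)//= big1 ?addr0 => [|l la]; last first.
  by rewrite mxE (negbTE la) mulr0.
by rewrite mxE eqxx mulrC.
Qed.

Definition monomial (k : int) (i j : 'I_n) : T -> M :=
  fun z => circle_val z ^ k *: delta_mx i j.

Lemma mxL2_monomial k i j : mxL2 (monomial k i j).
Proof. exact: mxL2_zpow (mxL2_cst _). Qed.

Lemma mxtrace_mul_delta (A : M) (i j : 'I_n) : \tr (A *m delta_mx i j) = A j i.
Proof.
rewrite /mxtrace (bigD1 j)//= mul_delta_mxE eqxx mul1r big1 ?addr0// => l lj.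
by rewrite mul_delta_mxE (negbTE lj) mul0r.
Qed.

Lemma trace_monomial k i j (A : M) z : \tr (A *m monomial k i j z) = A j i * circle_val z ^ k.
Proof. by rewrite /monomial -scalemxAr mxtraceZ mxtrace_mul_delta mulrC. Qed.

Lemma adj_monomial k i j z : adj (monomial k i j z) = monomial (- k) j i z.
Proof.
rewrite /monomial adjZ conj_zpow; congr (_ *: _); apply/matrixP => a b.
by rewrite adjE !mxE andbC; case: (_ && _); rewrite ?conjc1 ?conjc0.
Qed.

(* Written as an annihilator, so that orthogonal projections onto it are
   instances of [annih_projection]. *)
Definition hardy_from (d : int) : set (T -> M) := annih
  [set h | exists i j k, k < d /\ h = monomial (- k) j i].

Lemma hardy_from_mxL2 d : forall h,
  [set h | exists i j k, k < d /\ h = monomial (- k) j i] h -> mxL2 h.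
Proof. by move=> _ [i [j [k [_ ->]]]]; exact: mxL2_monomial. Qed.

Lemma fourier_coefE F i j k :
  fourier_coef (fun z => F z i j) k = circle_int (fun z => \tr (F z *m monomial (- k) j i z)).
Proof. by apply: eq_cint => z; rewrite trace_monomial. Qed.

Lemma hardy_fromP d F : hardy_from d F <->
  mxL2 F /\ forall i j k, k < d -> fourier_coef (fun z => F z i j) k = 0.
Proof.
split=> -[F2 F0]; split=> //.
  by move=> i j k kd; rewrite fourier_coefE F0//; exists i, j, k.
by move=> _ [i [j [k [kd ->]]]]; rewrite -fourier_coefE F0.
Qed.

Lemma hardy_from_le d e F : e <= d -> hardy_from d F -> hardy_from e F.
Proof.
move=> ed /hardy_fromP[F2 F0]; apply/hardy_fromP; split=> // i j k ke.
by apply: F0; exact: lt_le_trans ke ed.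
Qed.

Lemma hardy_fromD d F G : hardy_from d F -> hardy_from d G ->
  hardy_from d (fun z => F z + G z).
Proof. by apply: annihD; exact: hardy_from_mxL2. Qed.

Lemma hardy_fromZ d (c : C) F : hardy_from d F -> hardy_from d (fun z => c *: F z).
Proof. by apply: annihZ; exact: hardy_from_mxL2. Qed.

Lemma cint_zpowZ (c : C) k : k != 0 -> circle_int (fun z : T => c * circle_val z ^ k) = 0.
Proof. by move=> k0; rewrite cintZ ?cint_zpow ?mulr0//; exact: L2_L1 (L2_zpow k). Qed.

Lemma hardy_from_monomial d k i j : d <= k -> hardy_from d (monomial k i j).
Proof.
move=> dk; apply/hardy_fromP; split=> [|a b l ld]; first exact: mxL2_monomial.
rewrite /fourier_coef; under eq_cint do rewrite mxE mulrAC mulrC -zpowD.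
by apply: cint_zpowZ; rewrite subr_eq0 gt_eqF// (lt_le_trans ld).
Qed.

Lemma ae_eq_mx F G : (forall i j, {ae m, forall z, F z i j = G z i j}) ->
  {ae m, forall z, F z = G z}.
Proof.
move=> FG.
have h1 i (s : seq 'I_n) : {ae m, forall z, forall j, j \in s -> F z i j = G z i j}.
  elim: s => [|j s IH]; first exact: aeW.
  apply: filterS2 (FG i j) IH => z e h j'.
  by rewrite in_cons => /orP[/eqP ->|/h].
have h2 (s : seq 'I_n) : {ae m, forall z, forall i, i \in s -> forall j, F z i j = G z i j}.
  elim: s => [|i s IH]; first exact: aeW.
  apply: filterS2 (h1 i (enum 'I_n)) IH => z e h i'.
  by rewrite in_cons => /orP[/eqP ->|/h//] j; apply: e; rewrite mem_enum.
apply: filterS (h2 (enum 'I_n)) => z h; apply/matrixP => i j.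
by apply: h; rewrite mem_enum.
Qed.

(* For fixed [U], the functions [G] such that [U G] is analytic form a closed
   subspace containing the polynomials; the component of [G] orthogonal to it
   has no Fourier coefficients. *)
Lemma hardy_mul_coef U G i j k : hardy_from 0 U -> hardy_from 0 G -> k < 0 ->
  fourier_coef (fun z => (U z *m G z) i j) k = 0.
Proof.
move=> UH GH k0; have [U2 _] := UH; have [G2 _] := GH.
have [_ U0] := (hardy_fromP _ _).1 UH.
(* Pairing [G] with [h0] gives the coefficient of [U G] in question, so its vanishing is one more
   annihilation condition. *)
pose h0 z := monomial (- k) j i z *m U z.
pose A := [set h | exists i j k, k < 0 /\ h = monomial (- k) j i] `|` [set h0].
have h02 : mxL2 h0.
  apply: (mxL2_mull (K := 1)) U2; first exact: mxL2_measurable (mxL2_monomial _ _ _).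
  move=> z a b; rewrite !mxE normcM normc_zpow mul1r.
  by case: (_ && _); rewrite ?normc1 ?normc0.
have A2 h : A h -> mxL2 h by move=> [/hardy_from_mxL2|->].
have h0E F z : \tr (F z *m h0 z) = (U z *m F z) i j * circle_val z ^ (- k).
  by rewrite /h0 mulmxA mxtrace_mulC mulmxA trace_monomial.
have annihA F : annih A F <-> hardy_from 0 F /\ circle_int (fun z => \tr (F z *m h0 z)) = 0.
  split=> [[F2 F0]|[[F2 F0] Fh]].
    by split; [split=> // h hh; apply: F0; left|apply: F0; right].
  by split=> // h [/F0//|->].
have [P PA Porth] := annih_projection A2 ltr01 weight1 G2.
have [PH Ph0] := (annihA P).1 PA; have [P2 _] := PH.
have GP2 := mxL2B G2 P2.
have rH : hardy_from 0 (fun z => G z - P z).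
  rewrite (_ : (fun z => _) = fun z => G z + (-1) *: P z); last first.
    by apply/funext => z; rewrite scaleN1r.
  exact: hardy_fromD GH (hardy_fromZ (-1) PH).
have mono l a b : 0 <= l -> annih A (monomial l a b).
  move=> l0; apply/annihA; split; first exact: hardy_from_monomial.
  have e z : \tr (monomial l a b z *m h0 z) =
      (j == b)%:R * (U z i a * circle_val z ^ (- (k - l))).
    rewrite h0E /monomial -scalemxAr mxE mul_delta_mxE opprB zpowD.
    by move: (U z i a) (circle_val z ^ l) (circle_val z ^ - k) => u v t; ring.
  under eq_cint do rewrite e.
  rewrite cintZ; first by have := U0 i a (k - l); rewrite /fourier_coef => ->;
    rewrite ?mulr0// subr_lt0 (lt_le_trans k0).
  by apply: L2_L1M => //; exact: L2_zpow.
(* Negative coefficients vanish because [G] and [P] are analytic, the others because [G - P] is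
   orthogonal to the monomials that [mono] puts in the subspace. *)
have r0 a b : {ae m, forall z, G z a b - P z a b = 0}.
  apply: ae_eq0_of_null_coefs; split; first by apply: L1B; apply: L2_L1.
  move=> l; have [l0|l0] := ltP l 0.
    have [_ /(_ a b l l0)] := (hardy_fromP _ _).1 rH.
    by apply: etrans; apply: eq_cint => z; rewrite !mxE.
  have := Porth _ (mono l a b l0); apply: etrans; apply: eq_cint => z.
  by rewrite mulmx1 adj_monomial trace_monomial !mxE.
have GP : {ae m, forall z, G z = P z}.
  apply: ae_eq_mx => a b; apply: filterS (r0 a b) => z /eqP.
  by rewrite subr_eq0 => /eqP.
rewrite -[RHS]Ph0; apply: ae_eq_cint.
- under [X in L1 X]eq_fun do rewrite -h0E; exact: mxL1_trace.
- exact: mxL1_trace.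
- by apply: filterS GP => z ->; rewrite h0E.
Qed.

End HardyProducts.

(** * Factorization of positive definite constant matrices *)

Section PositiveFactor.
Context {R : realType} {n : nat}.
Local Notation C := R[i].
Local Notation cRe := (@complex.Re R).
Local Notation cIm := (@complex.Im R).

Lemma hs_norm_delta (i : 'I_n) : hs_norm (delta_mx i i : 'M[C]_n) ^+ 2 = 1.
Proof.
rewrite sqr_hs_norm (bigD1 i)//= (bigD1 i)//= mxE !eqxx normc1 expr1n.
rewrite !big1 ?addr0// => [j ji|j ji].
  by apply: big1 => l _; rewrite mxE (negbTE ji) normc0 expr0n.
by rewrite mxE (negbTE ji) andbF normc0 expr0n.
Qed.

(** By the spectral theorem [D = P^* d P] with [P] unitary, and [B] is [P^*] times the square root
    of [d]. The lower bound [k] makes the eigenvalues positive, so [B] is invertible. *)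
Lemma posdef_factor (D : 'M[C]_n) (k : R) : adj D = D -> 0 < k ->
  (forall X : 'M[C]_n, k * hs_norm X ^+ 2 <= qform D X) ->
  exists B B' : 'M[C]_n, B' *m B = 1%:M /\ D = B *m adj B.
Proof.
move=> hD k0 Dk; have tE (A : 'M[C]_n) : map_mx Num.conj A^T = adj A.
  by rewrite /adj map_trmx.
have Dn : D \is normalmx by apply/normalmxP; rewrite tE hD.
have := orthomx_spectralP Dn; set P := spectralmx D; set d := spectral_diag D.
have Pu : P \is unitarymx := spectral_unitarymx D.
have PP : P *m adj P = 1%:M by rewrite -tE; exact/unitarymxP.
have PP' : adj P *m P = 1%:M by exact: mulmx1C.
rewrite invmx_unitary// tE => De.
have dE : diag_mx d = P *m D *m adj P.
  by rewrite De !mulmxA PP mul1mx -mulmxA PP mulmx1.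
have dii i : d 0 i = (P *m D *m adj P) i i by rewrite -dE mxE eqxx mulr1n.
have dreal i : d 0 i = (cRe (d 0 i))%:C%C.
  have : conjc (d 0 i) = d 0 i by rewrite dii -adjE !adjM adjK hD mulmxA.
  case: (d 0 i) => a b /= [h].
  by have -> : b = 0 by lra.
have dpos i : 0 < cRe (d 0 i).
  (* The only nonzero row of the test matrix is the [i]-th row of [P], so the form takes the [i]-th
     eigenvalue as its value. *)
  apply: lt_le_trans k0 _; have := Dk (delta_mx i i *m P).
  have -> : hs_norm (delta_mx i i *m P) ^+ 2 = 1.
    rewrite -qform1 /qform mulmx1 adjM !mulmxA -(mulmxA _ P) PP mulmx1.
    by rewrite mxtrace_mul_adj hs_norm_delta.
  rewrite mulr1 => /le_trans; apply.
  have dJ : adj (delta_mx i i : 'M[C]_n) = delta_mx i i.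
    by apply/matrixP => a b; rewrite adjE !mxE andbC; case: (_ && _); rewrite ?conjc1 ?conjc0.
  have -> : qform D (delta_mx i i *m P) = cRe (\tr (delta_mx i i *m (P *m D *m adj P) *m delta_mx i i)).
    by rewrite /qform adjM dJ !mulmxA.
  by rewrite -dE mxtrace_mul_delta mul_mx_diag !mxE !eqxx mul1r.
pose s i : C := (Num.sqrt (cRe (d 0 i)))%:C%C.
have ss i : s i * s i = d 0 i.
  by rewrite dreal -rmorphM -expr2 sqr_sqrtr// ltW.
have s0 i : s i != 0.
  by apply/eqP => si; have := ss i; rewrite si mul0r => /esym di; have := dpos i; rewrite di ltxx.
have sJ i : conjc (s i) = s i by rewrite conjc_real.
pose S : 'M[C]_n := diag_mx (\row_i s i).
have adjS : adj S = S.
  apply/matrixP => i j; rewrite adjE !mxE eq_sym; case: eqP => [->|_].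
    by rewrite !mulr1n sJ.
  by rewrite !mulr0n conjc0.
exists (adj P *m S), (diag_mx (\row_i (s i)^-1) *m P); split.
  rewrite mulmxA -(mulmxA _ P) PP mulmx1 mulmx_diag; apply/matrixP => i j.
  by rewrite !mxE mulVf.
rewrite adjM adjK adjS mulmxA -(mulmxA _ S S) /S mulmx_diag {1}De; congr (_ *m diag_mx _ *m _).
by apply/rowP => i; rewrite !mxE ss.
Qed.

End PositiveFactor.

(** * Spectral factorization of matrix weights *)

Section SpectralFactorization.
Context {R : realType} {n : nat}.
Local Notation C := R[i].
Local Notation T := (circle R).
Local Notation m := (circle_measure R).
Local Notation cRe := (@complex.Re R).
Local Notation cIm := (@complex.Im R).
Local Notation M := 'M[C]_n.
Implicit Types F G X Y : T -> M.

Lemma hardy_from_cst (A : M) : hardy_from 0 (fun=> A).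
Proof.
apply/hardy_fromP; split=> [|i j k k0]; first exact: mxL2_cst.
by apply: cint_zpowZ; rewrite oppr_eq0 lt_eqF.
Qed.

Lemma hardy_from_mul U G : hardy_from 0 U -> hardy_from 0 G ->
  mxL2 (fun z => U z *m G z) -> hardy_from 0 (fun z => U z *m G z).
Proof. by move=> UH GH UG; apply/hardy_fromP; split=> // i j k; exact: hardy_mul_coef. Qed.

Lemma bounded_cst (A : M) : exists c, forall (z : T) i j, normc (A i j) <= c.
Proof. by exists (hs_norm A) => _ i j; exact: entry_le_hs_norm. Qed.

Lemma hardy_from_mull_cst (A : M) G : hardy_from 0 G -> hardy_from 0 (fun z => A *m G z).
Proof.
move=> GH; have [c cP] := bounded_cst A.
apply: (hardy_from_mul (hardy_from_cst A) GH).
by apply: mxL2_mull cP GH.1 => i j; exact: measurable_cfun_cst.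
Qed.

Lemma hardy_from_mulr_cst (A : M) G : hardy_from 0 G -> hardy_from 0 (fun z => G z *m A).
Proof.
move=> GH; have [c cP] := bounded_cst A.
apply: (hardy_from_mul GH (hardy_from_cst A)).
by apply: mxL2_mulr cP GH.1 => i j; exact: measurable_cfun_cst.
Qed.

(** The tangent minorant of the squared norm at [B]. Taken at the mean of a matrix function and
    integrated, it bounds the mean square below by the square of the mean. *)
Lemma le_Re_trace (A B : M) :
  2 * cRe (\tr (A *m adj B)) - hs_norm B ^+ 2 <= hs_norm A ^+ 2.
Proof.
have := sqr_ge0 (hs_norm (A + - B)); rewrite -(qform1 (A + - B)) qformD ?adj1//.
by rewrite qformN !qform1 mulmx1 adjN mulmxN (raddfN (@mxtrace _ _)) cReN; lra.
Qed.

Variables (k K : R) (W : T -> M).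
Hypothesis (k0 : 0 < k) (wW : weight k K W).

(* [Q] is the component of the constant function 1 orthogonal to [z H^2] in
   [L^2(W)]: then [W Q^*] is analytic and [Q W Q^*] is both analytic and
   hermitian, hence constant. *)
Lemma prediction_error : exists Q D, [/\ hardy_from 0 Q,
  hardy_from 0 (fun z => W z *m adj (Q z)),
  {ae m, forall z, Q z *m W z *m adj (Q z) = D}, adj D = D &
  forall X : M, k * hs_norm X ^+ 2 <= qform D X].
Proof.
have [mW hW WK Wk] := wW.
have [a aH aorth] := annih_projection (@hardy_from_mxL2 R n 1) k0 wW (mxL2_cst 1%:M).
have [a2 a0] := (hardy_fromP _ _).1 aH.
pose Q z := 1%:M - a z.
have Q2 : mxL2 Q by apply: mxL2B => //; exact: mxL2_cst.
have QH : hardy_from 0 Q.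
  have := hardy_fromD (hardy_from_cst 1%:M) (hardy_fromZ (-1) (hardy_from_le (e := 0) _ aH)).
  by under [X in _ -> hardy_from _ X]eq_fun do rewrite /Q -scaleN1r; apply.
have QW2 : mxL2 (fun z => Q z *m W z) by exact: mxL2_mulr WK Q2.
(* Being orthogonal to [z H^2] removes the positive coefficients of [Q W], hence the negative ones
   of its adjoint [W Q^*]. *)
have WQ2 : mxL2 (fun z => W z *m adj (Q z)) by exact: mxL2_mull WK (mxL2_adj Q2).
have QW0 i j l : 1 <= l -> fourier_coef (fun z => (Q z *m W z) i j) l = 0.
  move=> l1; have := aorth _ (hardy_from_monomial i j l1); apply: etrans.
  by apply: eq_cint => z; rewrite adj_monomial trace_monomial.
have WQE z : W z *m adj (Q z) = adj (Q z *m W z) by rewrite adjM hW.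
have WQH : hardy_from 0 (fun z => W z *m adj (Q z)).
  apply/hardy_fromP; split=> // i j l l0.
  have l1 : 1 <= - l by rewrite -(gtz0_ge1 (- l)) oppr_gt0.
  have := QW0 j i _ l1; rewrite /fourier_coef => /(congr1 (@conjc R)).
  rewrite conjc0 -cint_conj; last by apply: L2_L1M => //; exact: L2_zpow.
  by apply: etrans; apply: eq_cint => z; rewrite WQE adjE rmorphM /= conj_zpow !opprK.
pose V z := Q z *m (W z *m adj (Q z)).
have VJ z : adj (V z) = V z by rewrite /V !adjM adjK hW mulmxA.
have V1 i j : L1 (fun z => V z i j) by exact: mxL1_entry.
have V0 i j l : l < 0 -> fourier_coef (fun z => V z i j) l = 0.
  exact: hardy_mul_coef.
have V0' i j l : l != 0 -> fourier_coef (fun z => V z i j) l = 0.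
  have [l0 _|l0 _|->] := ltgtP l 0; [exact: V0| |by []].
  have := V0 j i (- l); rewrite oppr_lt0 => /(_ l0) /(congr1 (@conjc R)).
  rewrite /fourier_coef conjc0 -cint_conj; last first.
    by under [X in L1 X]eq_fun do rewrite mulrC; exact: L1_zpow.
  apply: etrans; apply: eq_cint => z.
  by rewrite rmorphM /= conj_zpow opprK -adjE VJ.
pose D : M := \matrix_(i, j) circle_int (fun z => V z i j).
have hD : adj D = D.
  apply/matrixP => i j; rewrite adjE !mxE -cint_conj//.
  by apply: eq_cint => z; rewrite -adjE VJ.
have VD : {ae m, forall z, V z = D}.
  apply: ae_eq_mx => i j.
  have : null_coefs (fun z => V z i j - D i j).
    split; first by apply: L1B => //; exact: L1_cst.
    move=> l; rewrite /fourier_coef.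
    rewrite (eq_cint (g := fun z => circle_val z ^ (- l) * V z i j -
      D i j * circle_val z ^ (- l))); last first.
      by move=> z; ring.
    rewrite cintB; [|exact: L1_zpow|exact/L1Z/L2_L1/L2_zpow].
    have -> : circle_int (fun z => circle_val z ^ (- l) * V z i j) =
        fourier_coef (fun z => V z i j) l.
      by apply: eq_cint => z; rewrite mulrC.
    have [->|l0] := eqVneq l 0; last first.
      by rewrite V0'// cint_zpowZ ?subrr// oppr_eq0.
    rewrite /fourier_coef oppr0; under eq_cint do rewrite expr0z mulr1.
    by under [X in _ - X]eq_cint do rewrite expr0z mulr1; rewrite cint_cst mxE subrr.
  by move=> /ae_eq0_of_null_coefs; apply: filterS => z /eqP; rewrite subr_eq0 => /eqP.
exists Q, D; split=> //.
  by apply: filterS VD => z <-; rewrite /V mulmxA.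
(* The form of [D] at [X] is the weighted squared norm of [X Q], at least [k] times the unweighted
   one. Since [a] has mean 0, [X Q] has mean [X], and [le_Re_trace] at [X] concludes. *)
move=> X; have [c cP] := bounded_cst X.
have XQ2 : mxL2 (fun z => X *m Q z).
  by apply: mxL2_mull cP Q2 => i j; exact: measurable_cfun_cst.
have -> : qform D X = wnorm W (fun z => X *m Q z).
  rewrite /wnorm /qform -Re_cint -[in LHS](cint_cst (\tr (X *m D *m adj X))).
  suff -> : circle_int (fun=> \tr (X *m D *m adj X)) =
      circle_int (fun z => \tr (X *m Q z *m W z *m adj (X *m Q z))) by [].
  apply: (ae_eq_cint (L1_cst _) (weight_L1 wW XQ2 XQ2)).
  by apply: filterS VD => z <-; rewrite /V adjM !mulmxA.
apply: le_trans (wnorm_ge_sqnorm wW XQ2); apply: ler_wpM2l; first exact: ltW.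
have XQX1 : L1 (fun z => \tr (X *m Q z *m adj X)).
  by apply: mxL1_trace XQ2 (mxL2_cst (adj X)).
have intXQ : circle_int (fun z => \tr (X *m Q z *m adj X)) = (hs_norm X ^+ 2)%:C%C.
  have aX1 : L1 (fun z => \tr (a z *m (adj X *m X))) by exact: mxL1_trace a2 (mxL2_cst _).
  rewrite (eq_cint (g := fun z => \tr (X *m adj X) - \tr (a z *m (adj X *m X)))); last first.
    move=> z; rewrite /Q mulmxBr mulmx1 mulmxBl (raddfB (@mxtrace _ _)); congr (_ - _).
    by rewrite -mulmxA [LHS]mxtrace_mulC -mulmxA.
  rewrite cintB//; last exact: L1_cst.
  rewrite cint_cst mxtrace_mul_adj (_ : circle_int _ = 0) ?subr0//.
  rewrite (@cint_sum R _ _ _ (fun i z => (a z *m (adj X *m X)) i i)); last first.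
    by move=> i _; exact: mxL1_entry a2 (mxL2_cst _).
  apply: big1 => i _; under eq_cint do rewrite mxE.
  rewrite (@cint_sum R _ _ _ (fun j z => a z i j * (adj X *m X) j i)); last first.
    by move=> j _; apply: L2_L1M => //; exact: L2_cst.
  apply: big1 => j _; under eq_cint do rewrite mulrC.
  rewrite cintZ; last exact: L2_L1.
  have := a0 i j 0 ltr01; rewrite /fourier_coef oppr0.
  by under eq_cint do rewrite expr0z mulr1; move=> ->; rewrite mulr0.
have XQXi := L1_Re XQX1.
have -> : hs_norm X ^+ 2 = \int[m]_z (2 * cRe (\tr (X *m Q z *m adj X)) - hs_norm X ^+ 2).
  rewrite (RintegralB measurableT (integrable_scaleR 2 XQXi) (integrable_cst _)).
  rewrite (RintegralZl _ measurableT XQXi) -Re_cint intXQ Rintegral_cst//.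
  have mT : fine (m setT) = 1 by rewrite probability_setT.
  by rewrite mT mulr1 /=; lra.
apply: le_Rintegral => //.
- have /= := integrable_addR (integrable_scaleR 2 XQXi) (integrable_cst (- hs_norm X ^+ 2)).
  by [].
- exact: sqr_hs_norm_integrable.
- by move=> z _; exact: le_Re_trace.
Qed.

Lemma entry_le_sqrt p q (A : 'M[C]_(p, q)) (c : R) : hs_norm A ^+ 2 <= c ->
  forall i j, normc (A i j) <= 1 + c.
Proof.
move=> Ac i j; apply: le_trans (entry_le_hs_norm _ _ _) _.
by have := sqr_ge0 (hs_norm A - 1); have := hs_norm_ge0 A; nra.
Qed.

(** With [D = B B^*], the matrix [E = B' Q] satisfies [E W E^* = 1], and its inverse
    [F = W Q^* B'^*] is analytic because [W Q^*] is. Then [F^* = E W], so that [F F^* = W]. *)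
Lemma spectral_factor : exists F E c, [/\ hardy_from 0 F, hardy_from 0 E &
  {ae m, forall z, [/\ F z *m adj (F z) = W z, F z *m E z = 1%:M, E z *m F z = 1%:M,
    forall i j, normc (F z i j) <= c & forall i j, normc (E z i j) <= c]}].
Proof.
have [mW hW WK Wk] := wW.
have [Q [D [QH WQH QWQ hD Dk]]] := prediction_error.
have [B [B' [B'B DB]]] := posdef_factor hD k0 Dk.
have BB' : B *m B' = 1%:M by exact: mulmx1C.
have BJ : adj B *m adj B' = 1%:M by rewrite -adjM B'B adj1.
pose F z := W z *m adj (Q z) *m adj B'; pose E z := B' *m Q z.
(* The squared norm of [F] is the trace of [W], at most [n * |K|], and [k] times that of [E] is at
   most the trace of [E W E^* = 1]. The absolute value serves [n = 0], where [K] may be negative. *)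
pose c := n%:R * `|K| + k^-1 * n%:R.
exists F, E, (1 + c); split.
- exact: hardy_from_mulr_cst.
- exact: hardy_from_mull_cst.
apply: filterS QWQ => z QWQ.
have EF : E z *m F z = 1%:M.
  have -> : E z *m F z = B' *m (Q z *m W z *m adj (Q z)) *m adj B'.
    by rewrite /E /F !mulmxA.
  by rewrite QWQ DB !mulmxA B'B mul1mx BJ.
have FE := mulmx1C EF.
have FF : F z *m adj (F z) = W z.
  have -> : adj (F z) = E z *m W z by rewrite /F /E !adjM !adjK hW mulmxA.
  by rewrite mulmxA FE mul1mx.
have n0 : 0 <= n%:R :> R by [].
have c1 : 0 <= n%:R * `|K| by rewrite mulr_ge0.
have c2 : 0 <= k^-1 * n%:R by rewrite mulr_ge0// invr_ge0 ltW.
split=> //; apply: entry_le_sqrt.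
  have : hs_norm (F z) ^+ 2 = cRe (\tr (W z)) by rewrite -FF mxtrace_mul_adj.
  move=> ->; rewrite /c -[leLHS]addr0 lerD// /mxtrace cRe_sum.
  rewrite -[n in n%:R]card_ord mulr_natl -sumr_const; apply: ler_sum => i _.
  by rewrite (le_trans (le_Re_normc _))// (le_trans (WK _ _ _))// ler_norm.
rewrite /c -[leLHS]add0r lerD// mulrC ler_pdivlMr// mulrC.
have EWE : E z *m W z *m adj (E z) = 1%:M.
  rewrite -[RHS]EF -[in RHS](mulmx1 (F z)) -[in RHS]adj1 -[in RHS]EF adjM.
  by rewrite -[in LHS]FF !mulmxA.
apply: le_trans (Wk z _) _; rewrite /qform EWE mxtrace1.
by have -> := @cRe_nat R n; exact: lexx.
Qed.

End SpectralFactorization.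

(** * Norming vectors *)

Section OperatorNorm.
Context {R : realType}.
Local Notation C := R[i].
Local Notation cRe := (@complex.Re R).
Local Notation cIm := (@complex.Im R).

Lemma sqr_hs_normD_young p q (A B : 'M[C]_(p, q)) (e : R) : 0 < e ->
  hs_norm (A + B) ^+ 2 <= (1 + e) * hs_norm A ^+ 2 + (1 + e^-1) * hs_norm B ^+ 2.
Proof.
move=> e0; pose c : C := - (e^-1)%:C%C; have := sqr_ge0 (hs_norm (A + c *: B)).
rewrite -(qform1 (A + c *: B)) -(qform1 (A + B)) !qformD ?adj1// qformZ !qform1 !mulmx1 adjZ.
rewrite /c conjcN_real -scalemxAr mxtraceZ mulNr cReN cRe_real_mul normcN normc_real.
rewrite ger0_norm ?invr_ge0 ?(ltW e0)// => h.
exact: young_square e0 h.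
Qed.

Lemma hs_norm0_eq0 p q (A : 'M[C]_(p, q)) : hs_norm A = 0 -> A = 0.
Proof.
move=> A0; apply/matrixP => i j; rewrite mxE; apply: eq0_normc.
by apply/eqP; rewrite eq_le normc_nneg andbT -A0 entry_le_hs_norm.
Qed.

Lemma hs_norm0 p q : hs_norm (0 : 'M[C]_(p, q)) = 0.
Proof. by rewrite -(scale0r 0) hs_normZ normc0 mul0r. Qed.

Lemma hs_normD p q (A B : 'M[C]_(p, q)) : hs_norm (A + B) <= hs_norm A + hs_norm B.
Proof.
have [A0|A0] := eqVneq (hs_norm A) 0.
  by rewrite A0 (hs_norm0_eq0 A0) !add0r.
have [B0|B0] := eqVneq (hs_norm B) 0.
  by rewrite B0 (hs_norm0_eq0 B0) !addr0.
have a0 : 0 < hs_norm A by rewrite lt_def A0 hs_norm_ge0.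
have b0 : 0 < hs_norm B by rewrite lt_def B0 hs_norm_ge0.
rewrite -ler_sqr ?nnegrE ?addr_ge0 ?hs_norm_ge0//.
(* The ratio of the two norms is the optimal parameter in Young's inequality. *)
apply: le_trans (sqr_hs_normD_young A B (divr_gt0 b0 a0)) _.
by rewrite le_eqVlt; apply/orP; left; apply/eqP; field; rewrite A0 B0.
Qed.

Lemma hs_normB p q (A B : 'M[C]_(p, q)) : hs_norm A - hs_norm B <= hs_norm (A - B).
Proof. by have := hs_normD (A - B) B; rewrite subrK; lra. Qed.

Variable n : nat.
Implicit Types (A : 'M[C]_n) (x : 'cV[C]_n).

Lemma op_norm_ub A x : hs_norm x <= 1 -> hs_norm (A *m x) <= op_norm A.
Proof. by move=> x1; apply: ub_le_sup; [have [] := op_norm_has_sup A|exists x]. Qed.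

Lemma op_norm_ge0 A : 0 <= op_norm A.
Proof. by apply: le_trans (op_norm_ub A (x := 0) _); rewrite ?hs_norm_ge0// hs_norm0 ler01. Qed.

Lemma op_norm_mulmx A x : hs_norm (A *m x) <= op_norm A * hs_norm x.
Proof.
have [x0|x0] := eqVneq (hs_norm x) 0.
  by rewrite (hs_norm0_eq0 x0) mulmx0 !hs_norm0 mulr0.
have x1 : 0 < hs_norm x by rewrite lt_def x0 hs_norm_ge0.
have := op_norm_ub A (x := ((hs_norm x)^-1)%:C%C *: x).
rewrite -scalemxAr !hs_normZ normc_real ger0_norm ?invr_ge0 ?hs_norm_ge0//.
by rewrite mulVf// => /(_ (lexx 1)); rewrite mulrC ler_pdivrMr.
Qed.

Lemma hs_norm_col p q (A : 'M[C]_(p, q)) :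
  hs_norm A ^+ 2 = \sum_j hs_norm (col j A) ^+ 2.
Proof.
rewrite sqr_hs_norm exchange_big; apply: eq_bigr => j _; rewrite sqr_hs_norm.
by apply: eq_bigr => i _; rewrite big_ord1 mxE.
Qed.

Lemma hs_norm_mulmx q A (B : 'M[C]_(n, q)) : hs_norm (A *m B) <= op_norm A * hs_norm B.
Proof.
rewrite -ler_sqr ?nnegrE ?mulr_ge0 ?op_norm_ge0 ?hs_norm_ge0//.
rewrite exprMn !hs_norm_col mulr_sumr; apply: ler_sum => j _.
rewrite -exprMn ler_sqr ?nnegrE ?mulr_ge0 ?op_norm_ge0 ?hs_norm_ge0//.
by rewrite colE -mulmxA -colE op_norm_mulmx.
Qed.

Lemma hs_norm_le_op A : hs_norm A <= n%:R * op_norm A.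
Proof.
have h1 : hs_norm (1%:M : 'M[C]_n) ^+ 2 = n%:R.
  rewrite -qform1 /qform mulmx1 mul1mx adj1 mxtrace1.
  exact: cRe_nat.
have [n0|n0] := posnP n.
  suff -> : A = 0 by rewrite hs_norm0 mulr_ge0// op_norm_ge0.
  by apply/matrixP => i; have := ltn_ord i; rewrite {2}n0.
rewrite -[A in hs_norm A]mulmx1 (le_trans (hs_norm_mulmx _ _))// mulrC.
rewrite ler_wpM2r ?op_norm_ge0// -ler_sqr ?nnegrE ?hs_norm_ge0// h1.
by rewrite expr2 ler_peMl// ler1n.
Qed.

Lemma qform_rank1 A x : qform (x *m adj x) A = hs_norm (A *m x) ^+ 2.
Proof. by rewrite -qform1 /qform mulmx1 adjM !mulmxA. Qed.

Lemma rank1_entry_le1 x i j : hs_norm x <= 1 -> normc ((x *m adj x) i j) <= 1.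
Proof.
move=> x1; rewrite mxE big_ord1 normcM adjE normc_conj.
by rewrite mulr_ile1 ?normc_nneg// (le_trans (entry_le_hs_norm _ _ _)).
Qed.

Lemma sqr_op_norm_le_hs A : op_norm A ^+ 2 <= n%:R * hs_norm A ^+ 2.
Proof.
pose c := n%:R * hs_norm A ^+ 2; have c0 : 0 <= c by rewrite mulr_ge0 ?sqr_ge0.
rewrite -/c -[X in _ <= X](sqr_sqrtr c0) ler_sqr ?nnegrE ?op_norm_ge0 ?sqrtr_ge0//.
apply: ge_sup; first by case: (op_norm_has_sup A).
move=> _ [x /= x1 <-]; rewrite -ler_sqr ?nnegrE ?hs_norm_ge0 ?sqrtr_ge0//.
rewrite (sqr_sqrtr c0) -qform_rank1 /c -[n%:R]mulr1.
by apply: qform_le => i j; exact: rank1_entry_le1.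
Qed.

Definition ratvec (v : 'cV[rat * rat]_n) : 'cV[C]_n :=
  \col_i (ratr (v i 0).1 +i* ratr (v i 0).2)%C.

Lemma ratvec_dense x e : 0 < e -> exists v, hs_norm (x - ratvec v) <= e.
Proof.
move=> e0; pose h := e / (2 * n%:R + 2).
have n0 : 0 <= n%:R :> R by [].
have d0 : 0 < 2 * n%:R + 2 :> R by lra.
have h0 : 0 < h by rewrite divr_gt0.
have exr (a : R) : exists r : rat, `|a - ratr r| <= h.
  have ah : a < a + h by rewrite ltrDl.
  have [r rP] := rat_in_itvoo ah.
  exists r; move: rP; rewrite in_itv /= => /andP[r1 r2].
  by rewrite ler_norml; lra.
have [r rP] := choice exr.
exists (\col_i (r (cRe (x i 0)), r (cIm (x i 0)))).
rewrite -ler_sqr ?nnegrE ?hs_norm_ge0 ?(ltW e0)// sqr_hs_norm.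
apply: (@le_trans _ _ (\sum_(i < n) 2 * h ^+ 2)).
  apply: ler_sum => i _; rewrite big_ord1 !mxE normc_sqr cReD cImD cReN cImN /=.
  have sq (a : R) : `|a| <= h -> a ^+ 2 <= h ^+ 2.
    by move=> ah; rewrite -(real_normK (num_real a)) lerXn2r// ?nnegrE ?(ltW h0).
  by have := sq _ (rP (cRe (x i 0))); have := sq _ (rP (cIm (x i 0))); lra.
rewrite sumr_const card_ord.
have -> : 2 * h ^+ 2 *+ n = e ^+ 2 * (2 * n%:R / (2 * n%:R + 2) ^+ 2).
  by rewrite -[LHS]mulr_natl /h; field; rewrite gt_eqF.
rewrite ler_piMr ?sqr_ge0// ler_pdivrMr ?exprn_gt0// mul1r.
by have := mulr_ge0 n0 n0; nra.
Qed.

(** The rational vectors of the unit ball, with 0 for every other code, so that each value lies in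
    the ball. Countability gives the measurability of [op_norm] and of the choice of a norming
    vector. *)
Definition ball_enum (k : nat) : 'cV[C]_n :=
  if unpickle k is Some v then if hs_norm (ratvec v) <= 1 then ratvec v else 0 else 0.

Lemma ball_enum_le1 k : hs_norm (ball_enum k) <= 1.
Proof.
rewrite /ball_enum; case: (unpickle k) => [v|]; last by rewrite hs_norm0 ler01.
by case: ifP => // _; rewrite hs_norm0 ler01.
Qed.

Lemma ball_enum_norming A d : 0 < d < 1 ->
  exists k, (1 - d) * op_norm A <= hs_norm (A *m ball_enum k).
Proof.
move=> /andP[d0 d1]; have [p0|p0] := eqVneq (op_norm A) 0.
  by exists 0; rewrite p0 mulr0 hs_norm_ge0.
have p1 : 0 < op_norm A by rewrite lt_def p0 op_norm_ge0.
have d2 : 0 < d / 2 * op_norm A by rewrite mulr_gt0// divr_gt0.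
have [_ [x /= x1 <-] hx] := sup_adherent d2 (op_norm_has_sup A).
rewrite -/(op_norm A) in hx.
(* Shrinking [x] leaves room in the ball for a rational approximation with error [d / 4]. The total
   loss is at most [d], since [(1 - d/4) (1 - d/2) - d/4 = 1 - d + d^2/8]. *)
pose x' := (1 - d / 4)%:C%C *: x; have [|v vP] := @ratvec_dense x' (d / 4).
  by rewrite divr_gt0.
have x'E : hs_norm x' = (1 - d / 4) * hs_norm x.
  by rewrite hs_normZ normc_real ger0_norm//; lra.
have v1 : hs_norm (ratvec v) <= 1.
  have vx : hs_norm (ratvec v - x') = hs_norm (x' - ratvec v) by rewrite -hs_normN opprB.
  have := hs_normB (ratvec v) x'; rewrite vx x'E.
  have : (1 - d / 4) * hs_norm x <= (1 - d / 4) * 1 by rewrite ler_wpM2l//; lra.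
  by lra.
exists (pickle v); rewrite /ball_enum pickleK v1.
have Av : A *m x' - A *m (x' - ratvec v) = A *m ratvec v.
  by rewrite -mulmxBr opprB addrC subrK.
have := hs_normB (A *m x') (A *m (x' - ratvec v)); rewrite Av.
have := op_norm_mulmx A (x' - ratvec v).
have := ler_wpM2l (ltW p1) vP.
rewrite /x' -scalemxAr hs_normZ normc_real ger0_norm; last by lra.
have : (1 - d / 4) * (op_norm A - d / 2 * op_norm A) <= (1 - d / 4) * hs_norm (A *m x).
  by rewrite ler_wpM2l ?(ltW hx)//; lra.
have : 0 <= d * (d * op_norm A) by rewrite !mulr_ge0 ?ltW.
move: (op_norm A) (hs_norm (A *m x)) (hs_norm (A *m ratvec v)) (hs_norm (A *m (_ - _))).
by move: (hs_norm _) => *; lra.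
Qed.

Lemma op_norm_sup A : op_norm A = sup (range (fun k => hs_norm (A *m ball_enum k))).
Proof.
have hs : has_sup (range (fun k => hs_norm (A *m ball_enum k))).
  split; first by exists (hs_norm (A *m ball_enum 0)), 0.
  by exists (op_norm A) => _ [k _ <-]; exact: op_norm_ub (ball_enum_le1 k).
apply/eqP; rewrite eq_le; apply/andP; split; last first.
  by apply: ge_sup hs.1 _ => _ [k _ <-]; exact: op_norm_ub (ball_enum_le1 k).
apply: (@le_half_pow_lim _ _ _ (op_norm A)) => j.
have [|k kP] := @ball_enum_norming A (2^-1 ^+ j.+1).
  have := half_pow_gt0 (R := R) j.+1; have := half_pow_le1 (R := R) j.
  by rewrite (half_powS j); lra.
have := half_powS (R := R) j; have := half_pow_gt0 (R := R) j.+1 => w0 wS.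
have : hs_norm (A *m ball_enum k) <= sup (range (fun k => hs_norm (A *m ball_enum k))).
  by apply: ub_le_sup; [case: hs|exists k].
have := mulr_ge0 (ltW w0) (op_norm_ge0 A); rewrite wS; move: kP; lra.
Qed.

End OperatorNorm.

(** * Measurable choice of almost norming vectors *)

Section Selection.
Context {R : realType} {n : nat}.
Local Notation C := R[i].
Local Notation T := (circle R).
Local Notation m := (circle_measure R).
Local Notation cRe := (@complex.Re R).
Local Notation cIm := (@complex.Im R).
Local Notation M := 'M[C]_n.
Implicit Types F G X Y : T -> M.

Lemma measurable_hs_norm_mulmx X (x : 'cV[C]_n) : measurable_mxfun X ->
  measurable_fun setT (fun z => hs_norm (X z *m x)).
Proof.
move=> mX; have msqrt : measurable_fun setT (@Num.sqrt R).
  by apply: continuous_measurable_fun; exact: sqrt_continuous.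
apply: (measurableT_comp msqrt).
apply: (@measurable_sum _ _ _ _ _ _ (fun i z => \sum_j normc ((X z *m x) i j) ^+ 2)) => i.
apply: (@measurable_sum _ _ _ _ _ _ (fun j z => normc ((X z *m x) i j) ^+ 2)) => j.
apply: measurable_normc_sqr; under [X in measurable_cfun X]eq_fun do rewrite mxE.
apply: measurable_cfun_sum => l _; apply: measurable_cfunM; first exact: mX.
exact: measurable_cfun_cst.
Qed.

Lemma measurable_op_norm X : measurable_mxfun X -> measurable_fun setT (fun z => op_norm (X z)).
Proof.
move=> mX; rewrite (_ : (fun _ => _) =
    fun z => sups (fun k => hs_norm (X z *m ball_enum n k)) 0); last first.
  apply/funext => z; rewrite op_norm_sup /sups /sdrop; congr sup.
  by apply/seteqP; split=> [_ [k _ <-]|_ [k _ <-]]; exists k.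
apply: (measurable_fun_sups (h := fun k z => hs_norm (X z *m ball_enum n k))).
  move=> z _; exists (op_norm (X z)) => _ [k _ <-].
  exact: op_norm_ub (ball_enum_le1 _ k).
by move=> k; exact: measurable_hs_norm_mulmx.
Qed.

(** The least successful index is measurable, since each of its fibres is a difference of sets on
    which a given index succeeds. Measurability is stated through compositions in order to apply
    directly to entries of [ball_enum n (N z)]. *)
Lemma norming_selection X d : measurable_mxfun X -> 0 < d < 1 ->
  exists N : T -> nat, (forall f : nat -> R, measurable_fun setT (f \o N)) /\
  forall z, (1 - d) * op_norm (X z) <= hs_norm (X z *m ball_enum n (N z)).
Proof.
move=> mX d01.
have exk z : exists k, (1 - d) * op_norm (X z) <= hs_norm (X z *m ball_enum n k).
  exact: ball_enum_norming.
pose N z := ex_minn (exk z).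
have NP z : (1 - d) * op_norm (X z) <= hs_norm (X z *m ball_enum n (N z)).
  by rewrite /N; case: ex_minnP.
exists N; split=> // f.
pose A k := [set z | (1 - d) * op_norm (X z) <= hs_norm (X z *m ball_enum n k)].
have mA k : measurable (A k).
  rewrite -[A k]setTI; apply: (measurable_fun_ler _ _ measurableT) => //.
    by apply: measurable_funM; [exact: measurable_cst|exact: measurable_op_norm].
  exact: measurable_hs_norm_mulmx.
have NE k : N @^-1` [set k] = A k `\` \big[setU/set0]_(i < k) A i.
  apply/seteqP; split=> z /=.
    rewrite /N; case: ex_minnP => k' k'P min <-; split=> //.
    rewrite -bigcup_mkord => -[i /= ik Aiz].
    by have := min i Aiz; rewrite leqNgt ik.
  rewrite -bigcup_mkord => -[Akz nA]; rewrite /N; case: ex_minnP => k' k'P min.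
  apply/eqP; rewrite eqn_leq (min _ Akz) leqNgt; apply/negP => k'k.
  by apply: nA; exists k'.
have mN : measurable_fun setT N.
  move=> _ B _; rewrite setTI.
  rewrite (_ : N @^-1` B = \bigcup_(k in B) (N @^-1` [set k])); last first.
    by apply/seteqP; split=> [z Bz|z [k Bk /= Nz]]; [exists (N z)|rewrite Nz].
  apply: bigcup_measurable => k _; rewrite NE; apply: measurableD => //.
  exact: bigsetU_measurable.
by apply: (measurableT_comp (_ : measurable_fun setT f) mN).
Qed.

End Selection.

(** * Duality of Lebesgue norms *)

Section LebesgueNorms.
Context {R : realType}.
Local Notation T := (circle R).
Local Notation m := (circle_measure R).
Implicit Types (f g s : T -> R) (p r c : R) (q : \bar R).
Local Notation LN q f := (Lnorm m q (fun z => (f z)%:E)).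

Lemma Lnorm_le f r c : 0 < r -> 0 <= c -> (forall z, 0 <= f z) ->
  (LN r%:E f <= c%:E)%E <-> (\int[m]_z (f z `^ r)%:E <= (c `^ r)%:E)%E.
Proof.
move=> r0 c0 f0; set I := (\int[m]_z _)%E.
have I0 : (0 <= I)%E by apply: integral_ge0 => z _; rewrite lee_fin powR_ge0.
have -> : LN r%:E f = (I `^ r^-1)%E.
  rewrite unlock; suff -> : (\int[m]_z (`|(f z)%:E| `^ r))%E = I by [].
  by apply: eq_integral => z _; rewrite /= ger0_norm.
have mon (a b : \bar R) (e : R) : (0 <= e)%R -> (0 <= a)%E -> (0 <= b)%E -> (a <= b)%E ->
    (a `^ e <= b `^ e)%E.
  move=> e0 a0 b0 ab; apply: (gt0_ler_poweR e0) => //.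
  - by rewrite in_itv /= a0 leey.
  - by rewrite in_itv /= b0 leey.
split=> h.
  have := mon _ _ r (ltW r0) (poweR_ge0 _ _) _ h; rewrite -poweRrM mulVf ?gt_eqF//.
  by rewrite poweRe1//; apply; rewrite lee_fin.
have ri : 0 <= r^-1 by rewrite invr_ge0 ltW.
have := mon _ _ r^-1 ri I0 _ h; rewrite poweR_EFin -powRrM mulfV ?gt_eqF// powRr1//.
by apply; rewrite lee_fin powR_ge0.
Qed.

Lemma Lnorm_lty f r : 0 < r -> (forall z, 0 <= f z) ->
  (LN r%:E f < +oo)%E <-> (\int[m]_z (f z `^ r)%:E < +oo)%E.
Proof.
move=> r0 f0; rewrite unlock.
have -> : (\int[m]_z (f z `^ r)%:E = \int[m]_z (`|(f z)%:E| `^ r))%E.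
  by apply: eq_integral => z _; rewrite /= ger0_norm.
split=> [h|]; last exact: poweR_lty.
by apply: lty_poweRy h; rewrite invr_neq0// gt_eqF.
Qed.

Lemma le_Lnorm f g r : 0 < r -> measurable_fun setT f -> measurable_fun setT g ->
  (forall z, 0 <= f z <= g z) -> (LN r%:E f <= LN r%:E g)%E.
Proof.
move=> r0 mf mg fg; rewrite unlock.
have mp (h : T -> R) : measurable_fun setT h -> measurable_fun setT (fun z => (h z `^ r)%:E).
  by move=> mh; apply/measurable_EFinP; exact: (measurableT_comp (measurable_powR r) mh).
have fgE (h : T -> R) : (forall z, 0 <= h z) ->
    (\int[m]_z (`|(h z)%:E| `^ r) = \int[m]_z (h z `^ r)%:E)%E.
  by move=> h0; apply: eq_integral => z _; rewrite /= ger0_norm.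
have f0 z : 0 <= f z by case/andP: (fg z).
have g0 z : 0 <= g z by case/andP: (fg z) => a /(le_trans a).
rewrite !fgE//; apply: gt0_ler_poweR.
- by rewrite invr_ge0 ltW.
- by rewrite in_itv /= leey integral_ge0// => z _; rewrite lee_fin powR_ge0.
- by rewrite in_itv /= leey integral_ge0// => z _; rewrite lee_fin powR_ge0.
- apply: ge0_le_integral => //; try exact: mp.
  + by move=> z _; rewrite lee_fin powR_ge0.
  + move=> z _; rewrite lee_fin; apply: ge0_ler_powR; rewrite ?nnegrE ?(ltW r0)//.
    by case/andP: (fg z).
Qed.

Lemma Lnorm_y_le f c : 0 <= c -> (forall z, 0 <= f z) ->
  (LN +oo%E f <= c%:E)%E <-> {ae m, forall z, f z <= c}.
Proof.
move=> c0 f0; have mT : (0 < m [set: T])%E by rewrite probability_setT lte01.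
rewrite unlock mT.
have e z : (abse \o (fun z => (f z)%:E)) z = (f z)%:E by rewrite /= ger0_norm.
split=> [/ess_supP|h].
  by apply: filterS => z; rewrite e lee_fin.
by apply/ess_supP; apply: filterS h => z; rewrite e lee_fin.
Qed.

Lemma sqr_le_powR (a r : R) : 0 <= a -> 2 <= r -> a ^+ 2 <= 1 + a `^ r.
Proof.
move=> a0 r2; have [a1|a1] := leP a 1.
  by rewrite (le_trans (exprn_ile1 _ a0 a1))// lerDl powR_ge0.
rewrite -powR_mulrn// (le_trans (ler_powR (ltW a1) r2))// lerDr.
exact: ler01.
Qed.

Lemma Lnorm_sqr_integrable q f : (2%:E <= q)%E -> measurable_fun setT f ->
  (forall z, 0 <= f z) -> (LN q f < +oo)%E ->
  m.-integrable setT (EFin \o (fun z => f z ^+ 2)).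
Proof.
move=> q2 mf f0; have mf2 := measurable_funX 2 mf.
case: q q2 => [r|_|//].
  rewrite lee_fin => r2; have r0 : 0 < r by lra.
  move=> /(Lnorm_lty r0 f0) fr.
  have fri : m.-integrable setT (EFin \o (fun z => f z `^ r)).
    apply/integrableP; split.
      by apply/measurable_EFinP; exact: (measurableT_comp (measurable_powR r) mf).
    by under eq_integral do rewrite /= ger0_norm ?powR_ge0//.
  apply: ge_integrable (integrable_addR (integrable_cst 1) fri) => // z.
  by rewrite ger0_norm ?sqr_ge0// sqr_le_powR.
have mT : (0 < m [set: T])%E by rewrite probability_setT lte01.
rewrite unlock mT => h; have {}h : (ess_sup m (EFin \o f) < +oo)%E.
  congr (_ < +oo)%E: h; congr (ess_sup _ _).
  by apply/funext => z /=; rewrite ger0_norm.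
have [K fK] := ess_supr_bounded h.
apply: ae_le_integrable (integrable_cst (K ^+ 2)) => //.
apply: filterS fK => z fK; rewrite ger0_norm ?sqr_ge0//.
by rewrite ler_sqr ?nnegrE// (le_trans (f0 z)).
Qed.

Variables (p : R) (q : \bar R).
Hypotheses (p2 : 2 <= p) (q2 : (2%:E < q)%E).
Hypothesis pq : ((p%:E)^-1 + q^-1 = (2%:E)^-1)%E.

Lemma exponent_gt0 : 0 < p.
Proof. by rewrite (lt_le_trans _ p2). Qed.

(** For finite [q] the relation is cleared of denominators to [(p - 2) * r = 2 * p], which matches
    the powers in the extremal weight. An infinite [q] forces [p = 2]. *)
Lemma exponents_cases : (p = 2 /\ q = +oo%E) \/
  (exists r, [/\ q = r%:E, 2 < p, 2 < r, p^-1 + r^-1 = 2^-1 & (p - 2) * r = 2 * p]).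
Proof.
have p0 := exponent_gt0.
move: q2 pq; case: q => [r| |] //; last first.
  rewrite invey adde0 !inver !gt_eqF// => _ [] /(congr1 (@GRing.inv R)).
  by rewrite !invrK => ->; left.
rewrite lte_fin => r2; have r0 : 0 < r by lra.
rewrite !inver !gt_eqF// -EFinD => -[] e; right; exists r.
have h : (p - 2) * r = 2 * p.
  have : (p^-1 + r^-1) * (2 * p * r) = 2^-1 * (2 * p * r) by rewrite e.
  have -> : (p^-1 + r^-1) * (2 * p * r) = 2 * r + 2 * p by field; rewrite !gt_eqF.
  have -> : 2^-1 * (2 * p * r) = p * r by field.
  by lra.
split=> //; rewrite lt_neqAle p2 andbT; apply/eqP => p2e.
by move: h; rewrite -p2e subrr mul0r; lra.
Qed.

(** For finite [q] this is Hoelder's inequality for the squares, with the conjugate exponents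
    [p / 2] and [q / 2]. *)
Lemma Lnorm_mul_le f g : measurable_fun setT f -> measurable_fun setT g ->
  (forall z, 0 <= f z) -> (forall z, 0 <= g z) -> (LN q f <= 1)%E ->
  (LN 2%:E (fun z => (g z * f z)%R) <= LN p%:E g)%E.
Proof.
move=> mf mg f0 g0.
have gf0 z : 0 <= g z * f z by rewrite mulr_ge0.
have [goo|goo] := eqVneq (LN p%:E g) +oo%E; first by rewrite goo leey.
have gfin : LN p%:E g \is a fin_num by rewrite ge0_fin_numE ?ltey// Lnorm_ge0.
have [a aE] : exists a, LN p%:E g = a%:E by exists (fine (LN p%:E g)); rewrite fineK.
have a0 : 0 <= a by rewrite -lee_fin -aE Lnorm_ge0.
have p0 := exponent_gt0.
have gp : (\int[m]_z (g z `^ p)%:E <= (a `^ p)%:E)%E.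
  by apply/(Lnorm_le p0 a0 g0); rewrite aE.
rewrite aE => fq; apply/(Lnorm_le _ a0 gf0) => //.
have mgf : measurable_fun setT (fun z => ((g z * f z) `^ 2)%:E).
  apply/measurable_EFinP; apply: (measurableT_comp (measurable_powR 2)).
  exact: measurable_funM.
have [[pE qE]|[r [qE p2' r2 e h]]] := exponents_cases.
  rewrite qE in fq; have {}fq := (Lnorm_y_le ler01 f0).1 fq.
  rewrite pE in gp; apply: le_trans gp; apply: ae_ge0_le_integral => //.
  - by move=> z _; rewrite lee_fin powR_ge0.
  - by move=> z _; rewrite lee_fin powR_ge0.
  - by apply/measurable_EFinP; exact: (measurableT_comp (measurable_powR 2) mg).
  - apply: filterS fq => z f1 _; rewrite lee_fin; apply: ge0_ler_powR; rewrite ?nnegrE//.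
    by rewrite ler_piMr.
have r0 : 0 < r by lra.
have fr : (\int[m]_z (f z `^ r)%:E <= 1)%E.
  by have := (Lnorm_le r0 ler01 f0).1; rewrite powR1; apply; rewrite -qE.
have mg2 : measurable_fun setT (fun z => g z ^+ 2) by exact: measurable_funX.
have mf2 : measurable_fun setT (fun z => f z ^+ 2) by exact: measurable_funX.
have h2 : (p / 2)^-1 + (r / 2)^-1 = 1.
  by rewrite !invf_div -mulrDr e divff.
have p20 : 0 < p / 2 by rewrite divr_gt0.
have r20 : 0 < r / 2 by rewrite divr_gt0.
have := hoelder m mg2 mf2 p20 r20 h2; rewrite Lnorm1.
have -> : (\int[m]_z `|(EFin \o ((fun z => g z ^+ 2) \* (fun z => f z ^+ 2))%R) z| =
    \int[m]_z ((g z * f z) `^ 2)%:E)%E.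
  apply: eq_integral => z _; rewrite /= ger0_norm ?mulr_ge0 ?sqr_ge0//.
  by rewrite -exprMn powR_mulrn.
move=> /le_trans; apply.
have sq (u : T -> R) (t b : R) : 0 < t -> 0 <= b -> (forall z, 0 <= u z) ->
    (\int[m]_z (u z `^ t)%:E <= (b `^ t)%:E)%E ->
    (Lnorm m (t / 2)%:E (EFin \o (fun z => (u z ^+ 2)%R)) <= (b ^+ 2)%:E)%E.
  move=> t0 b0 u0 ut; have t20 : 0 < t / 2 by rewrite divr_gt0.
  apply/(Lnorm_le t20 (sqr_ge0 b) (fun z => sqr_ge0 (u z))).
  have pE (x : R) : 0 <= x -> (x ^+ 2) `^ (t / 2) = x `^ t.
    by move=> x0; rewrite -powR_mulrn// -powRrM mulrCA divff ?mulr1.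
  by rewrite pE//; under eq_integral do rewrite pE//.
have ag := sq g p a p0 a0 g0 gp.
have af : (Lnorm m (r / 2)%:E (EFin \o (fun z => (f z ^+ 2)%R)) <= (1 ^+ 2)%:E)%E.
  by apply: sq => //; rewrite powR1.
rewrite powR_mulrn// -[leRHS]mule1; apply: lee_pmul => //; rewrite ?Lnorm_ge0//.
by rewrite expr1n in af.
Qed.

End LebesgueNorms.

(** * Scalar weights and the duality of [L^(p/2)] and [L^(q/2)] *)

Section AdmissibleWeights.
Context {R : realType}.
Local Notation T := (circle R).
Local Notation m := (circle_measure R).
Implicit Types (f g s : T -> R).
Local Notation LN q f := (Lnorm m q (fun z => (f z)%:E)).

Variables (p : R) (q : \bar R).
Hypotheses (p2 : 2 <= p) (q2 : (2%:E < q)%E).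
Hypothesis pq : ((p%:E)^-1 + q^-1 = (2%:E)^-1)%E.

(** If [s] is the trace of [W = F F^*], its square root is the Hilbert-Schmidt norm of [F], so this
    is the condition that [F] lies in the unit ball of [L^q]. *)
Definition admissible s := (LN q (fun z => Num.sqrt (s z)) <= 1)%E.

Lemma le_integral_fin f g : measurable_fun setT f -> measurable_fun setT g ->
  (forall z, 0 <= f z <= g z) -> (\int[m]_z (f z)%:E <= \int[m]_z (g z)%:E)%E.
Proof.
move=> mf mg fg; apply: ge0_le_integral => //.
- by move=> z _; rewrite lee_fin; case/andP: (fg z).
- exact/measurable_EFinP.
- exact/measurable_EFinP.
- by move=> z _; rewrite lee_fin; case/andP: (fg z).
Qed.

Lemma measurable_powR_comp f (a : R) : measurable_fun setT f ->
  measurable_fun setT (fun z => f z `^ a).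
Proof. by move=> mf; exact: (measurableT_comp (measurable_powR a) mf). Qed.

Lemma measurable_sqrt_comp s : measurable_fun setT s ->
  measurable_fun setT (fun z => Num.sqrt (s z)).
Proof.
move=> ms; have msqrt : measurable_fun setT (@Num.sqrt R).
  by apply: continuous_measurable_fun; exact: sqrt_continuous.
exact: measurableT_comp msqrt ms.
Qed.

Lemma admissibleP s : admissible s <->
  (q = +oo%E /\ {ae m, forall z, Num.sqrt (s z) <= 1}) \/
  (exists r, [/\ q = r%:E, 2 < r & (\int[m]_z (Num.sqrt (s z) `^ r)%:E <= 1)%E]).
Proof.
have s0 z : 0 <= Num.sqrt (s z) := sqrtr_ge0 _.
have h r : 2 < r -> (LN r%:E (fun z => Num.sqrt (s z)) <= 1)%E <->
    (\int[m]_z (Num.sqrt (s z) `^ r)%:E <= 1)%E.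
  move=> r2; have r0 : 0 < r by lra.
  by have := Lnorm_le r0 ler01 s0; rewrite powR1.
rewrite /admissible; have [[_ qE]|[r [qE _ r2 _ _]]] := exponents_cases p2 q2 pq.
  have hy := Lnorm_y_le ler01 s0; rewrite qE; split=> [/hy a|]; first by left.
  by move=> [[_ /hy]//|[r []]].
rewrite qE; split=> [/(h _ r2) a|]; first by right; exists r.
by move=> [[]//|[r' [[<-] _ /(h _ r2)]]].
Qed.

Lemma le_admissible s1 s2 : measurable_fun setT s1 -> measurable_fun setT s2 ->
  (forall z, 0 <= s1 z <= s2 z) -> admissible s2 -> admissible s1.
Proof.
move=> m1 m2 s12 /admissibleP h; apply/admissibleP.
have le_sqrt z : Num.sqrt (s1 z) <= Num.sqrt (s2 z).
  by rewrite ler_wsqrtr//; case/andP: (s12 z).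
case: h => [[qE h]|[r [qE r2 h]]]; [left|right].
  by split=> //; apply: filterS h => z; exact: le_trans.
exists r; split; [exact: qE|exact: r2|]; apply: le_trans h; have r0 : 0 < r by lra.
apply: le_integral_fin.
- exact: measurable_powR_comp (measurable_sqrt_comp m1).
- exact: measurable_powR_comp (measurable_sqrt_comp m2).
- move=> z; rewrite powR_ge0; apply: ge0_ler_powR; rewrite ?nnegrE ?sqrtr_ge0//.
  exact: ltW.
Qed.

Lemma admissible1 : admissible (fun=> 1).
Proof.
apply/admissibleP; have [[_ qE]|[r [qE _ r2 _ _]]] := exponents_cases p2 q2 pq; [left|right].
  by split=> //; apply: aeW => z; rewrite sqrtr1.
exists r; split; [exact: qE|exact: r2|]; rewrite sqrtr1 powR1.
by rewrite integral_cst// mul1e; exact: probability_le1.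
Qed.

Lemma powR_convex (r t a b : R) : 1 <= r -> 0 <= t <= 1 -> 0 <= a -> 0 <= b ->
  (t * a + (1 - t) * b) `^ r <= t * a `^ r + (1 - t) * b `^ r.
Proof.
move=> r1 /andP[t0 t1] a0 b0.
have := convex_powR r1 (Itv01 t0 t1) (x := a) (y := b).
by rewrite !convRE /=; apply; rewrite inE /= in_itv /= andbT.
Qed.

(** For finite [q] the condition bounds the integral of [s^(q/2)], which is convex in [s] since
    [q/2 >= 1]; otherwise it reads [s <= 1] almost everywhere. *)
Lemma admissible_conv t s1 s2 : 0 <= t <= 1 ->
  measurable_fun setT s1 -> measurable_fun setT s2 ->
  (forall z, 0 <= s1 z) -> (forall z, 0 <= s2 z) ->
  admissible s1 -> admissible s2 -> admissible (fun z => t * s1 z + (1 - t) * s2 z).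
Proof.
move=> t01 m1 m2 s10 s20 h1 h2; apply/admissibleP; have /andP[t0 t1] := t01.
have u0 : 0 <= 1 - t by lra.
move: h1 h2 => /admissibleP[[qE h1]|[r [qE r2 h1]]] /admissibleP; rewrite qE.
  move=> [[_ h2]|[r []]//]; left; split=> //; apply: filterS2 h1 h2 => z h1 h2.
  have le1 (x : R) : 0 <= x -> (Num.sqrt x <= 1) = (x <= 1).
    by move=> x0; rewrite -[1 in LHS]sqrtr1 ler_psqrt// nnegrE.
  rewrite le1 ?addr_ge0 ?mulr_ge0//; move: h1 h2; rewrite !le1// => h1 h2.
  have := ler_wpM2l t0 h1; have := ler_wpM2l u0 h2; lra.
move=> [[]//|[r' [[<-] _ h2]]]; right; exists r; split; [exact: erefl|exact: r2|].
have r0 : 0 <= r / 2 by lra.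
have r21 : 1 <= r / 2 by lra.
have sE (x : R) : 0 <= x -> Num.sqrt x `^ r = x `^ (r / 2).
  by move=> x0; rewrite -powR12_sqrt// -powRrM mulrC.
have mp s : measurable_fun setT s -> measurable_fun setT (fun z => Num.sqrt (s z) `^ r).
  by move=> ms; exact: measurable_powR_comp (measurable_sqrt_comp ms).
have fi s : measurable_fun setT s -> (\int[m]_z (Num.sqrt (s z) `^ r)%:E <= 1)%E ->
    m.-integrable setT (EFin \o (fun z => Num.sqrt (s z) `^ r)) /\
    \int[m]_z (Num.sqrt (s z) `^ r) <= 1.
  move=> ms sle; have si : m.-integrable setT (EFin \o (fun z => Num.sqrt (s z) `^ r)).
    apply/integrableP; split; first by apply/measurable_EFinP; exact: mp.
    under eq_integral do rewrite /= ger0_norm ?powR_ge0//.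
    exact: le_lt_trans sle (ltry 1).
  by split=> //; rewrite -lee_fin /Rintegral fineK//; exact: integrable_fin_num si.
have [i1 b1] := fi _ m1 h1; have [i2 b2] := fi _ m2 h2.
have ti := integrable_scaleR t i1; have ui := integrable_scaleR (1 - t) i2.
have tui := integrable_addR ti ui.
apply: (@le_trans _ _ (\int[m]_z (t * Num.sqrt (s1 z) `^ r + (1 - t) * Num.sqrt (s2 z) `^ r)%:E)%E).
  apply: le_integral_fin.
  - by apply: mp; apply: measurable_funD; apply: measurable_funM => //; exact: measurable_cst.
  - by apply/measurable_EFinP; exact: measurable_int tui.
  - move=> z; rewrite powR_ge0 !sE ?addr_ge0 ?mulr_ge0//.
    exact: powR_convex r21 t01 (s10 z) (s20 z).
rewrite -[leLHS]fineK; last exact: integrable_fin_num tui.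
rewrite lee_fin -/(Rintegral _ _ _) (RintegralD measurableT ti ui).
rewrite (RintegralZl _ measurableT i1) (RintegralZl _ measurableT i2).
have := lerD (ler_wpM2l t0 b1) (ler_wpM2l u0 b2); move=> /le_trans; apply.
by rewrite !mulr1 addrC subrK.
Qed.

(* The extremal weight in the duality is a normalised power of [g]; truncating
   [g] makes it bounded and its norm finite. *)
Lemma Lnorm_le_of_admissible g (c : R) : measurable_fun setT g -> (forall z, 0 <= g z) ->
  0 <= c -> m.-integrable setT (EFin \o (fun z => g z ^+ 2)) ->
  (forall s, measurable_fun setT s -> (forall z, 0 <= s z) -> (exists K, forall z, s z <= K) ->
     admissible s -> \int[m]_z (s z * g z ^+ 2) <= c) ->
  (LN p%:E g <= (Num.sqrt c)%:E)%E.
Proof.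
move=> mg g0 c0 gi gs; have p0 := exponent_gt0 p2.
have sc0 : 0 <= Num.sqrt c := sqrtr_ge0 c.
apply/(Lnorm_le p0 sc0 g0).
have [[pE qE]|[r [qE p2' r2 e h]]] := exponents_cases p2 q2 pq.
  have bd : exists K : R, forall z : T, (1 : R) <= K by exists 1 => _; exact: lexx.
  have := gs (fun=> 1) (@measurable_cst _ _ T R setT 1) (fun _ => ler01) bd admissible1.
  rewrite pE powR_mulrn// sqr_sqrtr//.
  under eq_Rintegral do rewrite mul1r; move=> gc.
  have -> : (\int[m]_z (g z `^ 2)%:E = \int[m]_z (g z ^+ 2)%:E)%E.
    by apply: eq_integral => z _; rewrite powR_mulrn.
  by rewrite -[leLHS]fineK ?lee_fin//; exact: integrable_fin_num gi.
have r0 : 0 < r by lra.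
pose tau (B : nat) z := Num.min (g z) B%:R.
have tau0 B z : 0 <= tau B z by rewrite /tau le_min g0 ler0n.
have mtau B : measurable_fun setT (tau B) by apply: measurable_minr.
have mpow (u : T -> R) (a : R) : measurable_fun setT u -> measurable_fun setT (fun z => u z `^ a).
  by move=> mu; exact: (measurableT_comp (measurable_powR a) mu).
have tauB B z : tau B z <= B%:R by rewrite /tau ge_min lexx orbT.
have taui B : m.-integrable setT (EFin \o (fun z => tau B z `^ p)).
  apply: ge_integrable (integrable_cst (B%:R `^ p)); first exact: mpow.
  move=> z; rewrite ger0_norm ?powR_ge0//; apply: ge0_ler_powR; rewrite ?nnegrE//.
  exact: ltW.
have bound B : (\int[m]_z (tau B z `^ p)%:E <= (Num.sqrt c `^ p)%:E)%E.
  pose I := \int[m]_z (tau B z `^ p).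
  have IE : (\int[m]_z (tau B z `^ p)%:E)%E = I%:E.
    by rewrite fineK//; exact: integrable_fin_num (taui B).
  rewrite IE lee_fin.
  have I0 : 0 <= I by apply: Rintegral_ge0 => z _; exact: powR_ge0.
  have [->|In0] := eqVneq I 0; first exact: powR_ge0.
  have Ip : 0 < I by rewrite lt_def In0.
  (* Normalises [s]: since [(p - 2) * r / 2 = p], the integral of [s^(r/2)] is [l^(r/2) * I = 1]. *)
  pose l := I `^ (- (2 / r)); have l0 : 0 < l by rewrite powR_gt0.
  pose s z := l * tau B z `^ (p - 2).
  have s0 z : 0 <= s z by rewrite mulr_ge0 ?powR_ge0// ltW.
  have ms : measurable_fun setT s by apply: measurable_funM; [exact: measurable_cst|exact: mpow].
  have p20 : 0 < p - 2 by lra.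
  have sbd : exists K, forall z, s z <= K.
    exists (l * B%:R `^ (p - 2)) => z; apply: ler_wpM2l; first exact: ltW.
    by apply: ge0_ler_powR; rewrite ?nnegrE// ltW.
  have sadm : admissible s.
    apply/admissibleP; right; exists r; split; [exact: qE|exact: r2|].
    rewrite (eq_integral (fun z => (I^-1 * tau B z `^ p)%:E)); last first.
      move=> z _; congr EFin; rewrite -powR12_sqrt// -powRrM /s powRM ?powR_ge0// ?(ltW l0)//.
      rewrite /l -!powRrM; congr (_ * _ `^ _).
        by rewrite (_ : - (2 / r) * _ = - 1) ?powR_inv1//; field; rewrite gt_eqF.
      by move: h; lra.
    rewrite -[leLHS]fineK; last exact: (integrable_fin_num measurableT (integrable_scaleR I^-1 (taui B))).
    rewrite lee_fin -/(Rintegral _ _ _) (RintegralZl _ measurableT (taui B)).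
    by rewrite mulVf.
  have := gs s ms s0 sbd sadm.
  have lI : l * I <= \int[m]_z (s z * g z ^+ 2).
    have [K sK] := sbd.
    rewrite -(RintegralZl _ measurableT (taui B)); apply: le_Rintegral => //.
    - exact: integrable_scaleR.
    - apply: ge_integrable (integrable_scaleR K gi).
        by apply: measurable_funM => //; exact: measurable_funX.
      move=> z; rewrite (ger0_norm (mulr_ge0 (s0 z) (sqr_ge0 _))).
      exact: (ler_wpM2r (sqr_ge0 _) (sK z)).
    - move=> z _; rewrite /s -mulrA; apply: ler_wpM2l; first exact: ltW.
      have -> : tau B z `^ p = tau B z `^ (p - 2) * tau B z ^+ 2.
        rewrite -powR_mulrn// -powRD; first by rewrite subrK.
        by rewrite subrK gt_eqF.
      apply: ler_wpM2l; first exact: powR_ge0.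
      by rewrite ler_sqr ?nnegrE// /tau ge_min lexx.
  move=> /(le_trans lI).
  (* The exponents agree because [1 - 2 / r = 2 / p]. *)
  have -> : l * I = I `^ (2 / p).
    rewrite /l -[X in _ * X](powRr1 I0) -powRD; last by rewrite In0 implybT.
    congr (_ `^ _); have -> : - (2 / r) + 1 = 2 * (2^-1 - r^-1) by field; rewrite gt_eqF.
    by rewrite -e addrK.
  have p20' : 0 <= p / 2 by lra.
  move=> Ic; have := ge0_ler_powR p20' _ _ Ic.
  rewrite -powRrM (_ : 2 / p * (p / 2) = 1); last by field; rewrite gt_eqF.
  rewrite powRr1// -powR12_sqrt// -powRrM (mulrC 2^-1); apply; rewrite nnegrE//.
  exact: powR_ge0.
have einfE (u : (\bar R)^nat) l : u @ \oo --> l -> limn_einf u = l.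
  by move=> ul; rewrite is_cvg_limn_einfE ?(cvg_lim _ ul)//; apply/cvg_ex; exists l.
rewrite (_ : (\int[m]_z (g z `^ p)%:E = \int[m]_z limn_einf (fun B => (tau B z `^ p)%:E))%E); last first.
  apply: eq_integral => z _; apply/esym/einfE.
  apply: cvg_near_cst; near=> B; congr (_ `^ _)%:E; rewrite /tau; apply/min_idPl.
  near: B; exact: nbhs_infty_ger.
apply: le_trans (fatou _ _ _ _) _.
- exact: measurableT.
- by move=> B; apply/measurable_EFinP; exact: mpow.
- by move=> B z _; rewrite lee_fin powR_ge0.
rewrite limn_einf_lim; apply: lime_le; first exact: is_cvg_einfs.
apply: nearW => B; apply: le_trans (bound B); apply: ereal_inf_lbound.
by exists B => //=.
Unshelve. all: end_near. Qed.

End AdmissibleWeights.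

(** * The norm of the Hankel operator *)

Section SpaceConversions.
Context {R : realType} {n : nat}.
Local Notation C := R[i].
Local Notation T := (circle R).
Local Notation m := (circle_measure R).
Local Notation cRe := (@complex.Re R).
Local Notation M := 'M[C]_n.
Implicit Types F G X Y : T -> M.

Lemma measurable_mxfunB F G : measurable_mxfun F -> measurable_mxfun G ->
  measurable_mxfun (fun z => F z - G z).
Proof.
move=> mF mG i j.
have := measurable_cfunD (mF i j) (measurable_cfunM (measurable_cfun_cst (-1)) (mG i j)).
under [X in measurable_cfun X]eq_fun do rewrite mulN1r.
by under [X in _ -> measurable_cfun X]eq_fun do rewrite !mxE.
Qed.

Lemma measurable_mxfunM F G : measurable_mxfun F -> measurable_mxfun G ->
  measurable_mxfun (fun z => F z *m G z).
Proof.
move=> mF mG i j; under [X in measurable_cfun X]eq_fun do rewrite mxE.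
by apply: measurable_cfun_sum => k _; exact: measurable_cfunM.
Qed.

Lemma scalar_L_L2 s (f : T -> C) : (2%:E <= s)%E -> scalar_L s f -> L2 f.
Proof.
move=> s2 [mf fs]; split=> //.
exact: (Lnorm_sqr_integrable s2 (measurable_normc mf) (fun z => normc_nneg (f z)) fs).
Qed.

Lemma L2_scalar_L (f : T -> C) : L2 f -> scalar_L 2%:E f.
Proof.
move=> [mf fi]; split=> //; have r20 : 0 < 2 :> R by [].
apply/(@Lnorm_lty R (fun z => normc (f z)) 2 r20 (fun z => normc_nneg (f z))).
rewrite (eq_integral (fun z => (normc (f z) ^+ 2)%:E)).
  have /fineK <- := integrable_fin_num measurableT fi; exact: ltry.
by move=> z _; rewrite powR_mulrn// normc_nneg.
Qed.

Lemma hardy_mx_hardy_from s F : (2%:E <= s)%E -> hardy_mx s F -> hardy_from 0 F.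
Proof.
move=> s2 hF; apply/hardy_fromP; split=> [i j|i j k].
  by have [/(scalar_L_L2 s2)] := hF i j.
by have [_] := hF i j; exact.
Qed.

Lemma hardy_from_hardy_mx F : hardy_from 0 F -> hardy_mx 2%:E F.
Proof.
by move=> /hardy_fromP[F2 F0] i j; split; [exact/L2_scalar_L/F2|move=> k; exact: F0].
Qed.

Lemma LS2_norm_le F (c : R) : mxL2 F -> 0 <= c ->
  (LS2_norm 2%:E F <= c%:E)%E <-> sqnorm F <= c ^+ 2.
Proof.
move=> F2 c0; have Fi := sqr_hs_norm_integrable F2.
have r20 : 0 < 2 :> R by [].
have -> : (sqnorm F <= c ^+ 2) = (\int[m]_z (hs_norm (F z) `^ 2)%:E <= (c `^ 2)%:E)%E.
  rewrite powR_mulrn// (eq_integral (fun z => (hs_norm (F z) ^+ 2)%:E)).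
    rewrite -[in RHS](fineK (integrable_fin_num measurableT Fi)).
    by rewrite lee_fin.
  by move=> z _; rewrite powR_mulrn// hs_norm_ge0.
exact: (@Lnorm_le R (fun z => hs_norm (F z)) 2 c r20 c0 (fun z => hs_norm_ge0 (F z))).
Qed.

Lemma LS2_mxL2 s F : (2%:E <= s)%E -> LS2 s F -> mxL2 F.
Proof.
move=> s2 [mF Fs]; apply: mxL2P => //.
exact: (Lnorm_sqr_integrable s2 (measurable_hs_norm mF) (fun z => hs_norm_ge0 (F z)) Fs).
Qed.

Lemma LS2_norm_sqrt F : mxL2 F -> LS2_norm 2%:E F = (Num.sqrt (sqnorm F))%:E.
Proof.
move=> F2; have s0 := sqnorm_ge0 F; apply/eqP; rewrite eq_le; apply/andP; split.
  by apply/LS2_norm_le; rewrite ?sqrtr_ge0// sqr_sqrtr.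
case E : (LS2_norm 2%:E F) => [r| |]; [|exact: leey|].
  have r0 : 0 <= r by rewrite -lee_fin -E; exact: Lnorm_ge0.
  rewrite lee_fin -(ger0_norm r0) -sqrtr_sqr ler_wsqrtr//.
  by apply/(LS2_norm_le F2 r0); rewrite E.
by have := Lnorm_ge0 m 2%:E (fun z => (hs_norm (F z))%:E); rewrite -/(LS2_norm 2%:E F) E.
Qed.

Lemma mxL2_LS2 F : mxL2 F -> LS2 2%:E F.
Proof. by move=> F2; split; [exact: mxL2_measurable|rewrite LS2_norm_sqrt// ltry]. Qed.

Lemma LM_mxL2 s F : (2%:E <= s)%E -> LM s F -> mxL2 F.
Proof.
move=> s2 [mF Fs]; have mop := measurable_op_norm mF.
have opi := Lnorm_sqr_integrable s2 mop (fun z => op_norm_ge0 (F z)) Fs.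
apply: mxL2P => //; apply: ge_integrable (integrable_scaleR (n%:R ^+ 2) opi).
  exact: measurable_sqr_hs_norm.
move=> z; rewrite ger0_norm ?sqr_ge0// -exprMn ler_sqr ?nnegrE ?hs_norm_ge0//.
  exact: hs_norm_le_op.
by rewrite mulr_ge0// op_norm_ge0.
Qed.

Definition adj_hardy : set (T -> M) :=
  [set h | exists2 G, hardy_from 0 G & h = fun z => adj (G z)].

Lemma adj_hardy_mxL2 h : adj_hardy h -> mxL2 h.
Proof. by move=> [G /hardy_fromP[G2 _] ->]; exact: mxL2_adj. Qed.

Lemma hardy2_minusP F : hardy2_minus F <-> annih adj_hardy F.
Proof.
split=> [[F2 F0]|[F2 F0]]; split.
- exact: (LS2_mxL2 (lexx _)).
- by move=> _ [G hG ->]; apply: F0; exact: hardy_from_hardy_mx.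
- exact: mxL2_LS2.
- by move=> G hG; apply: F0; exists G => //; exact: hardy_mx_hardy_from hG.
Qed.

(** Existence of a projection puts [xget] on its specification rather than on its default value. *)
Lemma proj_minusP F : mxL2 F -> hardy2_minus (proj_minus F) /\
  forall G, hardy2_minus G -> inner_L2 (fun z => F z - proj_minus F z) G = 0.
Proof.
move=> F2; apply: (@xgetPex _ (fun=> 0) [set U | hardy2_minus U /\ forall G, hardy2_minus G ->
  inner_L2 (fun z => F z - U z) G = 0]).
have [U hU U0] := annih_projection adj_hardy_mxL2 ltr01 weight1 F2.
exists U; split; first exact/hardy2_minusP.
move=> G /hardy2_minusP hG; rewrite -(U0 G hG); apply: eq_cint => z.
by rewrite mulmx1.
Qed.

Lemma inner_L2_expand X Y : mxL2 X -> mxL2 Y ->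
  sqnorm (fun z => X z - Y z) = sqnorm X + sqnorm Y - 2 * cRe (inner_L2 X Y).
Proof.
move=> X2 Y2; have := wnorm_expand weight1 (-1) X2 Y2; rewrite !wnorm1 => e.
have -> : sqnorm (fun z => X z - Y z) = sqnorm (fun z => X z + (-1) *: Y z).
  by apply: eq_Rintegral => z _; rewrite scaleN1r.
have <- : circle_int (fun z => \tr (X z *m 1%:M *m adj (Y z))) = inner_L2 X Y.
  by apply: eq_cint => z; rewrite mulmx1.
rewrite e normcN normc1 expr1n mul1r rmorphN rmorph1 mulN1r cReN mulrN.
exact: erefl.
Qed.

Lemma inner_L2_conj X Y : mxL2 X -> mxL2 Y -> inner_L2 Y X = conjc (inner_L2 X Y).
Proof.
move=> X2 Y2; rewrite -cint_conj; last exact: mxL1_trace (mxL2_adj Y2).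
by apply: eq_cint => z; rewrite -mxtrace_adj adjM adjK.
Qed.

Lemma inner_L2B X X' Y : mxL2 X -> mxL2 X' -> mxL2 Y ->
  inner_L2 (fun z => X z - X' z) Y = inner_L2 X Y - inner_L2 X' Y.
Proof.
move=> X2 X'2 Y2; rewrite -cintB; try exact: mxL1_trace (mxL2_adj Y2).
by apply: eq_cint => z; rewrite mulmxBl raddfB.
Qed.

Lemma inner_L2_self X : mxL2 X -> cRe (inner_L2 X X) = sqnorm X.
Proof.
move=> X2; rewrite Re_cint; apply: eq_Rintegral => z _.
by have -> := mxtrace_mul_adj (X z).
Qed.

End SpaceConversions.

(** * The upper bound *)

Section HankelUpperBound.
Context {R : realType} {n : nat}.
Local Notation C := R[i].
Local Notation T := (circle R).
Local Notation m := (circle_measure R).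
Local Notation cRe := (@complex.Re R).
Local Notation M := 'M[C]_n.
Implicit Types F G X Y Phi Psi : T -> M.

Variables (p : R) (q : \bar R).
Hypotheses (p2 : 2 <= p) (q2 : (2%:E < q)%E).
Hypothesis pq : ((p%:E)^-1 + q^-1 = (2%:E)^-1)%E.

Lemma hardy_mx_measurable s F : hardy_mx s F -> measurable_mxfun F.
Proof. by move=> hF i j; have [[]] := hF i j. Qed.

Lemma LS2_norm_mul_le G F : measurable_mxfun G -> measurable_mxfun F ->
  (LS2_norm q F <= 1)%E -> (LS2_norm 2%:E (fun z => G z *m F z) <= LM_norm p%:E G)%E.
Proof.
move=> mG mF F1; have mop := measurable_op_norm mG; have mhs := measurable_hs_norm mF.
apply: (@le_trans _ _ (Lnorm m 2%:E (fun z => (op_norm (G z) * hs_norm (F z))%:E))).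
  apply: (le_Lnorm (ltr0Sn R 1) (measurable_hs_norm (measurable_mxfunM mG mF))).
    exact: measurable_funM.
  by move=> z; rewrite hs_norm_ge0 hs_norm_mulmx.
exact: (Lnorm_mul_le p2 q2 pq mhs mop (fun z => hs_norm_ge0 (F z)) (fun z => op_norm_ge0 (G z)) F1).
Qed.

Lemma mul_mxL2 G F : LM p%:E G -> measurable_mxfun F -> (LS2_norm q F <= 1)%E ->
  mxL2 (fun z => G z *m F z).
Proof.
move=> [mG G1] mF F1; apply: (LS2_mxL2 (lexx _)); split; first exact: measurable_mxfunM.
exact: le_lt_trans (LS2_norm_mul_le mG mF F1) G1.
Qed.

(** A representative is picked separately for each function, so [Y = hankel Phi F] need not equal
    the projection of [X = (Phi - Psi) F] pointwise. Inner products suffice: [Psi F] is orthogonal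
    to [Y], so the inner product of [X] with [Y] is the squared norm of [Y], and [X - Y] has
    nonnegative squared norm. *)
Lemma hankel_le Phi Psi F : LM p%:E Phi -> hardy_mx p%:E Psi -> hardy_mx q F ->
  (LS2_norm q F <= 1)%E ->
  (LS2_norm 2%:E (hankel Phi F) <= LM_norm p%:E (fun z => (Phi z - Psi z)%R))%E.
Proof.
move=> LPhi hPsi hF F1; have mF := hardy_mx_measurable hF.
have mD : measurable_mxfun (fun z => Phi z - Psi z).
  by apply: measurable_mxfunB (hardy_mx_measurable hPsi); case: LPhi.
have [Doo|Dfin] := eqVneq (LM_norm p%:E (fun z => Phi z - Psi z)) +oo%E.
  by rewrite Doo leey.
have LD : LM p%:E (fun z => Phi z - Psi z) by split=> //; rewrite ltey.
apply: le_trans (LS2_norm_mul_le mD mF F1).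
pose X z := (Phi z - Psi z) *m F z; pose Y := hankel Phi F.
have X2 : mxL2 X := mul_mxL2 LD mF F1; have P2 := mul_mxL2 LPhi mF F1.
have [hY Y0] := proj_minusP P2.
have Y2 : mxL2 Y by have [] := (hardy2_minusP Y).1 hY.
pose U z := Psi z *m F z.
have UE z : Phi z *m F z - X z = U z by rewrite /X mulmxBl subKr.
have U2 : mxL2 U.
  by move=> i j; have := mxL2B P2 X2 i j; under [X in L2 X -> _]eq_fun do rewrite UE.
have hU : hardy_mx 2%:E U.
  apply: hardy_from_hardy_mx; apply: (hardy_from_mul _ _ U2).
    by apply: (hardy_mx_hardy_from _ hPsi); rewrite lee_fin.
  exact: (hardy_mx_hardy_from (ltW q2) hF).
have UY : inner_L2 U Y = 0 by rewrite (inner_L2_conj Y2 U2) (hY.2 U hU) conjc0.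
have XY : inner_L2 X Y = inner_L2 Y Y.
  have e1 := Y0 Y hY; rewrite (inner_L2B P2 Y2 Y2) in e1.
  have e2 : inner_L2 (fun z => Phi z *m F z - X z) Y = 0.
    by rewrite -UY; apply: eq_cint => z; rewrite UE.
  rewrite (inner_L2B P2 X2 Y2) in e2.
  by move/subr0_eq: e1 => <-; move/subr0_eq: e2 => <-.
have := sqnorm_ge0 (fun z => X z - Y z).
rewrite (inner_L2_expand X2 Y2) XY (inner_L2_self Y2) => h.
have YX : sqnorm Y <= sqnorm X by move: (sqnorm X) (sqnorm Y) h => x y h; lra.
by rewrite (LS2_norm_sqrt X2) (LS2_norm_sqrt Y2) lee_fin; exact: ler_wsqrtr.
Qed.

Lemma hankel_norm_le_dist Phi : LM p%:E Phi ->
  (hankel_norm q Phi <= dist_hardy p%:E Phi)%E.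
Proof.
move=> LPhi; apply: le_ereal_inf_tmp => _ [Psi hPsi <-].
by apply: ge_ereal_sup => _ [F [hF F1] <-]; exact: hankel_le.
Qed.

End HankelUpperBound.

(** * Weighted distances as norms of Hankel images *)

Section AdmissibleMatrixWeights.
Context {R : realType} {n : nat}.
Local Notation C := R[i].
Local Notation T := (circle R).
Local Notation m := (circle_measure R).
Local Notation cRe := (@complex.Re R).
Local Notation M := 'M[C]_n.
Implicit Types F G X Y Phi Psi W : T -> M.

Variables (p : R) (q : \bar R).
Hypotheses (p2 : 2 <= p) (q2 : (2%:E < q)%E).
Hypothesis pq : ((p%:E)^-1 + q^-1 = (2%:E)^-1)%E.

Lemma ae_Lnorm_le1 (f g : T -> R) : measurable_fun setT f -> measurable_fun setT g ->
  (forall z, 0 <= f z) -> (forall z, 0 <= g z) -> {ae m, forall z, f z <= g z} ->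
  (Lnorm m q (fun z => (g z)%:E) <= 1)%E -> (Lnorm m q (fun z => (f z)%:E) <= 1)%E.
Proof.
move=> mf mg f0 g0 fg; have [[_ ->]|[r [-> _ r2 _ _]]] := exponents_cases p2 q2 pq.
  move=> /(Lnorm_y_le ler01 g0) g1; apply/(Lnorm_y_le ler01 f0).
  by apply: filterS2 fg g1 => z; exact: le_trans.
have r0 : 0 < r by lra.
move=> /(Lnorm_le r0 ler01 g0) g1; apply/(Lnorm_le r0 ler01 f0); apply: le_trans g1.
have mpow (h : T -> R) : measurable_fun setT h -> measurable_fun setT (fun z => (h z `^ r)%:E).
  by move=> mh; apply/measurable_EFinP; exact: measurable_powR_comp.
apply: ae_ge0_le_integral.
- exact: measurableT.
- by move=> z _; rewrite lee_fin powR_ge0.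
- exact: mpow.
- by move=> z _; rewrite lee_fin powR_ge0.
- exact: mpow.
- apply: filterS fg => z fg _; rewrite lee_fin; apply: ge0_ler_powR; rewrite ?nnegrE//.
  exact: ltW.
Qed.

Definition admissible_weight (k : R) W :=
  (exists K, weight k K W) /\ admissible q (fun z => cRe (\tr (W z))).

Lemma weight_trace_ge0 k K W z : 0 <= k -> weight k K W -> 0 <= cRe (\tr (W z)).
Proof.
move=> k0 [_ _ _ Wk]; have := Wk z 1%:M; rewrite /qform mul1mx adj1 mulmx1.
by apply: le_trans; rewrite mulr_ge0// sqr_ge0.
Qed.

Lemma measurable_cRe_trace W : measurable_mxfun W ->
  measurable_fun setT (fun z => cRe (\tr (W z))).
Proof.
move=> mW; have [] : measurable_cfun (fun z => \tr (W z)) => //.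
by apply: measurable_cfun_sum => i _; exact: mW.
Qed.

(* Multiplication by the spectral factor [F] of [W] turns the weighted distance
   to [H^2] into the norm of a Hankel image: if [Y = H_Phi F], then
   [Psi = (Phi F - Y) F^-1] is analytic and [(Phi - Psi) F = Y]. *)
Lemma admissible_weight_dist (k : R) W Phi (c : R) : 0 < k -> admissible_weight k W ->
  LM p%:E Phi -> (hankel_norm q Phi <= c%:E)%E ->
  0 <= c /\ exists2 Psi, hardy_from 0 Psi & wnorm W (fun z => Phi z - Psi z) <= c ^+ 2.
Proof.
move=> k0 [[K wW] Wadm] LPhi Nc; have [mW _ _ _] := wW.
have [F [E [b [hF hE FE]]]] := spectral_factor k0 wW.
have [F2 F0] := (hardy_fromP 0 F).1 hF; have mF := mxL2_measurable F2.
have mE := mxL2_measurable ((hardy_fromP 0 E).1 hE).1.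
have FW : {ae m, forall z, hs_norm (F z) <= Num.sqrt (cRe (\tr (W z)))}.
  apply: filterS FE => z [<- _ _ _ _]; rewrite mxtrace_mul_adj /=.
  by rewrite sqrtr_sqr ler_norm.
have F1 : (LS2_norm q F <= 1)%E.
  apply: ae_Lnorm_le1 (measurable_hs_norm mF) _ _ _ FW Wadm.
  - exact: measurable_sqrt_comp (measurable_cRe_trace mW).
  - by move=> z; exact: hs_norm_ge0.
  - by move=> z; exact: sqrtr_ge0.
have hqF : hardy_mx q F.
  move=> i j; split; last by move=> l; exact: F0.
  split; first exact: mF.
  apply: le_lt_trans (ltry 1); apply: ae_Lnorm_le1 F1.
  - exact: measurable_normc (mF i j).
  - exact: measurable_hs_norm.
  - by move=> z; exact: normc_nneg.
  - by move=> z; exact: hs_norm_ge0.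
  - by apply: aeW => z; exact: entry_le_hs_norm.
have P2 := mul_mxL2 p2 q2 pq LPhi mF F1.
pose Y := hankel Phi F; have [hY Y0] := proj_minusP P2.
have Y2 : mxL2 Y by have [] := (hardy2_minusP Y).1 hY.
have YN : (LS2_norm 2%:E Y <= c%:E)%E.
  by apply: le_trans Nc; apply: ereal_sup_ubound; exists F.
have c0 : 0 <= c by move: YN; rewrite LS2_norm_sqrt// lee_fin; apply: le_trans; exact: sqrtr_ge0.
split=> //; move/(LS2_norm_le Y2 c0): YN => YN.
pose V z := Phi z *m F z - Y z; have V2 : mxL2 V by exact: mxL2B.
have hV : hardy_from 0 V.
  apply/hardy_fromP; split=> // i j l l0.
  (* Monomials of negative degree belong to [H^2_-], so orthogonality to them removes the negative
     coefficients of [V]. *)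
  rewrite fourier_coefE -(Y0 (monomial l i j)).
    by apply: eq_cint => z; rewrite -adj_monomial.
  split; first exact: mxL2_LS2 (mxL2_monomial _ _ _).
  move=> G hG; have G2 := (hardy_fromP 0 G).1 (hardy_mx_hardy_from (lexx _) hG).
  rewrite (inner_L2_conj G2.1 (mxL2_monomial l i j)) -[RHS]conjc0; congr conjc.
  rewrite -(G2.2 i j l l0) fourier_coefE.
  by apply: eq_cint => z; rewrite -adj_monomial.
have VE2 : mxL2 (fun z => V z *m E z).
  by apply: (ae_mxL2_mulr mE _ V2); apply: filterS FE => z [_ _ _ _ Eb]; exact: Eb.
exists (fun z => V z *m E z); first exact: hardy_from_mul.
apply: le_trans YN; rewrite le_eqVlt; apply/orP; left; apply/eqP.
have D2 : mxL2 (fun z => Phi z - V z *m E z).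
  by apply: mxL2B => //; apply: (LM_mxL2 _ LPhi); rewrite lee_fin.
rewrite /wnorm /sqnorm /Rintegral; congr fine; apply: ae_eq_integral.
- exact: measurableT.
- exact: measurable_int (weight_integrable wW D2).
- exact: measurable_int (sqr_hs_norm_integrable Y2).
- apply: filterS FE => z [WE FE1 EF1 _ _] _; congr EFin.
  rewrite /qform -WE mulmxA -(mulmxA _ (adj _)) -adjM mxtrace_mul_adj /=.
  by rewrite mulmxBl -mulmxA EF1 mulmx1 /V subKr.
Qed.

End AdmissibleMatrixWeights.

(** * One analytic function for all weights *)

Section HankelLowerBound.
Context {R : realType} {n : nat}.
Local Notation C := R[i].
Local Notation T := (circle R).
Local Notation m := (circle_measure R).
Local Notation cRe := (@complex.Re R).
Local Notation M := 'M[C]_n.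
Implicit Types F G X Y Phi Psi V W : T -> M.

Variables (p : R) (q : \bar R).
Hypotheses (p2 : 2 <= p) (q2 : (2%:E < q)%E).
Hypothesis pq : ((p%:E)^-1 + q^-1 = (2%:E)^-1)%E.

Definition conv_weight (t : R) V W : T -> M :=
  fun z => t%:C%C *: V z + (1 - t)%:C%C *: W z.

Lemma qform_conv (t : R) V W z (X : M) :
  qform (conv_weight t V W z) X = t * qform (V z) X + (1 - t) * qform (W z) X.
Proof.
rewrite /qform /conv_weight mulmxDr mulmxDl -!scalemxAr -!scalemxAl raddfD /=.
by rewrite !mxtraceZ cReD !cRe_real_mul.
Qed.

Lemma trace_conv (t : R) V W z :
  cRe (\tr (conv_weight t V W z)) = t * cRe (\tr (V z)) + (1 - t) * cRe (\tr (W z)).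
Proof. by rewrite /conv_weight raddfD /= !mxtraceZ cReD !cRe_real_mul. Qed.

Lemma weight_conv (t k1 k2 K1 K2 : R) V W : 0 <= t <= 1 -> weight k1 K1 V -> weight k2 K2 W ->
  weight (t * k1 + (1 - t) * k2) (t * K1 + (1 - t) * K2) (conv_weight t V W).
Proof.
move=> /andP[t0 t1] [mV hV V1 Vk] [mW hW W1 Wk].
have u0 : 0 <= 1 - t by rewrite subr_ge0.
split.
- move=> i j; rewrite /conv_weight; under [X in measurable_cfun X]eq_fun do rewrite !mxE.
  by apply: measurable_cfunD; apply: measurable_cfunM => //; exact: measurable_cfun_cst.
- by move=> z; rewrite /conv_weight adjD !adjZ !conjc_real hV hW.
- move=> z i j; rewrite /conv_weight !mxE.
  apply: le_trans (le_normcD _ _) _; rewrite !normcM !normc_real !ger0_norm//.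
  by apply: lerD; apply: ler_wpM2l.
- move=> z X; rewrite qform_conv mulrDl -!mulrA.
  by apply: lerD; apply: ler_wpM2l.
Qed.

Lemma admissible_weight_conv (t k : R) V W : 0 <= t <= 1 -> 0 <= k ->
  admissible_weight q k V -> admissible_weight q k W ->
  admissible_weight q k (conv_weight t V W).
Proof.
move=> t01 k0 [[K1 wV] aV] [[K2 wW] aW]; split.
  exists (t * K1 + (1 - t) * K2); have := weight_conv t01 wV wW.
  by rewrite -mulrDl addrC subrK mul1r.
under eq_fun do rewrite trace_conv.
have mt X K : weight k K X -> measurable_fun setT (fun z => cRe (\tr (X z))).
  by move=> [mX _ _ _]; exact: measurable_cRe_trace.
apply: (admissible_conv p2 q2 pq t01 (mt _ _ wV) (mt _ _ wW)) => //.
- by move=> z; exact: weight_trace_ge0 wV.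
- by move=> z; exact: weight_trace_ge0 wW.
Qed.

Lemma wnorm_conv (t k1 k2 K1 K2 : R) V W X : 0 <= t <= 1 ->
  weight k1 K1 V -> weight k2 K2 W -> mxL2 X ->
  wnorm (conv_weight t V W) X = t * wnorm V X + (1 - t) * wnorm W X.
Proof.
move=> t01 wV wW X2.
have iV := weight_integrable wV X2; have iW := weight_integrable wW X2.
rewrite -(RintegralZl t measurableT iV) -(RintegralZl (1 - t) measurableT iW).
rewrite -(RintegralD measurableT (integrable_scaleR t iV) (integrable_scaleR (1 - t) iW)).
by apply: eq_Rintegral => z _; rewrite qform_conv.
Qed.

(** All weights of the class dominate the same [k], so the modulus [k / 4] is common to them; [V]
    witnesses that the class is nonempty. The Hankel norm enters through [admissible_weight_dist],
    which bounds the distance for each single weight. *)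
Lemma admissible_weight_minimax (k : R) V Phi (c : R) : 0 < k -> admissible_weight q k V ->
  LM p%:E Phi -> (hankel_norm q Phi <= c%:E)%E ->
  exists2 Psi, hardy_from 0 Psi &
    forall W, admissible_weight q k W -> wnorm W (fun z => Phi z - Psi z) <= c ^+ 2.
Proof.
move=> k0 aV LPhi Nc; have Phi2 : mxL2 Phi by apply: (LM_mxL2 _ LPhi); rewrite lee_fin.
have H2 F : hardy_from 0 F -> mxL2 F by case.
apply: (@strongly_convex_minimax R (T -> M) (hardy_from 0) midpoint
  (fun F G => sqnorm (fun z => F z - G z)) (k / 4) _ _ _ _ _ _ _ (T -> M)
  (admissible_weight q k) conv_weight (fun W F => wnorm W (fun z => Phi z - F z))).
- exists (fun=> 0); exact: annih0.
- by rewrite divr_gt0.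
- by move=> F G; exact: (annih_midpoint (@hardy_from_mxL2 _ _ 0)).
- by move=> u; exact: (annih_complete (@hardy_from_mxL2 _ _ 0)).
- by move=> F G; exact: sqnormC.
- move=> F G H hF hG hH.
  have := sqnormD (mxL2B (H2 F hF) (H2 G hG)) (mxL2B (H2 G hG) (H2 H hH)).
  by rewrite (_ : (fun z => _ + _) = fun z => F z - H z)//; apply: funext => z; rewrite addrA subrK.
- by move=> F G; exact: sqnorm_ge0.
- by exists V.
- by move=> t V1 V2 t01; apply: admissible_weight_conv => //; exact: ltW.
- move=> t V1 V2 F t01 [[K1 w1] _] [[K2 w2] _] hF.
  exact: (wnorm_conv t01 w1 w2 (mxL2B Phi2 (H2 F hF))).
- move=> W [[K wW] _]; exact: (wdist_strongly_convex _ k0 wW Phi2).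
- by move=> W aW; have [_] := admissible_weight_dist p2 q2 pq k0 aW LPhi Nc.
Qed.

End HankelLowerBound.

(** * Recovering the [L^p] norm from the weights *)

Section TestWeights.
Context {R : realType} {n : nat}.
Local Notation C := R[i].
Local Notation T := (circle R).
Local Notation m := (circle_measure R).
Local Notation cRe := (@complex.Re R).
Local Notation M := 'M[C]_n.
Implicit Types F G X Y Phi Psi V W : T -> M.

Variables (p : R) (q : \bar R).
Hypotheses (p2 : 2 <= p) (q2 : (2%:E < q)%E).
Hypothesis pq : ((p%:E)^-1 + q^-1 = (2%:E)^-1)%E.

Definition rank1_weight (N : T -> nat) (s : T -> R) : T -> M :=
  fun z => (s z)%:C%C *: (ball_enum n (N z) *m adj (ball_enum n (N z))).

Lemma qform_rank1_weight (N : T -> nat) (s : T -> R) z X : qform (rank1_weight N s z) (X z) =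
  s z * hs_norm (X z *m ball_enum n (N z)) ^+ 2.
Proof.
rewrite -qform_rank1 /qform /rank1_weight -!scalemxAr -!scalemxAl mxtraceZ.
by rewrite cRe_real_mul.
Qed.

Lemma trace_rank1_weight N s z : 0 <= s z -> 0 <= cRe (\tr (rank1_weight N s z)) <= s z.
Proof.
move=> s0; rewrite /rank1_weight mxtraceZ cRe_real_mul mxtrace_mul_adj /=.
rewrite mulr_ge0 ?sqr_ge0//= ler_piMr// exprn_ile1 ?hs_norm_ge0//.
exact: ball_enum_le1.
Qed.

Lemma rank1_weightP (N : T -> nat) (s : T -> R) (K : R) :
  (forall f : nat -> R, measurable_fun setT (f \o N)) ->
  measurable_fun setT s -> (forall z, 0 <= s z <= K) -> weight 0 K (rank1_weight N s).
Proof.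
move=> mN ms sK.
have mx (g : nat -> C) : measurable_cfun (fun z => g (N z)).
  by split; [exact: (mN (fun l => cRe (g l)))|exact: (mN (fun l => complex.Im (g l)))].
split.
- move=> i j; rewrite /rank1_weight; under [X in measurable_cfun X]eq_fun do rewrite mxE.
  apply: measurable_cfunM; first exact: measurable_cfun_real.
  exact: (mx (fun l => (ball_enum n l *m adj (ball_enum n l)) i j)).
- by move=> z; rewrite /rank1_weight adjZ adjM adjK conjc_real.
- move=> z i j; rewrite /rank1_weight mxE normcM normc_real; have /andP[s0 s1] := sK z.
  rewrite ger0_norm//; apply: le_trans s1; rewrite ler_piMr//.
  exact: rank1_entry_le1 (ball_enum_le1 _ _).
- move=> z X; rewrite mul0r (qform_rank1_weight N s z (fun=> X)).
  by rewrite mulr_ge0 ?sqr_ge0//; case/andP: (sK z).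
Qed.

(* The successor covers the case [n = 0]. *)
Definition floor_weight : T -> M := fun=> (n.+1%:R^-1)%:C%C *: 1%:M.

Lemma floor_weightP : weight n.+1%:R^-1 n.+1%:R^-1 floor_weight.
Proof.
have n0 : (0 : R) <= n.+1%:R^-1 by rewrite invr_ge0 ler0n.
split.
- by move=> i j; exact: measurable_cfun_cst.
- by move=> z; rewrite /floor_weight adjZ adj1 conjc_real.
- move=> z i j; rewrite /floor_weight mxE normcM normc_real ger0_norm//.
  by rewrite ler_piMr// mxE; case: (i == j); rewrite ?normc1// normc0.
- move=> z X; rewrite -qform1 /qform /floor_weight -scalemxAr -scalemxAl mxtraceZ.
  by rewrite cRe_real_mul.
Qed.

Lemma trace_floor_weight z : 0 <= cRe (\tr (floor_weight z)) <= 1.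
Proof.
rewrite /floor_weight mxtraceZ cRe_real_mul mxtrace1 cRe_nat.
by rewrite mulr_ge0 ?invr_ge0 ?ler0n//= mulrC ler_pdivrMr ?ltr0Sn// mul1r ler_nat.
Qed.

(** The share [1 - t] of [floor_weight] gives the rank one weight the lower bound
    [(1 - t) / n.+1%:R] that the class demands. *)
Definition test_weight (t : R) N s : T -> M := conv_weight t (rank1_weight N s) floor_weight.

Lemma test_weight_admissible (t K : R) (N : T -> nat) (s : T -> R) : 0 <= t <= 1 ->
  (forall f : nat -> R, measurable_fun setT (f \o N)) ->
  measurable_fun setT s -> (forall z, 0 <= s z <= K) -> admissible q s ->
  admissible_weight q ((1 - t) / n.+1%:R) (test_weight t N s).
Proof.
move=> t01 mN ms sK sadm; have s0 z : 0 <= s z by case/andP: (sK z).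
have := weight_conv t01 (rank1_weightP mN ms sK) floor_weightP.
rewrite mulr0 add0r => wt; split; first by exists (t * K + (1 - t) * n.+1%:R^-1).
have m1 : measurable_fun setT (fun z : T => 1 : R) := measurable_cst _.
have [mt _ _ _] := wt; have /andP[t0 t1] := t01; have u0 : 0 <= 1 - t by rewrite subr_ge0.
(* The trace is at most [t * s + (1 - t)], a convex combination of the admissible weights [s] and
   1. *)
apply: (le_admissible p2 q2 pq) (admissible_conv p2 q2 pq t01 ms m1 s0 (fun=> ler01) sadm _).
- exact: measurable_cRe_trace.
- apply: measurable_funD; first by apply: measurable_funM => //; exact: measurable_cst.
  exact: measurable_cst.
- move=> z; rewrite trace_conv; have /andP[a b] := trace_rank1_weight N (s0 z).
  have /andP[a' b'] := trace_floor_weight z.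
  rewrite (addr_ge0 (mulr_ge0 t0 a) (mulr_ge0 u0 a')) /=.
  exact: lerD (ler_wpM2l t0 b) (ler_wpM2l u0 b').
- exact: (admissible1 p2 q2 pq).
Qed.

Lemma test_weight_nonempty (t : R) : 0 <= t <= 1 ->
  admissible_weight q ((1 - t) / n.+1%:R) (test_weight t (fun=> 0%N) (fun=> 0)).
Proof.
move=> t01; apply: (@test_weight_admissible t 0) => //.
- by move=> f; exact: measurable_cst.
- by move=> z; rewrite lexx.
- apply: (le_admissible p2 q2 pq) (admissible1 p2 q2 pq) => //; try exact: measurable_cst.
  by move=> z; rewrite lexx ler01.
Qed.

(** There are two losses: discarding the floor term costs [t], and the selected vectors norm [X] up
    to the factor [u], which enters squared. *)
Lemma LM_norm_le_of_weights X (t u c : R) : mxL2 X -> 0 < t < 1 -> 0 < u < 1 ->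
  (forall W, admissible_weight q ((1 - t) / n.+1%:R) W -> wnorm W X <= c ^+ 2) ->
  (LM_norm p%:E X <= (Num.sqrt (c ^+ 2 / (t * u ^+ 2)))%:E)%E.
Proof.
move=> X2 /andP[t0 t1] /andP[u0 u1] Wc; have mX := mxL2_measurable X2.
have d01 : 0 < 1 - u < 1 by apply/andP; split; lra.
have [N [mN XN]] := norming_selection mX d01.
have t01 : 0 <= t <= 1 by rewrite !ltW.
have tu0 : 0 < t * u ^+ 2 by rewrite mulr_gt0// exprn_gt0.
have opi : m.-integrable setT (EFin \o (fun z => op_norm (X z) ^+ 2)).
  apply: ge_integrable (integrable_scaleR n%:R (sqr_hs_norm_integrable X2)).
    by apply: measurable_funX; exact: measurable_op_norm.
  by move=> z; rewrite ger0_norm ?sqr_ge0//; exact: sqr_op_norm_le_hs.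
apply: (Lnorm_le_of_admissible p2 q2 pq (measurable_op_norm mX)
  (fun z => op_norm_ge0 (X z)) _ opi).
  by rewrite divr_ge0 ?sqr_ge0// ltW.
move=> s ms s0 [K sK] sadm.
have s0K z : 0 <= s z <= K by rewrite s0 sK.
have aW := test_weight_admissible t01 mN ms s0K sadm; have [[K' wW] _] := aW.
have si : m.-integrable setT (EFin \o (fun z => s z * op_norm (X z) ^+ 2)).
  apply: ge_integrable (integrable_scaleR K opi).
    by apply: measurable_funM => //; apply: measurable_funX; exact: measurable_op_norm.
  move=> z; rewrite (ger0_norm (mulr_ge0 (s0 z) (sqr_ge0 _))).
  exact: (ler_wpM2r (sqr_ge0 _) (sK z)).
rewrite ler_pdivlMr// mulrC; apply: le_trans (Wc _ aW).
rewrite -(RintegralZl _ measurableT si); apply: le_Rintegral.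
- exact: measurableT.
- exact: integrable_scaleR.
- exact: (weight_integrable wW X2).
- move=> z _; rewrite /test_weight qform_conv qform_rank1_weight.
  have fl : 0 <= (1 - t) * qform (floor_weight z) (X z).
    have [_ _ _ Wk] := floor_weightP.
    rewrite mulr_ge0 ?subr_ge0 ?(ltW t1)//; apply: le_trans (Wk z (X z)).
    by rewrite mulr_ge0 ?invr_ge0 ?ler0n ?sqr_ge0.
  have XNz := XN z; rewrite subKr in XNz.
  apply: (@le_trans _ _ (t * (s z * hs_norm (X z *m ball_enum n (N z)) ^+ 2))); last first.
    by rewrite lerDl.
  rewrite -mulrA ler_wpM2l ?(ltW t0)// mulrCA ler_wpM2l// -exprMn ler_sqr ?nnegrE//.
  - by rewrite mulr_ge0 ?op_norm_ge0// ltW.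
  - exact: hs_norm_ge0.
Qed.

End TestWeights.

(** * The lower bound *)

Section HankelNorm.
Context {R : realType} {n : nat}.
Local Notation C := R[i].
Local Notation T := (circle R).
Local Notation m := (circle_measure R).
Local Notation M := 'M[C]_n.
Implicit Types F G X Y Phi Psi V W : T -> M.

Variables (p : R) (q : \bar R).
Hypotheses (p2 : 2 <= p) (q2 : (2%:E < q)%E).
Hypothesis pq : ((p%:E)^-1 + q^-1 = (2%:E)^-1)%E.

Lemma powRD_le (a b : R) : 0 <= a -> 0 <= b ->
  (a + b) `^ p <= 2 `^ p * (a `^ p + b `^ p).
Proof.
move=> a0 b0; have p0 := ltW (exponent_gt0 p2).
wlog ab : a b a0 b0 / a <= b.
  by move=> h; case/orP: (le_total a b) => ?; [|rewrite addrC [X in _ * X]addrC]; exact: h.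
apply: (@le_trans _ _ ((2 * b) `^ p)); last first.
  by rewrite powRM// ler_wpM2l ?powR_ge0// lerDr powR_ge0.
by apply: ge0_ler_powR; rewrite ?nnegrE ?addr_ge0 ?mulr_ge0//; lra.
Qed.

(** This upgrades the [H^2] function supplied by the minimax to a competitor in [dist_hardy]: its
    entries are dominated by the norms of [Phi] and [Phi - Psi]. *)
Lemma LM_hardy_mx Phi Psi : LM p%:E Phi -> hardy_from 0 Psi ->
  (LM_norm p%:E (fun z => (Phi z - Psi z)%R) < +oo)%E -> hardy_mx p%:E Psi.
Proof.
move=> [mPhi Phi1] hPsi X1; have [Psi2 Psi0] := (hardy_fromP 0 Psi).1 hPsi.
have mPsi := mxL2_measurable Psi2; have p0 := exponent_gt0 p2.
have mX : measurable_mxfun (fun z => Phi z - Psi z) := measurable_mxfunB mPhi mPsi.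
move=> i j; split; last by move=> k; exact: Psi0.
split; first exact: mPsi.
pose a z := op_norm (Phi z); pose b z := op_norm (Phi z - Psi z).
have a0 z : 0 <= a z := op_norm_ge0 _; have b0 z : 0 <= b z := op_norm_ge0 _.
have mpow (f : T -> R) : measurable_fun setT f -> measurable_fun setT (fun z => f z `^ p).
  exact: measurable_powR_comp.
have fin (f : T -> R) : measurable_fun setT f -> (forall z, 0 <= f z) ->
    (Lnorm m p%:E (fun z => (f z)%:E) < +oo)%E ->
    m.-integrable setT (EFin \o (fun z => f z `^ p)).
  move=> mf f0 /(Lnorm_lty p0 f0) fp; apply/integrableP; split.
    by apply/measurable_EFinP; exact: mpow.
  by under eq_integral do rewrite /= ger0_norm ?powR_ge0//.
have ai := fin a (measurable_op_norm mPhi) a0 Phi1.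
have bi := fin b (measurable_op_norm mX) b0 X1.
have mPsij := measurable_normc (mPsi i j).
apply/(Lnorm_lty p0 (fun z => normc_nneg (Psi z i j))).
have le z : normc (Psi z i j) `^ p <= (n%:R `^ p * 2 `^ p) * (a z `^ p + b z `^ p).
  rewrite -mulrA; apply: (@le_trans _ _ (n%:R `^ p * (a z + b z) `^ p)); last first.
    exact: (ler_wpM2l (powR_ge0 _ _) (powRD_le (a0 z) (b0 z))).
  have ab0 := addr_ge0 (a0 z) (b0 z).
  have le1 (A : M) : normc (A i j) <= n%:R * op_norm A.
    exact: le_trans (entry_le_hs_norm _ _ _) (hs_norm_le_op _).
  have le2 : normc (Psi z i j) <= n%:R * (a z + b z).
    have -> : Psi z i j = Phi z i j - (Phi z - Psi z) i j by rewrite !mxE subKr.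
    apply: le_trans (le_normcD _ _) _; rewrite normcN mulrDr.
    exact: lerD (le1 _) (le1 _).
  rewrite -(powRM _ (ler0n _ _) ab0).
  exact: (ge0_ler_powR (ltW p0) (normc_nneg _) (mulr_ge0 (ler0n _ _) ab0) le2).
have li := integrable_scaleR (n%:R `^ p * 2 `^ p) (integrable_addR ai bi).
have Psii : m.-integrable setT (EFin \o (fun z => normc (Psi z i j) `^ p)).
  apply: ge_integrable li; first exact: mpow.
  by move=> z; rewrite ger0_norm ?powR_ge0.
have /fineK <- := integrable_fin_num measurableT Psii; exact: ltry.
Qed.

Lemma dist_le_hankel_norm Phi : LM p%:E Phi ->
  (dist_hardy p%:E Phi <= hankel_norm q Phi)%E.
Proof.
move=> LPhi.
have hle (c : R) : (hankel_norm q Phi <= c%:E)%E -> forall e, 0 < e ->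
    (dist_hardy p%:E Phi <= ((1 + e) * c)%:E)%E.
  (* With [t = u ^+ 2 = (1 + e)^-1] the two losses multiply to [(1 + e) ^- 2], whose effect under
     the square root is the factor [1 + e]. The function [Psi] may depend on [e], since [dist_hardy]
     is an infimum. *)
  move=> Nc e e0; pose u := Num.sqrt ((1 + e)^-1).
  have e1 : 0 < 1 + e by lra.
  have ei : 0 < (1 + e)^-1 by rewrite invr_gt0.
  have ei1 : (1 + e)^-1 < 1 by rewrite invf_lt1//; lra.
  have u2 : u ^+ 2 = (1 + e)^-1 by rewrite sqr_sqrtr// ltW.
  have u01 : 0 < u < 1.
    by rewrite sqrtr_gt0 ei/= -[ltRHS]sqrtr1 ltr_sqrt.
  have t01 : 0 < (1 + e)^-1 < 1 by rewrite ei ei1.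
  have k0 : 0 < (1 - (1 + e)^-1) / n.+1%:R :> R by rewrite divr_gt0 ?subr_gt0 ?ltr0Sn.
  have t01' : 0 <= (1 + e)^-1 <= 1 by rewrite !ltW.
  have aV := test_weight_nonempty (n := n) p2 q2 pq t01'.
  have [c0 _] := admissible_weight_dist p2 q2 pq k0 aV LPhi Nc.
  have [Psi hPsi Psic] := admissible_weight_minimax p2 q2 pq k0 aV LPhi Nc.
  have Phi2 : mxL2 Phi by apply: (LM_mxL2 _ LPhi); rewrite lee_fin.
  have X2 := mxL2B Phi2 ((hardy_fromP 0 Psi).1 hPsi).1.
  have := LM_norm_le_of_weights p2 q2 pq X2 t01 u01 Psic.
  rewrite u2 -invfM invrK -expr2 -exprMn sqrtr_sqr ger0_norm; last first.
    by rewrite mulr_ge0// ltW.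
  rewrite mulrC => Xc; apply: (le_trans _ Xc); apply: ereal_inf_lbound.
  exists Psi => //; apply: (LM_hardy_mx LPhi hPsi); exact: le_lt_trans Xc (ltry _).
have d0 : (0 <= dist_hardy p%:E Phi)%E.
  by apply: le_ereal_inf_tmp => _ [Psi _ <-]; exact: Lnorm_ge0.
case NE : (hankel_norm q Phi) => [c| |]; last first.
(* The value [-oo] is excluded: it would satisfy the bound with [c = -1] and make the distance
   negative. *)
- have Nm : (hankel_norm q Phi <= (-1)%:E)%E by rewrite NE; exact: leNye.
  have := le_trans d0 (hle _ Nm 1 ltr01); rewrite lee_fin mulrN1 oppr_ge0 leNgt.
  by rewrite addr_gt0.
- exact: leey.
have Nc : (hankel_norm q Phi <= c%:E)%E by rewrite NE.
move: d0 (hle c Nc); case: (dist_hardy p%:E Phi) => [d| |] d0 h; last by [].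
- by rewrite lee_fin; apply: le_eps_mul => e e0; rewrite -lee_fin; exact: h.
- by have := h 1 ltr01; rewrite leye_eq.
Qed.

End HankelNorm.
Theorem theorem6p1 (R : realType) (n : nat) (p : R) (q : \bar R)
    (Phi : circle R -> 'M[R[i]]_n) :
  2 <= p -> (2%:E < q)%E -> ((p%:E)^-1 + q^-1 = (2%:E)^-1)%E ->
  LM p%:E Phi ->
  hankel_norm q Phi = dist_hardy p%:E Phi.
Proof.
move=> p2 q2 pq LPhi; apply/eqP; rewrite eq_le.
by rewrite (hankel_norm_le_dist p2 q2 pq LPhi) (dist_le_hankel_norm p2 q2 pq LPhi).
Qed.
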